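(* Let $q$ be an odd prime power and let $G=\mathrm{PSL}(2,q)$ or $G=\mathrm{PGL}(2,q)$. Then for every integer $k\ge 4$ the extended product replacement algorithm graph $\tilde\Gamma_k(G)$ is connected.
   Context: For a finite group $G$ and an integer $k\ge d(G)$ (the minimal number of generators of $G$), let $V_k(G)=\{(g_1,\dots,g_k)\in G^k:\langle g_1,\dots,g_k\rangle=G\}$ be the set of generating $k$-tuples. The extended product replacement algorithm (PRA) graph $\tilde\Gamma_k(G)$ has vertex set $V_k(G)$, with edges joining each tuple to its images under the Nielsen moves, for $1\le i\ne j\le k$: $R_{i,j}^{\pm}$ replaces $g_i$ by $g_ig_j^{\pm1}$; $L_{i,j}^{\pm}$ replaces $g_i$ by $g_j^{\pm1}g_i$; $P_{i,j}$ interchanges $g_i$ and $g_j$; $I_i$ replaces $g_i$ by $g_i^{-1}$ (all other entries unchanged). *)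

(* Defs.v *)
From mathcomp Require Import all_boot all_order all_algebra all_fingroup all_solvable.

Set Implicit Arguments.
Unset Strict Implicit.
Unset Printing Implicit Defensive.

Import GroupScope.

Section NielsenMoves.

Variables (gT : finGroupType) (k : nat).
Implicit Types (g : {ffun 'I_k -> gT}) (i j : 'I_k).

Definition upd g i (x : gT) : {ffun 'I_k -> gT} :=
  [ffun l => if l == i then x else g l].

(* In order: R_{i,j}^+, R_{i,j}^-, L_{i,j}^+, L_{i,j}^-, P_{i,j}, I_i. *)
Definition nielsen_moves g i j : seq {ffun 'I_k -> gT} :=
  [:: upd g i (g i * g j);
      upd g i (g i * (g j)^-1);
      upd g i (g j * g i);
      upd g i ((g j)^-1 * g i);
      [ffun l => g (tperm i j l)];
      upd g i (g i)^-1].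

Lemma nielsen_moves_sym g h i j :
  i != j -> h \in nielsen_moves g i j -> g \in nielsen_moves h i j.
Proof.
move=> nij gh.
have nji : (j == i) = false by rewrite eq_sym (negbTE nij).
have undo z z' : h = upd g i z ->
    (h i = z -> h j = g j -> z' = g i) -> g = upd h i z'.
  move=> eh ->; rewrite ?eh ?ffunE ?eqxx ?nji //.
  by apply/ffunP=> l; rewrite !ffunE; case: eqP => [->|].
move: gh; rewrite !inE.
case/or4P => [/eqP eh | /eqP eh | /eqP eh | /or3P[/eqP eh | /eqP eh | /eqP eh]].
- suff <- : g = upd h i (h i * (h j)^-1) by rewrite eqxx !orbT.
  by apply: (undo _ _ eh) => -> ->; rewrite mulgK.
- suff <- : g = upd h i (h i * h j) by rewrite eqxx.
  by apply: (undo _ _ eh) => -> ->; rewrite mulgKV.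
- suff <- : g = upd h i ((h j)^-1 * h i) by rewrite eqxx !orbT.
  by apply: (undo _ _ eh) => -> ->; rewrite mulKg.
- suff <- : g = upd h i (h j * h i) by rewrite eqxx !orbT.
  by apply: (undo _ _ eh) => -> ->; rewrite mulKVg.
- suff <- : g = [ffun l => h (tperm i j l)] by rewrite eqxx !orbT.
  by apply/ffunP=> l; rewrite eh !ffunE tpermK.
- suff <- : g = upd h i (h i)^-1 by rewrite eqxx !orbT.
  by apply: (undo _ _ eh) => -> _; rewrite invgK.
Qed.

End NielsenMoves.

Section ExtendedPRAGraph.

Variables (gT : finGroupType) (k : nat).

(* The equation forces every entry to lie in G. *)
Definition generating_tuple (G : {set gT}) (g : {ffun 'I_k -> gT}) : bool :=
  <<[set g i | i : 'I_k]>> == G.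

Definition pra_vertex (G : {set gT}) : finType :=
  {g : {ffun 'I_k -> gT} | generating_tuple G g}.

Definition pra_edge (G : {set gT}) : rel (pra_vertex G) :=
  fun x y =>
    [exists i : 'I_k, exists j : 'I_k,
       (i != j) && (val y \in nielsen_moves (val x) i j)].

(* The inverse of a Nielsen move is a Nielsen move, so the graph is undirected
   and [connect pra_edge] is the relation of lying in one component. *)
Lemma pra_edge_sym (G : {set gT}) : symmetric (@pra_edge G).
Proof.
suff H x y : @pra_edge G x y -> @pra_edge G y x.
  by move=> x y; apply/idP/idP; apply: H.
case/existsP=> i /existsP[j /andP[nij hy]]; apply/existsP; exists i.
by apply/existsP; exists j; rewrite nij nielsen_moves_sym.
Qed.

End ExtendedPRAGraph.

(* For a symmetric [e]; the empty graph is not regarded as connected. *)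
Definition connected_graph (T : finType) (e : rel T) : Prop :=
  0 < #|T| /\ forall x y : T, connect e x y.

Definition extended_PRA_connected (gT : finGroupType) (G : {set gT}) (k : nat)
  : Prop := connected_graph (@pra_edge gT k G).

Section ProjectiveLinearGroups.

Variable F : finFieldType.

Definition SL2 : {set {'GL_2[F]}} :=
  [set u : {'GL_2[F]} | (\det u == 1)%R].

Lemma SL2_group_set : group_set SL2.
Proof.
apply/group_setP; split=> [|u v]; rewrite !inE.
  by rewrite GL_1E det1.
by rewrite GL_ME => /eqP du /eqP dv; rewrite det_mulmx du dv GRing.mulr1.
Qed.

Canonical SL2_group : {group {'GL_2[F]}} := Group SL2_group_set.

Definition PSL2 : {group coset_of 'Z(SL2)} := (SL2 / 'Z(SL2))%G.

Definition PGL2 : {group coset_of 'Z('GL_2[F])} := ('GL_2[F] / 'Z('GL_2[F]))%G.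

End ProjectiveLinearGroups.

(* Main.v *)
Require Import Defs.
From mathcomp Require Import all_boot all_order all_algebra all_fingroup all_solvable.
From mathcomp Require Import all_field.
From mathcomp Require Import zify ring.
From Stdlib Require Import Classical.

(* A Nielsen move multiplies an entry of a generating list by an element generated by the
   other entries. Let [G] lie between PSL(2,F) and PGL(2,F), acting on the projective line
   over an extension of [F] over which all quadratics of [F] split, so that each element of
   [G] has a fixed point. As in Dickson's classification, counting the orbits of points
   with a nontrivial stabiliser shows that a subgroup of [G] preserving no set of at most two
   points has order 12, 24 or 60, or lies between conjugates of PSL(2,K) and PGL(2,K) for a
   subfield [K].

   Nielsen moves reach a pair of entries without a common fixed point; choose one that
   generates a group of maximal order. Any further entry outside of this group extends it to a
   group of subfield type, and the trace invariant tr^2/det shows that a triple of maximal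
   order generates [G]. For k >= 4 some other entry is then redundant: it can be replaced by
   an arbitrary element. It is used to conjugate, so that some entry [a] moves infinity,
   then as a translation [x] such that the invariant of [a x] is a generator of F^* or its
   square, whence [<a, x>] contains PSL(2,F) or has order 60, and finally as a homothety [h]
   generating a torus. Then [a, x, h] generate [G] whenever [a] moves infinity and [x] is a
   nontrivial translation, so any two such lists are connected. *)

Set Implicit Arguments.
Unset Strict Implicit.
Unset Printing Implicit Defensive.

Import GroupScope.

(** * Nielsen moves on lists *)

(** Over the extension, split and nonsplit tori look alike: every nontrivial element has one or two
    fixed points, and a single one means unipotent. Counting unipotents twice turns the orbit count
    into the equation known from finite rotation groups. The obstacle is that entries may generate a
    proper subgroup of subfield type, and nothing inside it leads out. Maximality is the way around:
    an entry outside of PGL(2,K) has multiples whose invariant avoids all fields of order at most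
    |K|, so they generate a larger group with x and y. For this to contradict the choice when G is
    not contained in PSL(2,F), only those triples are compared that map onto G modulo PSL(2,F).
    Oddness of q enters through division by 2: unipotents are squares, field elements are
    differences of squares, and translation groups have odd order. The order 60 survives next to a
    unipotent because in characteristic 3 the elements of order three of the icosahedral group are
    unipotent. *)

Section Nielsen.

Variable gT : finGroupType.
Implicit Types (s t r : seq gT) (x y z : gT).

(** Moves act on the head only, since permutations bring any entry there. Taking [y] from the tail
    makes the two positions distinct. *)
Inductive nreach : seq gT -> seq gT -> Prop :=
| nreach_refl s : nreach s s
| nreach_trans s t r : nreach s t -> nreach t r -> nreach s r
| nreach_perm s t : perm_eq s t -> nreach s t
| nreach_mul1 x y s : y \in s -> nreach (x :: s) (x * y :: s)
| nreach_inv x s : nreach (x :: s) (x^-1 :: s).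

Definition gens s : {group gT} := <<[set x in s]>>%G.

Lemma mem_gens s x : x \in s -> x \in gens s.
Proof. by move=> xs; rewrite mem_gen ?inE. Qed.

Lemma gens_subP s (G : {group gT}) :
  reflect {subset s <= G} (gens s \subset G).
Proof.
rewrite gen_subG; apply: (iffP subsetP) => sG x; last by rewrite inE => /sG.
by move=> xs; apply: sG; rewrite inE.
Qed.

Lemma gensS s t : {subset s <= t} -> gens s \subset gens t.
Proof. by move=> st; apply/gens_subP => x /st /mem_gens. Qed.

Lemma eq_gens s t : s =i t -> gens s = gens t.
Proof.
by move=> st; apply/val_inj/eqP; rewrite eqEsubset !gensS // => x; rewrite st.
Qed.

Lemma nreach_gens s t : nreach s t -> gens s = gens t.
Proof.
elim=> {s t} [//|s t r _ -> _ -> //|s t st|x y s ys|x s].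
- exact/eq_gens/perm_mem.
- have yg z : y \in gens (z :: s) by rewrite mem_gens // inE ys orbT.
  have hd z : z \in gens (z :: s) by rewrite mem_gens // inE eqxx.
  apply/val_inj/eqP; rewrite eqEsubset; apply/andP; split; apply/gens_subP=> z;
    rewrite inE => /orP[/eqP-> | zs]; try by rewrite mem_gens // inE zs orbT.
    by rewrite -{1}(mulgK y x) groupM ?groupV.
  by rewrite groupM.
- have hd z : z \in gens (z :: s) by rewrite mem_gens // inE eqxx.
  apply/val_inj/eqP; rewrite eqEsubset; apply/andP; split; apply/gens_subP=> z;
    rewrite inE => /orP[/eqP-> | zs]; try by rewrite mem_gens // inE zs orbT.
    by rewrite -{1}(invgK x) groupV.
  by rewrite groupV.
Qed.

Lemma nreach_size s t : nreach s t -> size s = size t.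
Proof. by elim=> {s t} // [s t r _ -> _ -> | s t /perm_size]. Qed.

(** In a finite group the elements of [gens s] are products of entries without inverses, so iterated
    elementary moves suffice. *)
Lemma nreach_mulr x y s : y \in gens s -> nreach (x :: s) (x * y :: s).
Proof.
case/gen_prodgP => n [c cs ->] {y}.
elim: n c cs => [|n IHn] c cs; first by rewrite big_ord0 mulg1; apply: nreach_refl.
rewrite big_ord_recr /= mulgA.
apply: nreach_trans (IHn (fun i => c (widen_ord (leqnSn n) i)) _) _ => [i|].
  exact: cs.
by apply: nreach_mul1; have:= cs ord_max; rewrite inE.
Qed.

Lemma nreach_mull x y s : y \in gens s -> nreach (x :: s) (y * x :: s).
Proof.
move=> ys; apply: nreach_trans (nreach_inv x s) _.
have /(nreach_mulr x^-1) H : y^-1 \in gens s by rewrite groupV.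
by apply: nreach_trans H _; rewrite -invMg -{2}[y * x]invgK; apply: nreach_inv.
Qed.

(** The source of all freedom: once the tail generates the group, the head is arbitrary. *)
Lemma nreach_replace x y s (G : {group gT}) :
  gens s = G -> x \in G -> y \in G -> nreach (x :: s) (y :: s).
Proof.
move=> sG xG yG; rewrite -(mulgKV x y); apply: nreach_mull.
by rewrite sG groupM ?groupV.
Qed.

End Nielsen.

(** All paths run towards one base list; reversing them is left to the symmetry of the graph,
    [pra_edge_sym]. *)
Definition nielsen_connected (gT : finGroupType) (G : {set gT}) (k : nat) :=
  exists t0 : seq gT, [/\ size t0 = k, gens t0 = G :> {set gT} &
    forall s, size s = k -> gens s = G :> {set gT} -> nreach s t0].

Section Transport.

Variables (aT rT : finGroupType) (D : {group aT}) (f : {morphism D >-> rT}).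

Lemma nreach_map s t : nreach s t -> {subset s <= D} ->
  {subset t <= D} /\ nreach (map f s) (map f t).
Proof.
elim=> {s t} [s sD|s t r _ IH1 _ IH2 sD|s t st sD|x y s ys sD|x s sD].
- by split=> //; apply: nreach_refl.
- have [/IH2[rD R2] R1] := IH1 sD; split=> //; exact: nreach_trans R1 R2.
- by split; [move=> x; rewrite -(perm_mem st); apply: sD | apply/nreach_perm/perm_map].
- have xD : x \in D by rewrite sD ?inE ?eqxx.
  have yD : y \in D by rewrite sD ?inE ?ys ?orbT.
  split=> [z|]; last by rewrite /= morphM //; apply/nreach_mul1/map_f.
  by rewrite inE => /orP[/eqP->|zs]; rewrite ?groupM // sD // inE zs orbT.
- have xD : x \in D by rewrite sD ?inE ?eqxx.
  split=> [z|]; last by rewrite /= morphV //; apply/nreach_inv.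
  by rewrite inE => /orP[/eqP->|zs]; rewrite ?groupV // sD // inE zs orbT.
Qed.

Lemma gens_map s : {subset s <= D} -> gens (map f s) = f @* gens s :> {set rT}.
Proof.
move=> sD; rewrite /= morphim_gen; last by apply/subsetP=> x; rewrite inE => /sD.
congr <<_>>; rewrite morphimEsub; last by apply/subsetP=> x; rewrite inE => /sD.
apply/setP=> y; rewrite inE; apply/mapP/imsetP => [] [x xs ->]; exists x => //.
  by rewrite inE.
by rewrite inE in xs.
Qed.

End Transport.

(** Carries the result from permutation groups, where the argument takes place, to the quotients of
    matrix groups. *)
Lemma nielsen_connected_isog (aT rT : finGroupType) (G : {group aT})
    (H : {group rT}) k :
  H \isog G -> nielsen_connected H k -> nielsen_connected G k.
Proof.
case/isogP=> f injf fHG [t0 [t0k t0H conn]].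
have memH s : gens s = H :> {set rT} -> {subset s <= H}.
  by move=> sH; apply/gens_subP; rewrite sH.
have memG s : gens s = G :> {set aT} -> {subset s <= f @* H}.
  by move=> sH; rewrite fHG; apply/gens_subP; rewrite sH.
exists (map f t0); split; first by rewrite size_map.
  by rewrite gens_map ?t0H ?fHG //; apply: memH.
move=> s sk sG.
pose g := invm injf.
have gsH : gens (map g s) = H :> {set rT}.
  by rewrite gens_map ?sG -?fHG ?morphim_invmE ?injmK //; apply: memG.
have [] := nreach_map f (conn (map g s) _ gsH) (memH _ gsH); first by rewrite size_map.
move=> _; rewrite -map_comp map_id_in // => x xs /=.
by rewrite invmK //; apply: memG xs.
Qed.

(** * Lists as vertices of the graph *)

Section Graph.

Variables (gT : finGroupType) (k : nat) (G : {group gT}).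
Implicit Types (s t r : seq gT).

Definition ffun_of_seq s : {ffun 'I_k -> gT} := [ffun i : 'I_k => nth 1 s i].

Lemma generating_ffun_of_seq s : size s = k ->
  gens s = G :> {set gT} -> generating_tuple G (ffun_of_seq s).
Proof.
move=> sk sG; rewrite /generating_tuple -sG /=; apply/eqP; congr <<_>>.
apply/setP=> x; rewrite inE; apply/imsetP/idP => [[i _ ->]|].
  by rewrite ffunE mem_nth ?sk.
by case/(nthP 1)=> i; rewrite sk => ik <-; exists (Ordinal ik) => //; rewrite ffunE.
Qed.

Lemma gens_codom (x : pra_vertex k G) :
  gens (codom (val x)) = G :> {set gT}.
Proof.
case: x => g /= /eqP gG; rewrite -gG /=; congr <<_>>; apply/setP=> y; rewrite inE.
by apply/codomP/imsetP => [[i ->]|[i _ ->]]; exists i.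
Qed.

Lemma ffun_of_codom (g : {ffun 'I_k -> gT}) : ffun_of_seq (codom g) = g.
Proof.
apply/ffunP=> i; rewrite ffunE codomE (nth_map i) ?size_enum_ord //.
by rewrite nth_ord_enum.
Qed.

(** A permutation is a product of transpositions, each of which is an edge [P_{i,j}]. *)
Lemma connect_perm (s : 'S_k) (x y : pra_vertex k G) :
  (forall i, val y i = val x (s i)) -> connect (@pra_edge _ _ _) x y.
Proof.
have [ts -> {s} tsd] := prod_tpermP s.
elim: ts tsd y => [|[i j] ts IH] /= => [_ | /andP[nij /IH{}IH]] y yE.
  suff -> : y = x by [].
  by apply/val_inj/ffunP=> i; rewrite yE big_nil perm1.
pose h : {ffun 'I_k -> gT} := [ffun l => val y (tperm i j l)].
have hG : generating_tuple G h.
  have := valP y; rewrite /generating_tuple => /eqP <-; apply/eqP; congr <<_>>.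
  apply/setP=> z; apply/imsetP/imsetP => [] [l _ ->].
    by exists (tperm i j l) => //; rewrite ffunE.
  by exists (tperm i j l) => //; rewrite ffunE tpermK.
apply: connect_trans (IH (Sub h hG) _) _ => [l|].
  by rewrite SubK ffunE yE big_cons /= permM tpermK.
apply/connect1/existsP; exists i; apply/existsP; exists j; rewrite nij SubK !inE.
suff -> : val y = [ffun l => h (tperm i j l)] by rewrite eqxx !orbT.
by apply/ffunP=> l; rewrite !ffunE tpermK.
Qed.

Lemma nreach_connect s t : 1 < k -> nreach s t -> size s = k ->
  forall x y : pra_vertex k G,
  val x = ffun_of_seq s -> val y = ffun_of_seq t -> connect (@pra_edge _ _ _) x y.
Proof.
move=> k1; elim=> {s t} [s|s t r R1 IH1 R2 IH2|s t st|a b s bs|a s] sk x y xE yE.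
- by suff -> : x = y by []; apply: val_inj; rewrite xE yE.
(* The intermediate list is a vertex because [nreach] preserves the generated group. *)
- have sG : gens s = G :> {set gT}.
    have := valP x; rewrite /generating_tuple xE => /eqP <-; congr <<_>>.
    apply/setP=> z; rewrite inE; apply/idP/imsetP => [|[i _ ->]]; last first.
      by rewrite ffunE mem_nth ?sk.
    by case/(nthP 1)=> i; rewrite sk => ik <-; exists (Ordinal ik) => //; rewrite ffunE.
  have tk : size t = k by rewrite -(nreach_size R1).
  have tG : generating_tuple G (ffun_of_seq t).
    by apply: generating_ffun_of_seq; rewrite // -(nreach_gens R1).
  apply: connect_trans (IH1 sk _ (Sub _ tG) xE _) (IH2 tk (Sub _ tG) _ _ yE) => //.
- have tk : size t == k by rewrite -(perm_size st) sk.
  move/eqP: (sk) => sk'.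
  move: st; rewrite perm_sym.
  case/(@tuple_permP _ k t (Tuple sk')) => p tE.
  apply: (@connect_perm p) => i; rewrite xE yE !ffunE tE /=.
  rewrite (nth_map i) ?size_enum_ord // nth_ord_enum (tnth_nth 1).
  by [].
- have ltk : (index b s).+1 < k by rewrite -sk /= ltnS index_mem.
  have k0 : 0 < k by apply: ltn_trans k1.
  apply/connect1/existsP; exists (Ordinal k0).
  apply/existsP; exists (Ordinal ltk); rewrite -val_eqE /= !inE.
  apply/orP; left; rewrite xE yE; apply/eqP/ffunP=> l; rewrite !ffunE -val_eqE /=.
  by case: (nat_of_ord l) => [|n] //=; rewrite nth_index.
- have k0 : 0 < k by apply: ltn_trans k1.
  apply/connect1/existsP; exists (Ordinal k0).
  (* An edge names two distinct indices even for the inversion [I_i]; index 1 exists because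
     [1 < k]. *)
  apply/existsP; exists (Ordinal k1); rewrite -val_eqE /= !inE.
  do 5![apply/orP; right]; rewrite xE yE; apply/eqP/ffunP=> l; rewrite !ffunE -val_eqE /=.
  by case: (nat_of_ord l) => [|n].
Qed.

Lemma extended_PRA_connected_nielsen : 1 < k ->
  nielsen_connected G k -> extended_PRA_connected G k.
Proof.
move=> k1 [t0 [t0k t0G conn]].
pose v0 : pra_vertex k G := Sub _ (generating_ffun_of_seq t0k t0G).
have to_v0 (x : pra_vertex k G) : connect (@pra_edge _ _ _) x v0.
  have sk : size (codom (val x)) = k by rewrite size_codom card_ord.
  apply: (nreach_connect k1 (conn _ sk (gens_codom x)) sk) => //.
  by rewrite ffun_of_codom.
split=> [|x y]; first by apply/card_gt0P; exists v0.
apply: connect_trans (to_v0 x) _.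
by rewrite (sym_connect_sym (@pra_edge_sym _ _ _)).
Qed.

End Graph.

(** Certificates: an equation follows once the difference of its sides is written as a combination
    of known ones, which [ring] or [field] checks. *)
Lemma eq_by1 (R : pzRingType) (m u v x y : R) :
  u = v -> (x - y = m * (u - v))%R -> x = y.
Proof. by move=> ->; rewrite GRing.subrr GRing.mulr0 => /eqP; rewrite GRing.subr_eq0 => /eqP. Qed.

Lemma eq_by2 (R : pzRingType) (m n u v s t x y : R) :
  u = v -> s = t -> (x - y = m * (u - v) + n * (s - t))%R -> x = y.
Proof.
move=> -> ->; rewrite !GRing.subrr !GRing.mulr0 GRing.addr0 => /eqP.
by rewrite GRing.subr_eq0 => /eqP.
Qed.

(** * The projective line *)

Section Moebius.

Local Open Scope ring_scope.
Import GRing.Theory.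

Variable L : finFieldType.
Implicit Types (a b c d x y z : L) (P Q R : option L) (g h : {perm option L}).
Implicit Types (K : {set L}).

(* [option L] is the projective line: [Some z] is (z : 1) and [None] is (1 : 0). *)
Definition pt x y : option L := if y == 0 then None else Some (x / y).
Definition hx P : L := if P is Some z then z else 1.
Definition hy P : L := if P is Some _ then 1 else 0.

Lemma pt_h P : pt (hx P) (hy P) = P.
Proof. by case: P => [z|]; rewrite /pt /= ?eqxx // oner_eq0 divr1. Qed.

Lemma h_neq0 P : (hx P != 0) || (hy P != 0).
Proof. by case: P => [z|] /=; rewrite oner_eq0 ?orbT. Qed.

Lemma pt_scale k x y : k != 0 -> pt (k * x) (k * y) = pt x y.
Proof.
move=> k0; rewrite /pt mulf_eq0 (negbTE k0) /=; case: eqP => // /eqP y0.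
by congr Some; field; rewrite k0 y0.
Qed.

Lemma h_pt x y : (x != 0) || (y != 0) ->
  exists2 k, k != 0 & x = k * hx (pt x y) /\ y = k * hy (pt x y).
Proof.
rewrite /pt; case: (eqVneq y 0) => [->|y0] /=; rewrite ?orbF => x0.
  by exists x; rewrite ?mulr1 ?mulr0.
by exists y => //; rewrite mulr1 mulrC divfK.
Qed.

Lemma pt_eq x y x' y' : (x != 0) || (y != 0) -> (x' != 0) || (y' != 0) ->
  (pt x y == pt x' y') = (x * y' == x' * y).
Proof.
rewrite /pt; case: (eqVneq y 0) => [->|y0]; case: (eqVneq y' 0) => [->|y0'] /=;
  rewrite ?orbF ?mulr0 => x0 x0' //.
- by rewrite !eqxx.
- by rewrite mulf_eq0 (negbTE x0) (negbTE y0').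
- by rewrite [RHS]eq_sym mulf_eq0 (negbTE x0') (negbTE y0).
- by rewrite (inj_eq Some_inj) eqr_div.
Qed.

(** The matrix with rows (a, b) and (c, d) acts on row vectors, so that products of permutations,
    read from left to right, match products of matrices. *)
Definition mobf a b c d P := pt (hx P * a + hy P * c) (hx P * b + hy P * d).

Lemma mobf_pt a b c d x y : (x != 0) || (y != 0) ->
  mobf a b c d (pt x y) = pt (x * a + y * c) (x * b + y * d).
Proof.
case/h_pt => k k0; rewrite /mobf; move: (pt x y) => P [-> ->].
by rewrite -!mulrA -!mulrDr pt_scale.
Qed.

Lemma row_neq0 a b c d x y : a * d - b * c != 0 -> (x != 0) || (y != 0) ->
  (x * a + y * c != 0) || (x * b + y * d != 0).
Proof.
move=> D; apply: contraTT; rewrite !negb_or !negbK => /andP[/eqP E1 /eqP E2].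
have Ex : x * (a * d - b * c) = 0.
  by transitivity ((x * a + y * c) * d - (x * b + y * d) * c); [ring | rewrite E1 E2 !mul0r subrr].
have Ey : y * (a * d - b * c) = 0.
  by transitivity ((x * b + y * d) * a - (x * a + y * c) * b); [ring | rewrite E1 E2 !mul0r subrr].
by move/eqP: Ex; move/eqP: Ey; rewrite !mulf_eq0 (negbTE D) !orbF => -> ->.
Qed.

Lemma mobf_comp a b c d a' b' c' d' P : a * d - b * c != 0 ->
  mobf a' b' c' d' (mobf a b c d P) =
  mobf (a * a' + b * c') (a * b' + b * d') (c * a' + d * c') (c * b' + d * d') P.
Proof.
move=> D; rewrite {2}/mobf mobf_pt ?row_neq0 ?h_neq0 // /mobf.
by congr pt; ring.
Qed.

Lemma mobf_inj a b c d : a * d - b * c != 0 -> injective (mobf a b c d).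
Proof.
move=> D; apply: (can_inj (g := mobf d (- b) (- c) a)) => P.
rewrite mobf_comp // -[RHS]pt_h /mobf.
by rewrite -(@pt_scale (a * d - b * c) (hx P)) //; congr pt; ring.
Qed.

(** Total in the coefficients, so that no proof of invertibility is carried in terms; the default
    covers determinant zero. *)
Definition mob a b c d : {perm option L} :=
  odflt 1%g [pick g : {perm option L} | [forall P, g P == mobf a b c d P]].

Lemma mobE a b c d P : a * d - b * c != 0 -> mob a b c d P = mobf a b c d P.
Proof.
move=> D; rewrite /mob; case: pickP => [g /forallP/(_ P)/eqP //|].
by move/(_ (perm (mobf_inj D)))/forallP; case=> Q; rewrite permE.
Qed.

Lemma mob_scale k a b c d : k != 0 ->
  mob (k * a) (k * b) (k * c) (k * d) = mob a b c d.
Proof.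
move=> k0; rewrite /mob; congr odflt; apply: eq_pick => g; apply: eq_forallb => P.
by rewrite /mobf !(mulrCA _ k) -!mulrDr pt_scale.
Qed.

(* [congr mob] would unfold [mob] and enumerate permutations. *)
Lemma eq_mob a b c d a' b' c' d' : a = a' -> b = b' -> c = c' -> d = d' ->
  mob a b c d = mob a' b' c' d'.
Proof. by move=> -> -> -> ->. Qed.

(* Unfolding [mob] during unification would enumerate permutations. *)
Opaque mob.

Lemma det_mul a b c d a' b' c' d' :
  (a * a' + b * c') * (c * b' + d * d') - (a * b' + b * d') * (c * a' + d * c') =
  (a * d - b * c) * (a' * d' - b' * c').
Proof. ring. Qed.

Lemma mobM a b c d a' b' c' d' : a * d - b * c != 0 -> a' * d' - b' * c' != 0 ->
  (mob a b c d * mob a' b' c' d')%g =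
  mob (a * a' + b * c') (a * b' + b * d') (c * a' + d * c') (c * b' + d * d').
Proof.
move=> D D'; apply/permP=> P; rewrite permM !mobE ?mobf_comp //.
by rewrite det_mul mulf_neq0.
Qed.

Lemma mob1 : mob 1 0 0 1 = 1%g.
Proof.
apply/permP=> P; rewrite mobE ?mulr0 ?mulr1 ?subr0 ?oner_neq0 // perm1.
by rewrite /mobf !mulr0 !mulr1 addr0 add0r pt_h.
Qed.

Lemma mobV a b c d : a * d - b * c != 0 -> (mob a b c d)^-1%g = mob d (- b) (- c) a.
Proof.
move=> D; apply/eqP; rewrite eq_invg_mul mobM //; last first.
  by rewrite mulrNN mulrC.
rewrite -[X in _ == X]mob1 -(@mob_scale (a * d - b * c) 1 0 0 1) //; apply/eqP.
by apply: eq_mob; ring.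
Qed.

(** Agreement at the three points (1 : 0), (0 : 1) and (1 : 1) already forces the matrices to be
    proportional. *)
Lemma mob_inj a b c d a' b' c' d' : a * d - b * c != 0 -> a' * d' - b' * c' != 0 ->
  mob a b c d = mob a' b' c' d' ->
  exists2 k, k != 0 & [/\ a' = k * a, b' = k * b, c' = k * c & d' = k * d].
Proof.
move=> D D' E.
have H x y : (x != 0) || (y != 0) ->
    (x * a + y * c) * (x * b' + y * d') = (x * a' + y * c') * (x * b + y * d).
  move=> xy; apply/eqP; rewrite -pt_eq ?row_neq0 // -!mobf_pt //.
  by rewrite -!mobE // E.
have /= E1 := H 1 0; rewrite oner_eq0 in E1; have {}E1 := E1 isT.
have /= E2 := H 0 1; rewrite oner_eq0 eqxx in E2; have {}E2 := E2 isT.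
have /= E3 := H 1 1; rewrite oner_eq0 in E3; have {}E3 := E3 isT.
rewrite !mul1r !mul0r !addr0 in E1; rewrite !mul1r !mul0r !add0r in E2.
rewrite !mul1r in E3.
(* Polarisation: the equation at (1 : 1) minus those at the other two points leaves the mixed
   terms. *)
have E4 : a * d' + c * b' = a' * d + c' * b.
  by apply: (eq_by2 (m := 1) (n := -1)  E3 (congr2 +%R E1 E2)); ring.
(* For proportional matrices this is the factor of proportionality times the first determinant. *)
pose k := a' * d - b' * c; have kE : k = a * d' - c' * b.
  by apply: (eq_by1 (m := -1) E4); rewrite /k; ring.
have scale z z' : z' * (a * d - b * c) = k * z -> z' = k / (a * d - b * c) * z.
  by move=> e; rewrite mulrAC -e mulfK.
have ea : a' = k / (a * d - b * c) * a.
  by apply: scale; apply: (eq_by1 (m := c) E1); rewrite /k; ring.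
have eb : b' = k / (a * d - b * c) * b.
  by apply: scale; apply: (eq_by1 (m := d) E1); rewrite /k; ring.
have ec : c' = k / (a * d - b * c) * c.
  by apply: scale; rewrite kE; apply: (eq_by1 (m := - a) E2); ring.
have ed : d' = k / (a * d - b * c) * d.
  by apply: scale; rewrite kE; apply: (eq_by1 (m := - b) E2); ring.
exists (k / (a * d - b * c)) => //; apply: contraNneq D' => k0.
by rewrite ea eb k0 !mul0r subrr.
Qed.

End Moebius.

(** * Subfields and the groups PSL(2,K) and PGL(2,K) *)

Section Subfields.

Local Open Scope ring_scope.
Import GRing.Theory.

Variable L : finFieldType.
Implicit Types (a b c d x y z : L) (P Q R : option L) (g h : {perm option L}).
Implicit Types (K : {set L}).

(** Closure under inversion follows from finiteness, inverses being powers; see [sfV]. *)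
Definition subfield K := [/\ 1 \in K, {in K &, forall x y, x - y \in K}
  & {in K &, forall x y, x * y \in K}].

Section SubfieldTheory.

Variable K : {set L}.
Hypothesis sK : subfield K.

Lemma sf1 : 1 \in K. Proof. by case: sK. Qed.
Lemma sfB x y : x \in K -> y \in K -> x - y \in K. Proof. by case: sK => _ + _; apply. Qed.
Lemma sfM x y : x \in K -> y \in K -> x * y \in K. Proof. by case: sK => _ _; apply. Qed.
Lemma sf0 : 0 \in K. Proof. by rewrite -(subrr 1) sfB ?sf1. Qed.
Lemma sfN x : x \in K -> - x \in K. Proof. by move=> xK; rewrite -sub0r sfB ?sf0. Qed.
Lemma sfD x y : x \in K -> y \in K -> x + y \in K.
Proof. by move=> xK yK; rewrite -[y]opprK sfB ?sfN. Qed.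
Lemma sfX x n : x \in K -> x ^+ n \in K.
Proof. by move=> xK; elim: n => [|n IH]; rewrite ?expr0 ?sf1 // exprS sfM. Qed.
Lemma sfV x : x \in K -> x^-1 \in K.
Proof.
move=> xK; have [->|x0] := eqVneq x 0; first by rewrite invr0 sf0.
suff -> : x^-1 = x ^+ (#|L| - 2) by rewrite sfX.
apply: (mulIf x0); rewrite mulVf // -exprSr.
have L1 : (1 < #|L|)%N.
  by rewrite (cardD1 (0 : L)) (cardD1 (1 : L)) !inE oner_neq0.
have -> : (#|L| - 2).+1 = #|L|.-1 by lia.
apply: (mulIf x0); rewrite -exprSr mul1r prednK ?expf_card //; lia.
Qed.
Lemma sf_div x y : x \in K -> y \in K -> x / y \in K.
Proof. by move=> xK yK; rewrite sfM ?sfV. Qed.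

Lemma sf_generator : exists2 th, th \in K & th != 0 /\
  forall x, x \in K -> x != 0 -> exists m : nat, x = th ^+ m.
Proof.
have gK : group_set [set u : {unit L} | val u \in K].
  apply/group_setP; split=> [|u v]; rewrite !inE; first exact: sf1.
  by move=> uK vK; rewrite FinRing.val_unitM sfM.
have [u /= uE] := cyclicP (field_unit_group_cyclic (Group gK)).
have : u \in [set u : {unit L} | val u \in K] by rewrite uE cycle_id.
rewrite inE => uK; exists (val u) => //; split=> [|x xK x0].
  by have := valP u; rewrite unitfE.
have xu : x \is a GRing.unit by rewrite unitfE.
have : FinRing.Unit xu \in [set u : {unit L} | val u \in K] by rewrite inE.
rewrite uE => /cycleP[m mE]; exists m.
by rewrite -[x]/(val (FinRing.Unit xu)) mE FinRing.val_unitX.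
Qed.

Lemma sf_nonsquareM x y : x \in K -> y \in K -> x != 0 -> y != 0 ->
  (forall r, r \in K -> x != r ^+ 2) -> (forall r, r \in K -> y != r ^+ 2) ->
  exists2 r, r \in K & x * y = r ^+ 2.
Proof.
move=> xK yK x0 y0 xn yn; have [th thK [_ gen]] := sf_generator.
have [m mE] := gen x xK x0; have [n nE] := gen y yK y0.
have oddm : odd m.
  apply: contraNT (xn (th ^+ m./2) (sfX _ thK)) => mev.
  by rewrite mE -exprM muln2 even_halfK.
have oddn : odd n.
  apply: contraNT (yn (th ^+ n./2) (sfX _ thK)) => nev.
  by rewrite nE -exprM muln2 even_halfK.
exists (th ^+ ((m + n)./2)); first exact: sfX.
by rewrite -exprM muln2 even_halfK ?oddD ?oddm ?oddn // exprD mE nE.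
Qed.

End SubfieldTheory.

Lemma subfieldT : subfield [set: L].
Proof. by split=> [|x y _ _|x y _ _]; rewrite in_setT. Qed.

Definition rat_pts K : {set option L} := [set P | if P is Some z then z \in K else true].

Definition PGLset K : {set {perm option L}} :=
  [set g | [exists a in K, exists b in K, exists c in K, exists d in K,
     (a * d - b * c != 0) && (g == mob a b c d)]].

Definition PSLset K : {set {perm option L}} :=
  [set g | [exists a in K, exists b in K, exists c in K, exists d in K,
     (a * d - b * c == 1) && (g == mob a b c d)]].

Lemma PGLsetP K g : reflect (exists a b c d, [/\ [&& a \in K, b \in K, c \in K & d \in K],
    a * d - b * c != 0 & g = mob a b c d]) (g \in PGLset K).
Proof.
rewrite inE; apply: (iffP idP).
  case/exists_inP=> a aK /exists_inP[b bK /exists_inP[c cK /exists_inP[d dK]]].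
  by case/andP=> D /eqP ->; exists a, b, c, d; rewrite aK bK cK dK.
case=> [a [b [c [d [/and4P[aK bK cK dK] D ->]]]]].
apply/exists_inP; exists a => //; apply/exists_inP; exists b => //.
by apply/exists_inP; exists c => //; apply/exists_inP; exists d; rewrite ?D ?eqxx.
Qed.

Lemma PSLsetP K g : reflect (exists a b c d, [/\ [&& a \in K, b \in K, c \in K & d \in K],
    a * d - b * c = 1 & g = mob a b c d]) (g \in PSLset K).
Proof.
rewrite inE; apply: (iffP idP).
  case/exists_inP=> a aK /exists_inP[b bK /exists_inP[c cK /exists_inP[d dK]]].
  by case/andP=> /eqP D /eqP ->; exists a, b, c, d; rewrite aK bK cK dK.
case=> [a [b [c [d [/and4P[aK bK cK dK] D ->]]]]].
apply/exists_inP; exists a => //; apply/exists_inP; exists b => //.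
by apply/exists_inP; exists c => //; apply/exists_inP; exists d; rewrite ?D ?eqxx.
Qed.

Lemma PSL_PGL K : PSLset K \subset PGLset K.
Proof.
apply/subsetP=> g /PSLsetP[a [b [c [d [abcd D ->]]]]]; apply/PGLsetP.
by exists a, b, c, d; rewrite D oner_neq0.
Qed.

Lemma PGLset_sub K : PGLset K \subset PGLset [set: L].
Proof.
apply/subsetP=> g /PGLsetP[a [b [c [d [abcd D ->]]]]]; apply/PGLsetP.
by exists a, b, c, d; rewrite !in_setT.
Qed.

Section Groups.

Variable K : {set L}.
Hypothesis sK : subfield K.

Lemma PGL_group_set : group_set (PGLset K).
Proof.
apply/group_setP; split=> [|g h].
  apply/PGLsetP; exists 1, 0, 0, 1; rewrite sf1 ?sf0 ?mob1 //.
  by rewrite mulr1 mulr0 subr0 oner_neq0.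
move=> /PGLsetP[a [b [c [d [/and4P[aK bK cK dK] D ->]]]]].
move=> /PGLsetP[a' [b' [c' [d' [/and4P[aK' bK' cK' dK'] D' ->]]]]].
rewrite mobM //; apply/PGLsetP; do 4!eexists; split; last by [].
  by rewrite !(sfD, sfM).
by rewrite det_mul mulf_neq0.
Qed.

Lemma PSL_group_set : group_set (PSLset K).
Proof.
apply/group_setP; split=> [|g h].
  apply/PSLsetP; exists 1, 0, 0, 1; rewrite sf1 ?sf0 ?mob1 //.
  by rewrite mulr1 mulr0 subr0.
move=> /PSLsetP[a [b [c [d [/and4P[aK bK cK dK] D ->]]]]].
move=> /PSLsetP[a' [b' [c' [d' [/and4P[aK' bK' cK' dK'] D' ->]]]]].
rewrite mobM ?D ?D' ?oner_neq0 //; apply/PSLsetP; do 4!eexists; split; last by [].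
  by rewrite !(sfD, sfM).
by rewrite det_mul D D' mulr1.
Qed.

Definition PGLgroup := Group PGL_group_set.
Definition PSLgroup := Group PSL_group_set.

(** Dividing the matrix by a square root of its determinant normalises the determinant to 1. *)
Lemma PSL_square a b c d r : [&& a \in K, b \in K, c \in K & d \in K] -> r \in K ->
  a * d - b * c != 0 -> a * d - b * c = r ^+ 2 -> mob a b c d \in PSLset K.
Proof.
move=> /and4P[aK bK cK dK] rK D Dr.
have r0 : r != 0 by apply: contraNneq D => r0; rewrite Dr r0 expr0n.
apply/PSLsetP; exists (r^-1 * a), (r^-1 * b), (r^-1 * c), (r^-1 * d).
rewrite mob_scale ?invr_eq0 // !sfM ?sfV //; split=> //.
transitivity ((a * d - b * c) / r ^+ 2); first by field.
by rewrite Dr divff // expf_neq0.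
Qed.

(* The square classes of the determinants show that the index is at most 2. *)
Lemma PGL_PSL_mul g h : g \in PGLset K -> h \in PGLset K ->
  g \notin PSLset K -> h \notin PSLset K -> (g * h)%g \in PSLset K.
Proof.
move=> /PGLsetP[a [b [c [d [Kg D ->]]]]] /PGLsetP[a' [b' [c' [d' [Kh D' ->]]]]] gn hn.
have DK x y z t : [&& x \in K, y \in K, z \in K & t \in K] -> x * t - y * z \in K.
  by move=> /and4P[? ? ? ?]; rewrite sfB ?sfM.
have [||r rK rE] := @sf_nonsquareM K sK _ _ (DK _ _ _ _ Kg) (DK _ _ _ _ Kh) D D'.
- by move=> r rK; apply: contra gn => /eqP; apply: PSL_square.
- by move=> r rK; apply: contra hn => /eqP; apply: PSL_square.
rewrite mobM //; apply: (PSL_square (r := r)) => //; rewrite ?det_mul ?mulf_neq0 //.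
move: Kg Kh => /and4P[? ? ? ?] /and4P[? ? ? ?].
by rewrite !(sfD, sfM).
Qed.

Lemma PGL_norm_PSL : PGLset K \subset 'N(PSLset K).
Proof.
apply/normsP=> g gG; apply/eqP; rewrite eqEcard cardJg leqnn andbT.
move: gG => /PGLsetP[a [b [c [d [/and4P[aK bK cK dK] D ->]]]]].
apply/subsetP=> h /imsetP[x /PSLsetP[a' [b' [c' [d' [/and4P[aK' bK' cK' dK'] D' ->]]]]] ->].
have D1 : a' * d' - b' * c' != 0 by rewrite D' oner_neq0.
have D2 : d * a - - b * - c != 0 by rewrite mulrNN mulrC.
rewrite conjgE mobV // !mobM ?det_mul ?mulf_neq0 //.
(* [mobV] inverts by the adjugate, so the conjugate has the square of [a * d - b * c] as its
   determinant. *)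
apply: (PSL_square (r := a * d - b * c)); rewrite ?det_mul ?mulf_neq0 //.
- by rewrite !(sfD, sfM, sfN).
- by rewrite sfB ?sfM.
by rewrite D'; ring.
Qed.

End Groups.

End Subfields.

(** * Affine maps and fixed points *)

Section FixedPoints.

Local Open Scope ring_scope.
Import GRing.Theory.

Variable L : finFieldType.
Implicit Types (a b c d x y z : L) (P Q R : option L) (g h : {perm option L}).
Implicit Types (K : {set L}).

Definition Mob := PGLgroup (subfieldT L).

Lemma MobP g : reflect (exists a b c d, a * d - b * c != 0 /\ g = mob a b c d) (g \in Mob).
Proof.
apply: (iffP (PGLsetP _ _)) => [[a [b [c [d [_ D ->]]]]] | [a [b [c [d [D ->]]]]]].
  by exists a, b, c, d.
by exists a, b, c, d; rewrite !in_setT.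
Qed.

Lemma PGL_Mob K g : g \in PGLset K -> g \in Mob.
Proof. exact: (subsetP (PGLset_sub K)). Qed.

Lemma PSL_Mob K g : g \in PSLset K -> g \in Mob.
Proof. by move/(subsetP (PSL_PGL K)); apply: PGL_Mob. Qed.

Lemma mob_Mob a b c d : a * d - b * c != 0 -> mob a b c d \in Mob.
Proof. by move=> D; apply/MobP; exists a, b, c, d. Qed.

Lemma mob_infE a b c d : a * d - b * c != 0 -> mob a b c d None = pt a b.
Proof. by move=> D; rewrite mobE // /mobf /= !mul1r !mul0r !addr0. Qed.

Lemma mob_SomeE a b c d z : a * d - b * c != 0 ->
  mob a b c d (Some z) = pt (z * a + c) (z * b + d).
Proof. by move=> D; rewrite mobE // /mobf /= !mul1r. Qed.

Lemma mob_fix_inf a b c d : a * d - b * c != 0 ->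
  (mob a b c d None == None) = (b == 0).
Proof. by move=> D; rewrite mob_infE // /pt; case: (b == 0). Qed.

Lemma mob_fix_Some a b c d z : a * d - b * c != 0 ->
  (mob a b c d (Some z) == Some z) = (z * a + c == z * (z * b + d)).
Proof.
move=> D; rewrite mob_SomeE // -[Some z](pt_h (Some z)) pt_eq ?oner_neq0 ?orbT //=.
  by rewrite mulr1.
have := @row_neq0 _ a b c d z 1 D; rewrite oner_neq0 orbT !mul1r; exact.
Qed.

Definition aff a c := mob a 0 c 1.

Lemma aff_det a c : (a * 1 - 0 * c != 0) = (a != 0).
Proof. by rewrite mulr1 mul0r subr0. Qed.

Lemma aff_inf a c : a != 0 -> aff a c None = None.
Proof. by move=> a0; apply/eqP; rewrite mob_fix_inf ?aff_det. Qed.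

Lemma affE a c z : a != 0 -> aff a c (Some z) = Some (z * a + c).
Proof. by move=> a0; rewrite mob_SomeE ?aff_det // /pt mulr0 add0r oner_eq0 divr1. Qed.

Lemma affM a c a' c' : a != 0 -> a' != 0 -> (aff a c * aff a' c')%g = aff (a * a') (c * a' + c').
Proof. by move=> a0 a0'; rewrite mobM ?aff_det // !(mulr0, mul0r, addr0, add0r, mulr1, mul1r). Qed.

Lemma aff1 : aff 1 0 = 1%g. Proof. exact: mob1. Qed.

Lemma affV a c : a != 0 -> (aff a c)^-1%g = aff a^-1 (- c / a).
Proof.
move=> a0; apply/eqP; rewrite eq_invg_mul affM ?invr_eq0 // divff // mulNr subrr.
by rewrite aff1.
Qed.

Lemma aff_inj a c a' c' : a != 0 -> a' != 0 -> aff a c = aff a' c' -> a = a' /\ c = c'.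
Proof.
move=> a0 a0' E; have e0 := affE c 0 a0; have e1 := affE c 1 a0.
move: e0 e1; rewrite E !affE // !mul0r !add0r !mul1r => -[->] [] /addIr.
by [].
Qed.

Lemma aff_Mob a c : a != 0 -> aff a c \in Mob.
Proof. by move=> a0; rewrite mob_Mob ?aff_det. Qed.

Lemma affP g : g \in Mob -> g None = None -> exists2 a, a != 0 & exists c, g = aff a c.
Proof.
case/MobP=> a [b [c [d [D ->]]]] /eqP; rewrite mob_fix_inf // => /eqP b0.
move: D; rewrite b0 mul0r subr0 mulf_eq0 => /norP[a0 d0].
exists (a / d); first by rewrite mulf_neq0 ?invr_eq0.
exists (c / d); transitivity (mob (d * (a / d)) (d * 0) (d * (c / d)) (d * 1)).
  by rewrite mulr0 mulr1 !mulrA ![d * _]mulrC !mulfK.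
exact: mob_scale.
Qed.

Definition fixs g : {set option L} := [set P | g P == P].

Lemma fixsP g P : reflect (g P = P) (P \in fixs g).
Proof. by rewrite inE; apply: eqP. Qed.

Lemma fixsJ g h : fixs (g ^ h)%g = h @: fixs g.
Proof.
apply/setP=> P; rewrite inE; apply/eqP/imsetP => [E|[Q /fixsP E ->]].
  exists (h^-1%g P); last by rewrite permKV.
  by apply/fixsP/(perm_inj (s := h)); rewrite permKV -[RHS]E conjgE !permM.
by rewrite conjgE !permM permK E.
Qed.

Lemma fixs_aff a c : a != 0 -> fixs (aff a c) =
  if a == 1 then (if c == 0 then setT else [set None]) else [set None; Some (c / (1 - a))].
Proof.
move=> a0; case: (eqVneq a 1) => [->|a1].
  case: (eqVneq c 0) => [->|c0].
    by apply/setP=> P; rewrite aff1 !inE perm1 eqxx.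
  apply/setP=> -[z|]; rewrite !inE ?aff_inf ?oner_neq0 //.
  by rewrite affE ?oner_neq0 // (inj_eq Some_inj) mulr1 -subr_eq0 addrAC subrr add0r (negbTE c0).
have a1' : 1 - a != 0 by rewrite subr_eq0 eq_sym.
apply/setP=> -[z|]; rewrite !inE ?aff_inf ?eqxx //.
rewrite affE // !(inj_eq Some_inj).
apply/eqP/eqP => [E|->]; last by field; rewrite a1'.
by apply: (mulIf a1'); rewrite divfK //; apply: (eq_by1 (m := -1) E); ring.
Qed.

Lemma PSL_move_inf K P : subfield K -> P \in rat_pts K ->
  exists2 g, g \in PSLset K & g P = None.
Proof.
move=> sK; case: P => [z|]; rewrite inE => zK; last first.
  by exists 1%g; rewrite ?perm1 // (group1 (PSLgroup sK)).
have D : 0 * - z - (-1) * 1 = 1 :> L by ring.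
exists (mob 0 (-1) 1 z); last first.
  rewrite mob_SomeE /pt; last by rewrite mul0r mulr1 opprK add0r oner_neq0.
  by rewrite mulrN1 addNr eqxx.
apply/PSLsetP; exists 0, (-1), 1, z; rewrite sfN ?sf0 ?sf1 //; split=> //; ring.
Qed.

Lemma Mob_move_inf P : exists2 g, g \in Mob & g P = None.
Proof.
have [|g /PSL_Mob gM gP] := @PSL_move_inf [set: L] P (subfieldT L).
  by case: P => [z|]; rewrite !inE.
by exists g.
Qed.

Lemma fixs_conj_inf g P : g \in Mob -> g P = P -> exists2 h, h \in Mob & h P = None /\
  exists2 a, a != 0 & exists c, (g ^ h)%g = aff a c.
Proof.
move=> gM gP; have [h hM hP] := Mob_move_inf P; exists h => //; split=> //.
by apply: affP; rewrite ?groupJ // -hP conjgE !permM permK gP.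
Qed.

Lemma fixs_le2 g : g \in Mob -> g != 1%g -> (#|fixs g| <= 2)%N.
Proof.
move=> gM g1; case: (set_0Vmem (fixs g)) => [->|[P /fixsP gP]]; first by rewrite cards0.
have [h hM [_ [a a0 [c gE]]]] := fixs_conj_inf gM gP.
have : #|fixs (g ^ h)%g| = #|fixs g| by rewrite fixsJ card_imset //; apply: perm_inj.
move=> <-; rewrite gE fixs_aff //.
case: eqP gE => [->|_ _]; last by rewrite cards2; case: (_ == _).
case: eqP => [->|_]; last by rewrite cards1.
by rewrite aff1 => /eqP; rewrite conjg_eq1 (negbTE g1).
Qed.

Lemma fixs3 g P Q R : g \in Mob -> uniq [:: P; Q; R] ->
  g P = P -> g Q = Q -> g R = R -> g = 1%g.
Proof.
move=> gM U gP gQ gR; apply/eqP; apply: contraT => g1.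
have: (#|[set x in [:: P; Q; R]]| <= #|fixs g|)%N.
  apply/subset_leq_card/subsetP=> x; rewrite !inE.
  by case/or3P=> /eqP->; rewrite ?gP ?gQ ?gR.
move/leq_trans/(_ (fixs_le2 gM g1)).
by rewrite cardsE (eq_card (B := mem [:: P; Q; R])) // (card_uniqP U).
Qed.

End FixedPoints.

(** * Orbits with nontrivial stabilisers *)

Section OrbitCount.

Local Open Scope nat_scope.

Variable L : finFieldType.
Implicit Types (P Q R : option L) (g h : {perm option L}) (H : {group {perm option L}}).

Definition stabp H P : {group {perm option L}} := 'C_H[P | 'P]%G.
(** A Moebius transformation with a single fixed point is conjugate to a translation, so these are
    the nontrivial unipotents at [P]. *)
Definition unip H P : {set {perm option L}} := [set h in H | fixs h == [set P]].

Lemma stabpE H P h : (h \in stabp H P) = (h \in H) && (h P == P).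
Proof. by rewrite inE; congr (_ && _); apply/astab1P/eqP. Qed.

Lemma stabpP H P h : reflect (h \in H /\ h P = P) (h \in stabp H P).
Proof. by rewrite stabpE; apply: (iffP andP) => -[hH /eqP]. Qed.

Lemma unipJ H y P : unip (H :^ y)%G (y P) = unip H P :^ y.
Proof.
apply/setP=> h; rewrite mem_conjg !inE -mem_conjg; congr (_ && _).
rewrite -{1}(conjgKV y h) fixsJ -(imset_set1 y P).
by rewrite (inj_eq (imset_inj (@perm_inj _ y))).
Qed.

Lemma stabpJ H y P : stabp (H :^ y)%G (y P) = stabp H P :^ y :> {set _}.
Proof.
apply/setP=> h; rewrite mem_conjg !stabpE -mem_conjg; congr (_ && _).
have -> : h (y P) = y ((h ^ y^-1)%g P) by rewrite conjgE invgK !permM permKV.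
by rewrite (inj_eq perm_inj).
Qed.

Variable H : {group {perm option L}}.
Hypothesis fix12 : {in H, forall h, h != 1%g -> 0 < #|fixs h| <= 2}.

Let N := #|H|.
Definition orb P := #|orbit 'P H P|.

Lemma orb_stab P : orb P * #|stabp H P| = N.
Proof. have := @card_orbit_in_stab _ _ _ ('P) H P (subsetT H). exact. Qed.

(** Counts the nontrivial elements fixing [P], the unipotent ones twice. Summed over all points,
    every nontrivial element is thus counted exactly twice, whether it has one fixed point or
    two. *)
Definition weight P := #|stabp H P|.-1 + #|unip H P|.

Lemma fixs1 : fixs (1%g : {perm option L}) = [set: option L].
Proof. by apply/setP=> P; rewrite !inE perm1 eqxx. Qed.

Lemma unip_neq1 P h : h \in unip H P -> h != 1%g.
Proof.
rewrite inE => /andP[_ /eqP E]; apply/eqP => h1; move: E; rewrite h1 fixs1.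
case: P => [z|] /setP E.
  by have := E None; rewrite !inE.
by have := E (Some 0%R); rewrite !inE.
Qed.

Lemma sum_weight : \sum_P weight P = 2 * N.-1.
Proof.
rewrite big_split /=.
have -> : \sum_P #|stabp H P|.-1 = \sum_(h in H^#) #|fixs h|.
  transitivity (\sum_P \sum_(h in H^#) (h P == P : nat)).
    apply: eq_bigr => P _; rewrite (cardsD1 1%g) group1 /= -sum1_card big_mkcond /=.
    rewrite [RHS]big_mkcond; apply: eq_bigr => h _.
    by rewrite in_setD1 stabpE in_setD1; case: (h != 1%g); case: (h \in H); case: (h P == P).
  rewrite exchange_big; apply: eq_bigr => h _; rewrite -sum1_card big_mkcond.
  by rewrite [RHS]big_mkcond; apply: eq_bigr => P _; rewrite inE; case: (h P == P).
have -> : \sum_P #|unip H P| = \sum_(h in H^#) (#|fixs h| == 1 : nat).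
  transitivity (\sum_P \sum_(h in H^#) (fixs h == [set P] : nat)).
    apply: eq_bigr => P _; rewrite -sum1_card big_mkcond [RHS]big_mkcond.
    apply: eq_bigr => h _; rewrite in_setD1; case: (boolP (h \in unip H P)) => [hu|].
      by rewrite (unip_neq1 hu); move: hu; rewrite inE => /andP[-> ->].
    by rewrite inE; case: (h != 1%g); case: (h \in H); case: (fixs h == _).
  rewrite exchange_big; apply: eq_bigr => h _.
  case: (boolP (#|fixs h| == 1)) => [/cards1P[P ->]|n1].
    rewrite (bigD1 P) //= eqxx big1 // => Q; rewrite eq_sym => QP.
    by rewrite (inj_eq set1_inj) (negbTE QP).
  by apply: big1 => P _; case: (eqVneq (fixs h) [set P]) => // E; rewrite E cards1 in n1.
rewrite -big_split /= (eq_bigr (fun=> 2)).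
  by rewrite sum_nat_const mulnC; congr (_ * _); rewrite /N (cardsD1 1%g H) group1.
by move=> h; rewrite in_setD1 => /andP[h1 hH]; have := fix12 hH h1; case: #|fixs h| => [|[|[]]].
Qed.

Lemma orbit_sym' P Q : Q \in orbit 'P H P -> orbit 'P H Q = orbit 'P H P.
Proof. by move=> QP; apply/(orbit_in_eqP (subsetT H)). Qed.

Lemma orbit_conj P Q : Q \in orbit 'P H P ->
  #|stabp H Q| = #|stabp H P| /\ #|unip H Q| = #|unip H P|.
Proof.
case/orbitP=> h hH <-; rewrite /= apermE.
have HJ : (H :^ h)%G = H by apply/val_inj; rewrite /= conjGid.
by rewrite -{1 3}HJ stabpJ unipJ !cardJg.
Qed.

Lemma weight_orbit P Q : Q \in orbit 'P H P -> weight Q = weight P.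
Proof. by case/orbit_conj=> E1 E2; rewrite /weight E1 E2. Qed.

(** Stated for an invariant set of points, so that the induction can remove one orbit at a time.
    Points with trivial stabiliser have weight zero. *)
Lemma orbit_list_sub (X : {set option L}) :
  (forall P Q, P \in X -> Q \in orbit 'P H P -> Q \in X) ->
  exists ps : seq (option L),
   [/\ \sum_(P in X) weight P = \sum_(P <- ps) orb P * weight P,
    {subset ps <= X}, forall P, P \in ps -> 1 < #|stabp H P|,
    pairwise [rel P Q | Q \notin orbit 'P H P] ps &
    forall Q, Q \in X -> 1 < #|stabp H Q| -> exists2 P, P \in ps & Q \in orbit 'P H P].
Proof.
have [n] := ubnP #|X|; elim: n X => // n IH X ltXn Xinv.
have [/existsP[P /andP[PX sP]]|] := boolP [exists P in X, 1 < #|stabp H P|]; last first.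
  rewrite negb_exists_in => /forall_inP noP; exists [::]; split=> //; last first.
    by move=> Q /noP/negbTE ->.
  rewrite big_nil big1 // => P PX; have := noP P PX; rewrite -leqNgt => s1.
  have {}s1 : #|stabp H P| = 1 by apply/eqP; rewrite eqn_leq s1 cardG_gt0.
  rewrite /weight s1 /=; apply/eqP; rewrite cards_eq0; apply/eqP/setP=> h; rewrite in_set0.
  apply/negP=> hu; have := unip_neq1 hu; rewrite inE in hu.
  have : h \in stabp H P.
    by case/andP: hu => hH /eqP E; rewrite stabpE hH /=; have := set11 P; rewrite -E inE.
  by move/eqP: s1; rewrite -trivg_card1 => /eqP ->; rewrite inE => ->.
have subX : orbit 'P H P \subset X by apply/subsetP=> Q; apply: Xinv.
have [||ps [E sub s2 pw cov]] := IH (X :\: orbit 'P H P).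
- rewrite -ltnS; apply: leq_trans ltXn; rewrite ltnS; apply: proper_card.
  apply/properP; split; first exact: subsetDl.
  by exists P; rewrite // !inE orbit_refl.
- move=> Q R; rewrite inE => /andP[QnO QX] RQ; rewrite inE (Xinv Q R) // andbT.
  by apply: contra QnO => RP; rewrite -(orbit_sym' RP) (orbit_sym' RQ) orbit_refl.
exists (P :: ps); split=> [|Q|Q||Q QX sQ].
- rewrite big_cons -E (big_setID (orbit 'P H P)) /=; congr (_ + _).
  rewrite (setIidPr subX) (eq_bigr (fun=> weight P)) ?sum_nat_const //.
  exact: weight_orbit.
- by rewrite inE => /orP[/eqP->//|/sub]; rewrite inE => /andP[].
- by rewrite inE => /orP[/eqP->//|/s2].
- rewrite pairwise_cons pw andbT; apply/allP=> Q /sub; rewrite inE => /andP[].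
  by [].
have [QO|QnO] := boolP (Q \in orbit 'P H P); first by exists P; rewrite ?inE ?eqxx.
have [|R Rps QR] := cov Q _ sQ; first by rewrite inE QnO.
by exists R; rewrite // inE Rps orbT.
Qed.

Lemma orbit_list : exists ps : seq (option L),
   [/\ 2 * N.-1 = \sum_(P <- ps) orb P * weight P,
    forall P, P \in ps -> 1 < #|stabp H P|,
    pairwise [rel P Q | Q \notin orbit 'P H P] ps &
    forall Q, 1 < #|stabp H Q| -> exists2 P, P \in ps & Q \in orbit 'P H P].
Proof.
have [|ps [E sub s2 pw cov]] := @orbit_list_sub [set: option L].
  by move=> *; rewrite inE.
exists ps; split=> //; last by move=> Q; apply: cov; rewrite inE.
by rewrite -E -sum_weight; apply: eq_bigl => P; rewrite inE.
Qed.

End OrbitCount.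

(** * The stabiliser of infinity *)

Section Borel.

Local Open Scope ring_scope.
Import GRing.Theory.

Variable L : finFieldType.
Implicit Types (a b c d x y z : L) (P Q R : option L) (g h : {perm option L}).
Implicit Types (A Z : {set L}).

Definition additive_set A := 0 \in A /\ {in A &, forall x y, x - y \in A}.

Lemma additive_setN A x : additive_set A -> x \in A -> - x \in A.
Proof. by move=> [A0 AB] xA; rewrite -sub0r AB. Qed.

Lemma additive_setD A x y : additive_set A -> x \in A -> y \in A -> x + y \in A.
Proof. by move=> AA xA yA; rewrite -[y]opprK; case: (AA) => _; apply=> //; apply: additive_setN. Qed.

(** [Z] is a disjoint union of cosets of [A]. *)
Lemma dvdn_card_additive A Z : additive_set A ->
  (forall z x, z \in Z -> x \in A -> z + x \in Z) -> (#|A| %| #|Z|)%N.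
Proof.
move=> AA ZA.
have eqR : {in Z & &, equivalence_rel [rel x y | y - x \in A]}.
  move=> x y z _ _ _; split=> /=; first by rewrite subrr; case: AA.
  move=> xy; apply/idP/idP => [xz|yz].
    have -> : z - y = (z - x) - (y - x) by ring.
    by case: AA => _; apply.
  have -> : z - x = (z - y) + (y - x) by ring.
  exact: additive_setD.
have part := equivalence_partitionP eqR.
rewrite (@card_uniform_partition _ #|A| _ _ _ part) ?dvdn_mull //.
move=> _ /imsetP[x xZ ->]; rewrite -(card_imset A (addrI x)); apply: eq_card => y.
rewrite !inE; apply/andP/imsetP => [[_ yx]|[a aA ->]].
  by exists (y - x); rewrite // addrC subrK.
by split; [apply: ZA | rewrite /= addrAC subrr add0r].
Qed.

Lemma card_char_power : (2%:R : L) != 0 ->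
  exists p, [/\ prime p, odd p & exists n, #|L| = (p ^ n)%N].
Proof.
move=> L2; have [p pr_p pL] := finPcharP L; exists p; split=> //.
  case: (even_prime pr_p) => // p2; move: pL L2; rewrite p2 inE /= => /eqP ->.
  by rewrite eqxx.
have := abelem_pgroup (fin_ring_pchar_abelem pL).
by rewrite /pgroup cardsT => /p_natP[n ->]; exists n.
Qed.

Lemma card_additive_power p n A : prime p -> #|L| = (p ^ n)%N -> additive_set A ->
  exists e, #|A| = (p ^ e)%N.
Proof.
move=> pr_p Ln AA.
have : (#|A| %| #|[set: L]|)%N by apply: dvdn_card_additive => // *; rewrite inE.
by rewrite cardsT Ln => /(dvdn_pfactor _ _ pr_p)[e _ ->]; exists e.
Qed.

Lemma odd_card_additive A : (2%:R : L) != 0 -> additive_set A -> odd #|A|.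
Proof.
move=> L2 AA; have [p [pr_p odd_p [n Ln]]] := card_char_power L2.
by have [e ->] := card_additive_power pr_p Ln AA; rewrite oddX odd_p orbT.
Qed.

Variable H : {group {perm option L}}.
Hypothesis HM : H \subset Mob L.

Definition transl : {set L} := [set c | aff 1 c \in H].
Definition mults : {set L} := [set a | (a != 0) && [exists c, aff a c \in H]].

Lemma translD x c y d : x != 0 -> y != 0 -> (aff x c * (aff y d)^-1)%g =
  aff (x / y) ((c - d) / y).
Proof.
by move=> x0 y0; rewrite affV // affM ?invr_eq0 //; congr aff; field.
Qed.

Lemma transl_additive : additive_set transl.
Proof.
split=> [|c d]; first by rewrite inE aff1 group1.
rewrite !inE => cH dH.
have := groupM cH (groupVr dH); rewrite translD ?oner_neq0 //.
by rewrite !divr1.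
Qed.

Lemma mem_mults a c : a != 0 -> aff a c \in H -> a \in mults.
Proof. by move=> a0 aH; rewrite inE a0; apply/existsP; exists c. Qed.

(** An affine map with multiplier [a] conjugates the translation by [x] to the one by [x * a]. *)
Lemma mults_transl a x : a \in mults -> x \in transl -> x * a \in transl.
Proof.
rewrite !inE => /andP[a0 /existsP[c cH]] xH.
have := groupJ xH cH; rewrite conjgE affV // !affM ?invr_eq0 ?mulf_neq0 ?oner_neq0 ?invr_eq0 //.
by rewrite mul1r mulVf // mulNr; congr (aff _ _ \in H); field.
Qed.

Lemma mem_stab_inf h : h \in stabp H None -> exists a c, [/\ a != 0, a \in mults & h = aff a c].
Proof.
case/stabpP=> hH /(affP (subsetP HM _ hH))[a a0 [c hE]].
by exists a, c; split=> //; apply: (@mem_mults _ c); rewrite -?hE.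
Qed.

Lemma unip_inf : unip H None = aff 1 @: (transl :\ 0).
Proof.
apply/setP=> h; rewrite inE; apply/andP/imsetP => [[hH /eqP fE]|[c]].
  have hinf : h None = None by apply/fixsP; rewrite fE set11.
  have [a a0 [c hE]] := affP (subsetP HM _ hH) hinf.
  move: fE; rewrite hE fixs_aff //; case: eqP => [a1|_].
    case: eqP => [_|c0 _]; first by move/setP/(_ (Some 0)); rewrite !inE.
    exists c; last by rewrite a1.
    by rewrite !inE; move/eqP: c0 => ->; rewrite -a1 -hE.
  by move/setP/(_ (Some (c / (1 - a)))); rewrite !inE eqxx orbT.
rewrite !inE => /andP[c0 cH] ->; rewrite cH fixs_aff ?oner_neq0 // eqxx (negbTE c0).
by rewrite eqxx.
Qed.

Lemma card_unip_inf : #|unip H None| = #|transl|.-1.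
Proof.
rewrite unip_inf card_in_imset; last first.
  by move=> c d _ _ /aff_inj[] //; rewrite oner_neq0.
by rewrite (cardsD1 0 transl) (proj1 transl_additive).
Qed.

Lemma card_stab_inf : #|stabp H None| = (#|transl| * #|mults|)%N.
Proof.
(* One element of [H] for each multiplier: these represent the cosets of the translations in the
   stabiliser. *)
pose c0 (a : L) := odflt 0 [pick c | aff a c \in H].
have c0P a : a \in mults -> aff a (c0 a) \in H.
  rewrite inE /c0 => /andP[_ /existsP[c cH]]; case: pickP => //= /(_ c).
  by rewrite cH.
have nz a : a \in mults -> a != 0 by rewrite inE => /andP[].
rewrite -cardsX -(@card_in_imset _ _ (fun p : L * L => aff p.2 (c0 p.2 + p.1))); last first.
  move=> [c a] [c' a'] /setXP[/= _ aM] /setXP[/= _ aM'] /aff_inj[||-> /addrI ->] //; exact: nz.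
apply: eq_card => h; apply/idP/imsetP => [hS|[[c a] /setXP[/= cT aM] ->]].
  have [a [c [a0 aM hE]]] := mem_stab_inf hS.
  exists (c - c0 a, a); last by rewrite hE /= addrC subrK.
  apply/setXP; split=> //=; rewrite inE.
  have hH : aff a c \in H by rewrite -hE; case/stabpP: hS.
  have := groupM (groupVr (c0P a aM)) hH.
  rewrite affV // affM ?invr_eq0 // mulVf //; congr (aff _ _ \in H); field; exact: a0.
apply/stabpP; rewrite aff_inf ?nz //; split=> //.
rewrite inE in cT; by have := groupM (c0P a aM) cT; rewrite (affM _ _ (nz a aM) (oner_neq0 L)) !mulr1.
Qed.

(** The multipliers act freely on the nonzero translations. *)
Lemma mults_bound : (1 < #|transl|)%N -> (#|mults| <= #|transl|.-1)%N.
Proof.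
rewrite (cardsD1 0 transl) (proj1 transl_additive) add1n ltnS => /card_gt0P[c].
rewrite in_setD1 => /andP[c0 cT] /=.
rewrite -(@card_in_imset _ _ (fun a => c * a) mults); last by move=> a b _ _ /(mulfI c0).
apply/subset_leq_card/subsetP=> _ /imsetP[a aM ->]; rewrite in_setD1 mults_transl // andbT.
by rewrite mulf_neq0 //; move: aM; rewrite inE => /andP[].
Qed.

(** The translations act freely on the finite points of the orbit of infinity. *)
Lemma orb_inf_dvd : (#|transl| %| (orb H None).-1)%N.
Proof.
pose Z := [set z | Some z \in orbit 'P H None].
suff -> : (orb H None).-1 = #|Z|.
  apply: dvdn_card_additive transl_additive _ => z x; rewrite !inE => zO xH.
  have -> : Some (z + x) = aff 1 x (Some z) by rewrite affE ?oner_neq0 // mulr1.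
  by rewrite -[aff 1 x _]/('P%act (Some z) (aff 1 x)) orbit_actr_in ?subsetT.
rewrite /orb (cardsD1 None) orbit_refl /= -(card_imset Z Some_inj).
apply: eq_card => P; rewrite !inE; apply/idP/imsetP => [|[z]].
  by case: P => [z|] //=; exists z; rewrite ?inE.
by rewrite inE => zO ->.
Qed.

End Borel.

(** * Solutions of the orbit equations *)

Section Arithmetic.

Local Open Scope nat_scope.

(* A unipotent part of order [q = m + 2], a point stabiliser of order [q * t] in an orbit
   of [1 + q * f] points, and [n] the order of the other nontrivial stabilisers. *)
Lemma unip_arith m t f n o1 : 0 < m -> odd m -> t <= m.+1 -> 0 < t -> 0 < f ->
  o1 * n = (1 + (m + 2) * f) * ((m + 2) * t) -> o1 = (1 + (m + 2) * f) * m + 2 ->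
  f = 1 /\ (t = m.+1 /\ n = m.+3 \/ 2 * t = m.+1 /\ 2 * n = m.+3) \/
  [/\ m = 1, t = 2, n = 5 & f = 3].
Proof.
move=> m0 om tm t0 f0 E1 E2.
set o := 1 + (m + 2) * f in E1 E2.
have E3 : o * ((m + 2) * t) = o * (n * m) + 2 * n.
  by rewrite -E1 E2 mulnDl mulnAC mulnA.
have le1 : n * m <= (m + 2) * t.
  rewrite -(leq_pmul2l (_ : 0 < o)) // E3; exact: leq_addr.
(* The remainder satisfies [o * r = 2 * n] and [2 * t = r * (1 + f * m)]; since [t <= m.+1], it can
   only be 1 or 2. *)
have [r E5] : exists r, (m + 2) * t = r + n * m by exists ((m + 2) * t - n * m); rewrite subnK.
have E4 : o * r = 2 * n by move: E3; rewrite E5 mulnDr addnC => /addnI.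
have E4' : (1 + (m + 2) * f) * r * m = 2 * n * m by rewrite -E4.
have E6 : 2 * t = r * (1 + f * m).
  apply/eqP; rewrite -(eqn_pmul2l (_ : 0 < m + 2)); last by rewrite addn2.
  apply/eqP; lia.
have r0 : 0 < r by rewrite lt0n; apply: contraTneq t0 => r0; rewrite r0 in E6; lia.
have r3 : r < 3.
  rewrite ltnNge; apply/negP => r3.
  have : 3 * (1 + 1 * m) <= r * (1 + f * m).
    by rewrite leq_mul // leq_add2l leq_mul2r f0 orbT.
  rewrite -E6; lia.
have rE : r = 1 \/ r = 2 by lia.
rewrite /o in E4.
(* With [q = m + 2], remainder 2 gives the numbers of PGL(2,q). Remainder 1 gives those of PSL(2,q)
   for [f = 1], a parity contradiction for [f = 2], and for larger [f] the icosahedral solution with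
   [q = 3]. *)
case: rE => rE; rewrite rE in E4 E6.
  have : f = 1 \/ f = 2 \/ 2 < f by lia.
  case=> [f1|[f2|f3]].
  - by subst f; left; split=> //; right; lia.
  - by exfalso; subst f; lia.
  - have m1 : m = 1.
      have : 3 * m <= f * m by rewrite leq_mul2r f3 orbT.
      lia.
    by subst m; right; split; lia.
have f1 : f = 1.
  have : f < 2 \/ 2 <= f by lia.
  case=> [|f2]; first by lia.
  have : 2 * m <= f * m by rewrite leq_mul2r f2 orbT.
  lia.
by subst f; left; split=> //; left; lia.
Qed.

(** The equation 1/x + 1/y + 1/z = 1 + 2/N of the finite rotation groups. The dihedral solution has
    an orbit of two points, which [2 < c] excludes. *)
Lemma elliptic_arith N a b c x y z : 0 < N -> a * x = N -> b * y = N -> c * z = N ->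
  1 < x -> 1 < y -> 1 < z -> 2 < a -> 2 < b -> 2 < c -> a + b + c = N + 2 ->
  x <= y -> y <= z -> [/\ x = 2, y = 3 & [\/ z = 3 /\ N = 12, z = 4 /\ N = 24 | z = 5 /\ N = 60]].
Proof.
move=> N0 ax bY cz x1 y1 z1 a2 b2 c2 S xy yz.
have big k u v w : u * v = w -> k <= v -> k * u <= w by move=> <- kv; rewrite mulnC leq_mul2l kv orbT.
have x2 : x = 2.
  have : x = 2 \/ 3 <= x by lia.
  case=> // x3.
  have := big 3 _ _ _ ax x3; have := big 3 _ _ _ bY (leq_trans x3 xy).
  have := big 3 _ _ _ cz (leq_trans x3 (leq_trans xy yz)); lia.
subst x.
have y3 : y = 3.
  have : y = 2 \/ y = 3 \/ 4 <= y by lia.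
  case=> [y2|[//|y4]]; first by subst y; lia.
  have := big 4 _ _ _ bY y4; have := big 4 _ _ _ cz (leq_trans y4 yz); lia.
subst y; split=> //.
have z6 : z < 6.
  rewrite ltnNge; apply/negP=> z6; have := big 6 _ _ _ cz z6; lia.
have : z = 3 \/ z = 4 \/ z = 5 by lia.
by case=> [zE|[zE|zE]]; subst z; [constructor 1 | constructor 2 | constructor 3]; lia.
Qed.

End Arithmetic.

(** * Orbit data of groups preserving no set of at most two points *)

Section Classification.

Local Open Scope nat_scope.

Variable L : finFieldType.
Implicit Types (P Q R : option L) (g h : {perm option L}) (H K : {group {perm option L}}).
Hypothesis L2 : (2%:R != 0 :> L)%R.

Definition irred H := [forall P, exists h in H, h P != P].
(** The points may coincide, so that a common fixed point is excluded as well. *)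
Definition good H := [forall P, forall Q, exists h in H, h @: [set P; Q] != [set P; Q]].

Lemma irredP H : reflect (forall P, exists2 h, h \in H & h P != P) (irred H).
Proof. by apply: (iffP forallP) => irr P; apply/exists_inP. Qed.

Lemma goodP H : reflect (forall P Q, exists2 h, h \in H & h @: [set P; Q] != [set P; Q]) (good H).
Proof.
apply: (iffP forallP) => irr P; first by move=> Q; apply/exists_inP/(forallP (irr P)).
by apply/forallP=> Q; apply/exists_inP.
Qed.

Lemma good_irred H : good H -> irred H.
Proof.
move/goodP=> gH; apply/irredP=> P; have [h hH] := gH P P.
by rewrite setUid imset_set1 (inj_eq set1_inj) => hP; exists h.
Qed.

Lemma goodS H K : H \subset K -> good H -> good K.
Proof.
by move=> HK /goodP irr; apply/goodP=> P Q; have [h /(subsetP HK)] := irr P Q; exists h.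
Qed.

Section Fixed.

Variable H : {group {perm option L}}.
Hypothesis HM : H \subset Mob L.
Hypothesis fixH : {in H, forall h, 0 < #|fixs h|}.

Lemma fix12 : {in H, forall h, h != 1%g -> 0 < #|fixs h| <= 2}.
Proof. by move=> h hH h1; rewrite fixH // fixs_le2 // (subsetP HM). Qed.

Lemma irred_orb P : irred H -> 1 < orb H P.
Proof.
move/irredP/(_ P)=> [h hH hP]; rewrite ltnNge; apply/negP => o1.
have /card_orbit1 E : #|orbit 'P H P| = 1.
  by apply/eqP; rewrite eqn_leq o1 lt0n; apply/eqP=> /card0_eq/(_ P); rewrite orbit_refl.
have : h P \in orbit 'P H P by apply/orbitP; exists h.
by rewrite E inE (negbTE hP).
Qed.

Lemma good_orb P : good H -> 2 < orb H P.
Proof.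
move=> gH; rewrite ltn_neqAle irred_orb ?good_irred // andbT eq_sym; apply/eqP=> o2.
have E2 : #|orbit 'P H P| == 2 by rewrite -/(orb H P) o2.
have /cards2P[Q [R [QR E]]] := E2.
have [h hH /negP nE] := goodP _ gH Q R; apply: nE; rewrite -E.
rewrite eqEcard (card_imset _ (@perm_inj _ h)) leqnn andbT.
apply/subsetP=> _ /imsetP[S SO ->].
by rewrite -[h S]/('P%act S h) orbit_actr_in ?subsetT.
Qed.

Lemma conj_fix (y : {perm option L}) : y \in Mob L ->
  ((H :^ y)%G \subset Mob L) /\ {in (H :^ y)%G, forall h, 0 < #|fixs h|}.
Proof.
move=> yM; split; first by rewrite -(conjGid yM) conjSg.
move=> _ /imsetP[h hH ->]; rewrite fixsJ card_imset ?fixH //; exact: perm_inj.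
Qed.

Lemma orbJ (y : {perm option L}) P : orb (H :^ y)%G (y P) = orb H P.
Proof.
apply/eqP; rewrite -(eqn_pmul2r (cardG_gt0 (stabp H P))) orb_stab.
by rewrite -(cardJg _ y) -stabpJ orb_stab /= cardJg.
Qed.

(** Here [m + 2] is the order of the translation group at [P], which is odd and at least 3; the
    shift by 2 keeps the later equations free of subtraction. [t] counts multipliers. *)
Lemma unip_data P : unip H P != set0 -> irred H -> exists m t f,
  [/\ [/\ 0 < m, odd m, t <= m.+1, 0 < t & 0 < f],
      #|unip H P| = m.+1, #|stabp H P| = (m + 2) * t & orb H P = 1 + (m + 2) * f].
Proof.
move=> U0 irr; have o1 := irred_orb P irr.
have [y yM yP] := Mob_move_inf P; have [KM _] := conj_fix yM.
have EU : #|unip H P| = #|unip (H :^ y)%G None| by rewrite -yP unipJ cardJg.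
have ES : #|stabp H P| = #|stabp (H :^ y)%G None| by rewrite -yP stabpJ cardJg.
have EO : orb H P = orb (H :^ y)%G None by rewrite -yP orbJ.
rewrite -card_gt0 EU in U0; rewrite EO in o1; rewrite EU ES EO.
move: (H :^ y)%G KM o1 U0 {EU ES EO} => K KM o1 U0.
rewrite (card_unip_inf KM) (card_stab_inf KM).
have := orb_inf_dvd K; have := @mults_bound _ K.
have oddT := odd_card_additive L2 (transl_additive K).
have T1 : 1 < #|transl K|.
  by rewrite (card_unip_inf KM) in U0; lia.
have T2 : 2 < #|transl K| by case: #|transl K| oddT T1 => [|[|[]]].
have [m mE] : exists m, #|transl K| = m + 2 by exists (#|transl K| - 2); lia.
have M0 : 0 < #|mults K|.
  by apply/card_gt0P; exists 1%R; rewrite inE GRing.oner_neq0; apply/existsP; exists 0%R; rewrite aff1.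
move=> /(_ T1) tm /dvdnP[f fE].
exists m, #|mults K|, f; rewrite mE in oddT T2 tm fE *.
split; [split|..] => //; try lia.
Qed.

Lemma weight_ge P : 1 < #|stabp H P| -> #|H| <= 2 * (orb H P * weight H P).
Proof.
move=> s1; rewrite -(orb_stab H P) mulnCA leq_mul2l /weight; apply/orP; right.
rewrite /orb; lia.
Qed.

Lemma weight_tor P : unip H P = set0 -> orb H P * weight H P = #|H| - orb H P.
Proof. by move=> U0; rewrite /weight U0 cards0 addn0 -subn1 mulnBr muln1 orb_stab. Qed.

End Fixed.

End Classification.

Section Numbers.

Local Open Scope nat_scope.

Variable L : finFieldType.
Implicit Types (P Q R : option L) (g h : {perm option L}).
Hypothesis L2 : (2%:R != 0 :> L)%R.

Variable H : {group {perm option L}}.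
Hypothesis HM : H \subset Mob L.
Hypothesis fixH : {in H, forall h, 0 < #|fixs h|}.

Lemma unip_weight P m t : #|unip H P| = m.+1 -> #|stabp H P| = (m + 2) * t -> 0 < t ->
  orb H P * weight H P = #|H| + orb H P * m.
Proof.
move=> U S t0; rewrite -(orb_stab H P) -mulnDr /weight U S; congr (_ * _).
have : 0 < (m + 2) * t by rewrite muln_gt0 addn2.
lia.
Qed.

(** A unipotent orbit contributes more than [#|H|] to the total [2 * #|H|.-1], and any other
    nontrivial one at least half of [#|H|]. Hence there is exactly one other, and it is not
    unipotent. *)
Lemma unip_numbers P : unip H P != set0 -> irred H -> exists m t f n Q,
  [/\ [/\ 0 < m, odd m, t <= m.+1, 0 < t & 0 < f],
     [/\ #|unip H P| = m.+1, #|stabp H P| = (m + 2) * t & orb H P = 1 + (m + 2) * f],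
     [/\ unip H Q = set0, #|stabp H Q| = n, 1 < n &
       forall R, 1 < #|stabp H R| -> #|stabp H R| = (m + 2) * t \/ #|stabp H R| = n] &
     f = 1 /\ (t = m.+1 /\ n = m.+3 \/ 2 * t = m.+1 /\ 2 * n = m.+3) \/
     [/\ m = 1, t = 2, n = 5 & f = 3]].
Proof.
move=> U0 irr; have [m [t [f [[m0 om tm t0 f0] U S O]]]] := unip_data L2 HM fixH U0 irr.
have N0 : 0 < #|H| by exact: cardG_gt0.
have [ps [sumE s2 _ cov]] := orbit_list (fix12 HM fixH).
have sP : 1 < #|stabp H P|.
  by rewrite S; apply: leq_trans (leq_pmulr _ t0); rewrite addn2.
have [p0 p0ps Pp0] := cov P sP.
have [E1 E2] := orbit_conj Pp0; have E3 : orb H P = orb H p0 by rewrite /orb (orbit_sym' Pp0).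
move: sumE; rewrite (perm_big _ (perm_to_rem p0ps)) big_cons /= => sumE.
have W0 : orb H p0 * weight H p0 = #|H| + orb H P * m.
  by rewrite -(@weight_orbit _ _ _ _ Pp0) -E3 (unip_weight U S).
have NE := orb_stab H P; rewrite S in NE.
have psE : forall p, p \in ps -> p = p0 \/ p \in rem p0 ps.
  by move=> p; rewrite (perm_mem (perm_to_rem p0ps)) inE => /orP[/eqP|]; [left|right].
have s2' : {in rem p0 ps, forall p, 1 < #|stabp H p|}.
  by move=> p pr; apply: s2; rewrite (perm_mem (perm_to_rem p0ps)) inE pr orbT.
case: (rem p0 ps) sumE s2' psE => [|q [|r rest]] sumE s2' psE; rewrite W0 in sumE.
(* A single orbit of size o would give N = o m + 2, whereas N is at least o (m + 2) and o > 1. *)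
- rewrite big_nil in sumE; exfalso.
  have : orb H P * (m + 2) <= #|H| by rewrite -NE mulnA leq_pmulr.
  have := irred_orb P irr.
  move: sumE N0; move: #|H| (orb H P) => N o; clear; lia.
- rewrite big_cons big_nil addn0 in sumE.
  have sq : 1 < #|stabp H q| by apply: s2'; rewrite inE eqxx.
  have [Uq|Uq] := eqVneq (unip H q) set0; last first.
    have [m' [t' [f' [[m0' om' tm' t0' f0'] U' S' O']]]] := unip_data L2 HM fixH Uq irr.
    by exfalso; move: sumE N0; rewrite (unip_weight U' S') //;
      move: #|H| (orb _ _) (orb _ _) => N o1 o2; clear; lia.
  rewrite (weight_tor Uq) in sumE.
  have oq := orb_stab H q.
  have leq : orb H q <= #|H| by rewrite -oq leq_pmulr ?cardG_gt0.
  have o1 : orb H q = orb H P * m + 2.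
    by move: sumE N0 leq; move: #|H| (orb H P) (orb H q) => N x y; clear; lia.
  exists m, t, f, #|stabp H q|, q; split=> //; first split=> //.
    move=> R /cov[p /psE[->|]]; first by case/orbit_conj=> ->; left; rewrite -E1.
    by rewrite inE => /eqP -> /orbit_conj[-> _]; right.
  apply: (unip_arith m0 om tm t0 f0 (o1 := orb H q)); last by rewrite o1 O.
  by rewrite oq -NE O.
exfalso; rewrite !big_cons in sumE.
have wq : #|H| <= 2 * (orb H q * weight H q).
  by apply: (weight_ge L2 HM); apply: s2'; rewrite inE eqxx.
have wr : #|H| <= 2 * (orb H r * weight H r).
  by apply: (weight_ge L2 HM); apply: s2'; rewrite !inE eqxx orbT.
move: sumE N0 wq wr; move: #|H| (orb H P) (orb _ _ * _) (orb _ _ * _) (\sum_(_ <- _) _).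
by move=> N x y z w; clear; lia.
Qed.

Definition goodtype_a := #|H| = 12 /\ forall P, #|stabp H P| <= 3.
(** The divisibility clause will identify the stabilisers of the two fixed points of an elliptic
    element. *)
Definition goodtype_b n := exists P, [/\ unip H P = set0, #|stabp H P| = n &
   forall R, n %| #|stabp H R| -> #|stabp H R| = n].

Lemma elliptic_numbers : (forall P, unip H P = set0) -> good H ->
  [\/ goodtype_a, #|H| = 24 /\ goodtype_b 4 | #|H| = 60 /\ goodtype_b 5].
Proof.
move=> U0 gH; have irr := good_irred gH.
have N0 : 0 < #|H| by exact: cardG_gt0.
have [ps [sumE s2 _ cov]] := orbit_list (fix12 HM fixH).
rewrite (eq_bigr (fun P => #|H| - orb H P)) in sumE; last first.
  by move=> P _; rewrite weight_tor.
have N3 : 2 < #|H|.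
  apply: leq_trans (good_orb None gH) _.
  by rewrite -(orb_stab H None) leq_pmulr ?cardG_gt0.
have half p : p \in ps -> 2 * orb H p <= #|H|.
  by move/s2=> s1; rewrite -(orb_stab H p) mulnC leq_mul2l s1 orbT.
have o3 p : 2 < orb H p by apply: good_orb.
have os p := orb_stab H p.
(* Each orbit contributes [#|H| - orb H p], at least half of [#|H|], and orbits have more than two
   points: this leaves exactly three orbits, which may be sorted by their stabilisers. *)
suff main a b c : perm_eq ps [:: a; b; c] -> #|stabp H a| <= #|stabp H b| ->
    #|stabp H b| <= #|stabp H c| ->
    [\/ goodtype_a, #|H| = 24 /\ goodtype_b 4 | #|H| = 60 /\ goodtype_b 5].
  case: ps sumE s2 half cov main => [|a [|b [|c [|d ps]]]] sumE s2 half cov main.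
  - by rewrite big_nil in sumE; lia.
  - rewrite big_cons big_nil in sumE; have := o3 a; lia.
  - rewrite !big_cons big_nil in sumE; have := o3 a; have := o3 b.
    have := half a; have := half b; rewrite !inE !eqxx ?orbT; lia.
  - have tr := perm_refl [:: a; b; c].
    have [ab|ba] := leqP #|stabp H a| #|stabp H b|.
      have [bc|cb] := leqP #|stabp H b| #|stabp H c|; first exact: (main a b c).
      have [ac|ca] := leqP #|stabp H a| #|stabp H c|.
        by apply: (main a c b) => //; [rewrite perm_cons (perm_catC [:: b] [:: c]) | apply: ltnW].
      apply: (main c a b) => //; last exact: ltnW.
      by rewrite (perm_catC [:: a; b] [:: c]).
    have [ac|ca] := leqP #|stabp H a| #|stabp H c|.
      apply: (main b a c) => //; last exact: ltnW.
      by rewrite (perm_cat2r [:: c] [:: a; b] [:: b; a]) (perm_catC [:: a] [:: b]).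
    have [bc|cb] := leqP #|stabp H b| #|stabp H c|.
      by apply: (main b c a) => //; [rewrite (perm_catC [:: a] [:: b; c]) | apply: ltnW].
    apply: (main c b a); [|exact: ltnW|exact: ltnW].
    by apply/seq.permP=> p /=; lia.
  - rewrite !big_cons in sumE.
    have := half a; have := half b; have := half c; have := half d.
    rewrite !inE !eqxx ?orbT => /(_ isT) + /(_ isT) + /(_ isT) + /(_ isT); lia.
move=> pE sab sbc.
have memp p : (p \in ps) = (p \in [:: a; b; c]) by apply: perm_mem.
have [ha hb hc] : [/\ a \in ps, b \in ps & c \in ps] by rewrite !memp !inE !eqxx ?orbT.
rewrite (perm_big _ pE) !big_cons big_nil in sumE.
have S : orb H a + orb H b + orb H c = #|H| + 2.
  have := half a ha; have := half b hb; have := half c hc; move: sumE N0 => /=.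
  move: #|H| (orb H a) (orb H b) (orb H c) => N x y z; clear; lia.
have [xE yE zE] := elliptic_arith N0 (os a) (os b) (os c) (s2 a ha) (s2 b hb) (s2 c hc)
  (o3 a) (o3 b) (o3 c) S sab sbc.
have cases R : [\/ #|stabp H R| = 1, #|stabp H R| = 2, #|stabp H R| = 3 |
    #|stabp H R| = #|stabp H c| ].
  have := cardG_gt0 (stabp H R); rewrite leq_eqVlt => /orP[/eqP|/cov[p]]; first by constructor 1.
  rewrite memp !inE => /or3P[] /eqP-> /orbit_conj[-> _];
    [constructor 2|constructor 3|constructor 4] => //.
have typeb n : 3 < n -> #|stabp H c| = n -> goodtype_b n.
  move=> n3 cn; exists c; split=> // R /(dvdn_leq (cardG_gt0 _)).
  by case: (cases R) => ->; rewrite ?cn //; move: n3; clear; lia.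
case: zE => -[zn Nn]; [constructor 1|constructor 2|constructor 3]; split=> //;
  try by apply: typeb.
by move=> R; case: (cases R) => -> //; rewrite zn.
Qed.

Lemma good_numbers : good H ->
  [\/ goodtype_a, #|H| = 24 /\ goodtype_b 4, #|H| = 60 /\ goodtype_b 5 |
   exists P m t, [/\ 2 < m, odd m, #|unip H P| = m.+1 &
     [/\ orb H P = m.+3, #|stabp H P| = (m + 2) * t, t <= m.+1 & m.+1 <= 2 * t]]].
Proof.
move=> gH; have irr := good_irred gH.
have [/existsP[P UP]|] := boolP [exists P, unip H P != set0]; last first.
  rewrite negb_exists => /forallP U0.
  case: elliptic_numbers => // [P|||]; first by apply/eqP; have := U0 P; rewrite negbK.
  - by constructor 1.
  - by constructor 2.
  - by constructor 3.
have [m [t [f [n [Q [[m0 om tm t0 f0] [U S O] [UQ SQ n1 SR] ar]]]]]] := unip_numbers UP irr.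
have NE := orb_stab H P; rewrite S O in NE.
have typeb k : n = k -> ~~ (k %| 1) -> ~~ (k %| (m + 2) * t) -> goodtype_b k.
  move=> nk k1 kS; exists Q; split=> //; first by rewrite SQ.
  move=> R; have := cardG_gt0 (stabp H R); rewrite leq_eqVlt => /orP[/eqP <-|/SR[->|->]] //.
    by rewrite (negbTE k1).
  by rewrite (negbTE kS).
(* For three translations the subfield groups PSL(2,3) and PGL(2,3) are the tetrahedral and
   octahedral groups, and are listed with these. *)
have [m1|m1] : m = 1 \/ 2 < m by case: m m0 om {tm U S O SR ar NE typeb} => [|[|[|m]]] //; [left|right].
  subst m; case: ar => [[f1 [[tE nE]|[tE nE]]]|[_ tE nE fE]].
  - by constructor 2; split; [rewrite -NE f1 tE | apply: typeb; rewrite ?nE ?tE].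
  - have t1 : t = 1 by lia.
    have n2 : n = 2 by lia.
    constructor 1; split; first by rewrite -NE f1 t1.
    move=> R; have := cardG_gt0 (stabp H R); rewrite leq_eqVlt => /orP[/eqP <-|/SR[->|->]] //.
      by rewrite t1.
    by rewrite n2.
  - by constructor 3; split; [rewrite -NE fE tE | apply: typeb; rewrite ?nE ?tE].
case: ar => [[f1 ar]|[mE]]; last by rewrite mE in m1.
constructor 4; exists P, m, t; split=> //; split=> //; first by rewrite O f1 muln1; lia.
lia.
Qed.

End Numbers.

(** * Subgroups of subfield type *)

Section SubfieldType.

Local Open Scope ring_scope.
Import GRing.Theory.

Variable L : finFieldType.
Implicit Types (a b c d x y z : L) (P Q R : option L) (g h : {perm option L}).
Implicit Types (H A : {group {perm option L}}).

(** The unipotents fixing zero, opposite to the translations. *)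
Definition low x := mob 1 x 0 1.

Section OneField.

Variable K : {set L}.
Hypothesis sK : subfield K.

Lemma subfield_additive : additive_set K.
Proof. by split; [apply: sf0 | move=> x y; apply: sfB]. Qed.

Lemma aff_PSL x : x \in K -> aff 1%R x \in PSLset K.
Proof.
move=> xK; apply/PSLsetP; exists 1, 0, x, 1.
by rewrite sf0 ?sf1 ?xK // mulr1 mul0r subr0.
Qed.

Lemma low_PSL x : x \in K -> low x \in PSLset K.
Proof.
move=> xK; apply/PSLsetP; exists 1, x, 0, 1.
by rewrite sf0 ?sf1 ?xK // mulr1 mulr0 subr0.
Qed.

(** If [b != 0], a matrix of determinant 1 is a translation times an opposite unipotent times a
    translation; if [b = 0], a factor [low (- 1)] reduces to this case. *)
Lemma PSL_generated A : {in K, forall x, aff 1%R x \in A} -> {in K, forall x, low x \in A} ->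
  PSLset K \subset A.
Proof.
move=> uA lA; have D1 x : (1 * 1 - 0 * x : L) != 0 by rewrite mulr1 mul0r subr0 oner_neq0.
have D2 x : (1 * 1 - x * 0 : L) != 0 by rewrite mulr1 mulr0 subr0 oner_neq0.
have main a b c d : [&& a \in K, b \in K, c \in K & d \in K] -> a * d - b * c = 1 ->
    b != 0 -> mob a b c d \in A.
  move=> /and4P[aK bK cK dK] D b0.
  have -> : mob a b c d = (aff 1%R ((d - 1) / b)%R * low b * aff 1%R ((a - 1) / b)%R)%g.
    rewrite /aff /low !mobM ?det_mul ?mulf_neq0 //.
    have -> : c = (a * d - 1) / b by rewrite -D; field.
    by apply: eq_mob; field.
  by rewrite !groupM ?uA ?lA // sf_div // sfB // sf1.
apply/subsetP=> g /PSLsetP[a [b [c [d [/and4P[aK bK cK dK] D ->]]]]].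
have [b0|b0] := eqVneq b 0; last by apply: main; rewrite ?aK ?bK ?cK ?dK.
have a0 : a != 0 by apply: contra_eq_neq D => ->; rewrite b0 !mul0r subr0 eq_sym oner_neq0.
have -> : mob a b c d = (mob a (a + b)%R c (c + d)%R * low (- 1)%R)%g.
  rewrite /low mobM //; first by apply: eq_mob; ring.
  by have -> : a * (c + d) - (a + b) * c = a * d - b * c by [ring]; rewrite D oner_neq0.
rewrite groupM ?lA ?sfN ?sf1 // main ?sfD ?aK ?cK ?bK ?dK //.
  by rewrite -D; ring.
by rewrite b0 addr0.
Qed.

(** Translations on both sides clear the diagonal of an element moving infinity; the antidiagonal
    element left conjugates translations to opposite unipotents. *)
Lemma PSL_bruhat A a b c d : {in K, forall x, aff 1%R x \in A} ->
  [&& a \in K, b \in K, c \in K & d \in K] -> a * d - b * c != 0 -> b != 0 ->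
  mob a b c d \in A -> PSLset K \subset A.
Proof.
move=> uA /and4P[aK bK cK dK] D b0 gA.
have D1 x : (1 * 1 - 0 * x : L) != 0 by rewrite mulr1 mul0r subr0 oner_neq0.
pose c' := (b * c - a * d) / b.
have c'K : c' \in K by rewrite sf_div // sfB ?sfM.
have c0 : c' != 0 by rewrite mulf_neq0 ?invr_eq0 // -oppr_eq0 opprB.
have wA : mob 0 b c' 0 \in A.
  have -> : mob 0 b c' 0 = (aff 1%R (- d / b)%R * mob a b c d * aff 1%R (- a / b)%R)%g.
    by rewrite /aff !mobM ?det_mul ?mulf_neq0 //; apply: eq_mob; rewrite /c'; field.
  by rewrite !groupM ?uA // sf_div ?sfN.
have Dw : 0 * 0 - b * c' != 0 by rewrite mul0r sub0r oppr_eq0 mulf_neq0.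
apply: (PSL_generated uA) => x xK.
have -> : low x = (aff 1%R (c' / b * x)%R ^ mob 0 b c' 0)%g.
  rewrite conjgE mobV // /aff /low !mobM ?det_mul ?mulf_neq0 ?D1 //; last first.
    by rewrite mul0r mulrNN sub0r oppr_eq0 mulf_neq0.
  transitivity (mob (- (b * c') * 1) (- (b * c') * x) (- (b * c') * 0) (- (b * c') * 1)).
    by rewrite mob_scale // oppr_eq0 mulf_neq0.
  by apply: eq_mob; field.
by apply: groupJ wA; apply: uA; apply: (sfM sK) => //; apply: (sf_div sK).
Qed.

Lemma PGL_rat g P : g \in PGLset K -> P \in rat_pts K -> g P \in rat_pts K.
Proof.
move=> /PGLsetP[a [b [c [d [/and4P[aK bK cK dK] D ->]]]]].
case: P => [z|]; rewrite inE => zK.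
  rewrite mob_SomeE // /pt; case: eqP => _; rewrite inE //.
  by rewrite sf_div // sfD // sfM.
by rewrite mob_infE // /pt; case: eqP => _; rewrite inE // sf_div.
Qed.

Lemma rat_PGL g : g \in Mob L -> {in rat_pts K, forall P, g P \in rat_pts K} -> g \in PGLset K.
Proof.
case/MobP=> a [b [c [d [D ->]]]] gK.
have [k1 k0] : (1 \in K) /\ (0 \in K) by rewrite sf1 ?sf0.
have g0 := gK (Some 0); have g1 := gK (Some 1); have gi := gK None.
rewrite !inE mob_SomeE // mul0r mul0r !add0r in g0.
rewrite !inE mob_SomeE // !mul1r in g1.
rewrite !inE mob_infE // in gi.
have {}g0 := g0 k0; have {}g1 := g1 k1; have {}gi := gi isT.
have [b0|b0] := eqVneq b 0.
  move: D g0 g1; rewrite b0 mul0r subr0 mulf_eq0 => /norP[a0 d0].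
  rewrite add0r /pt (negbTE d0) mulrDl => cK acK.
  have aK : a / d \in K by rewrite -[X in X \in K](addrK (c / d)) sfB.
  apply/PGLsetP; exists (a / d), 0, (c / d), 1; rewrite k0 k1 cK aK; split=> //.
    by rewrite mulr1 mul0r subr0 mulf_neq0 ?invr_eq0.
  transitivity (mob (d * (a / d)) (d * 0) (d * (c / d)) (d * 1)); last exact: mob_scale.
  by rewrite mulr0 mulr1 !mulrA ![d * _]mulrC !mulfK.
rewrite /pt (negbTE b0) in gi.
(* By finiteness infinity has a rational preimage, namely [- d / b]. *)
have imK : mob a b c d @: rat_pts K = rat_pts K.
  apply/eqP; rewrite eqEcard (card_imset _ (@perm_inj _ _)) leqnn andbT.
  by apply/subsetP=> _ /imsetP[P PK ->]; apply: gK.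
have dK : d / b \in K.
  have : None \in mob a b c d @: rat_pts K by rewrite imK inE.
  case/imsetP=> [[z|]]; rewrite inE => zK /esym.
    rewrite mob_SomeE // /pt; case: eqP => // /eqP; rewrite addr_eq0 => /eqP E _.
    by rewrite -[d]opprK -E mulNr mulfK // sfN.
  by move/eqP; rewrite mob_fix_inf // (negbTE b0).
have cK : c / b \in K.
  have [d0|d0] := eqVneq d 0.
    move: g1; rewrite d0 addr0 /pt (negbTE b0) mulrDl => acK.
    by rewrite -[X in X \in K](addKr (a / b)) sfD // sfN.
  move: g0; rewrite /pt (negbTE d0) => cdK.
  have -> : c / b = (c / d) * (d / b) by field; rewrite b0 d0.
  by rewrite sfM.
apply/PGLsetP; exists (a / b), 1, (c / b), (d / b); rewrite k1 gi cK dK; split=> //.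
  have -> : a / b * (d / b) - 1 * (c / b) = (a * d - b * c) / b ^+ 2 by field.
  by rewrite mulf_neq0 ?invr_eq0 ?expf_neq0.
transitivity (mob (b * (a / b)) (b * 1) (b * (c / b)) (b * (d / b))); last exact: mob_scale.
by rewrite mulr1 !mulrA ![b * _]mulrC !mulfK.
Qed.

End OneField.

Section Core.

Variable H : {group {perm option L}}.
Hypothesis HM : H \subset Mob L.

Lemma subfield_core t : 1 \in transl H -> Some 0 \in orbit 'P H None ->
  orb H None = #|transl H|.+1 -> #|stabp H None| = (#|transl H| * t)%N ->
  (#|transl H| <= t.*2.+1)%N ->
  [/\ subfield (transl H), PSLset (transl H) \subset H & H \subset PGLset (transl H)].
Proof.
set K := transl H => K1 O0 orbE stE Kt.
have AK : additive_set K := transl_additive H.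
have uH x : x \in K -> aff 1%R x \in H by rewrite inE.
(* Translates of zero put the rational points into the orbit, and the sizes agree. *)
have ratE : rat_pts K = orbit 'P H None.
  apply/eqP; rewrite eqEcard; apply/andP; split; last first.
    rewrite -/(orb H None) orbE (cardsD1 None) inE add1n ltnS -(card_imset K Some_inj).
    by apply/subset_leq_card/subsetP=> _ /imsetP[x xK ->]; rewrite in_setD1 inE.
  apply/subsetP=> -[x|]; rewrite inE => xK; last exact: orbit_refl.
  have -> : Some x = aff 1 x (Some 0) by rewrite affE ?oner_neq0 // mul0r add0r.
  by rewrite -[aff 1 x _]/('P%act (Some 0) (aff 1 x)) orbit_actr_in ?subsetT ?uH.
have preserve g : g \in H -> {in rat_pts K, forall P, g P \in rat_pts K}.
  move=> gH P; rewrite ratE => PO.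
  by rewrite -[g P]/('P%act P g) orbit_actr_in ?subsetT.
have affH a : a \in mults H -> aff a 0 \in H.
  rewrite inE => /andP[a0 /existsP[c cH]].
  have O0' : Some 0 \in rat_pts K by rewrite ratE.
  have := preserve _ cH _ O0'; rewrite affE // mul0r add0r inE => cK.
  have := groupM cH (uH _ (additive_setN AK cK)).
  by rewrite affM ?oner_neq0 // !mulr1 subrr.
have tE : #|mults H| = t.
  apply/eqP; rewrite -(eqn_pmul2l (_ : 0 < #|K|)%N) -?stE -?card_stab_inf //.
  by apply/card_gt0P; exists 1.
(* The ring of multipliers of the additive group [K]. It lies in [K] because [1 \in K], and it
   contains zero and the [t] multipliers of [H], thus more than half of [K]. By divisibility it is
   [K], which is therefore a field. *)
pose R := [set x | [forall k in K, k * x \in K]].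
have RP x : reflect {in K, forall k, k * x \in K} (x \in R).
  by rewrite inE; apply: (iffP forall_inP).
have RK : R \subset K by apply/subsetP=> x /RP/(_ 1 K1); rewrite mul1r.
have AR : additive_set R.
  split=> [|x y /RP xR /RP yR]; apply/RP=> k kK; first by rewrite mulr0; case: AK.
  by rewrite mulrBr; case: AK => _; apply; [apply: xR | apply: yR].
have cardR : (t < #|R|)%N.
  rewrite (cardsD1 0) (proj1 AR) add1n ltnS -tE; apply/subset_leq_card/subsetP=> a aM.
  rewrite in_setD1; apply/andP; split; first by move: aM; rewrite inE => /andP[].
  by apply/RP=> k kK; apply: mults_transl.
have dvd : (#|R| %| #|K|)%N.
  apply: dvdn_card_additive AR _ => z x zK /(subsetP RK) xK; exact: additive_setD.
have RKE : R = K.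
  apply/eqP; rewrite eqEcard RK /=; case/dvdnP: dvd => -[|[|m]] E.
  - by move: K1; rewrite (cards0_eq E) inE.
  - by rewrite E mul1n.
  - exfalso; move: E cardR Kt; rewrite -/K; move: #|R| #|K| => r k; clear.
    have : (2 * r <= m.+2 * r)%N by rewrite leq_mul2r orbT.
    lia.
have sK : subfield K.
  split=> // [x y xK yK|x y xK]; first by case: AK => _; apply.
  by rewrite -{1}RKE => /RP; apply.
have HK : H \subset PGLset K.
  by apply/subsetP=> g gH; apply: rat_PGL (preserve g gH); rewrite // (subsetP HM).
split=> //; case/orbitP: O0 => h hH; rewrite /= apermE => h0.
have /PGLsetP[a [b [c [d [K4 D hE]]]]] := subsetP HK _ hH.
apply: (PSL_bruhat sK (A := H) uH K4 D); last by rewrite -hE.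
by rewrite -(mob_fix_inf D) -hE h0.
Qed.

End Core.

(* Subfield type: [y] conjugates [H] between PSL(2,K) and PGL(2,K), and [t] is the
   number of multipliers of the stabiliser of a [K]-rational point. *)
Definition Ktype H (K : {set L}) (y : {perm option L}) t :=
  [/\ [/\ subfield K, y \in Mob L, PSLset K \subset (H :^ y)%g & (H :^ y)%g \subset PGLset K],
      #|H| = ((#|K| * t) * #|K|.+1)%N & ((t <= #|K|.-1)%N /\ (#|K| <= t.*2.+1)%N)].

Lemma Ktype_inf H m t : H \subset Mob L -> (0 < m)%N ->
  #|unip H None| = m.+1 -> orb H None = m.+3 ->
  #|stabp H None| = ((m + 2) * t)%N -> (t <= m.+1)%N -> (m.+1 <= 2 * t)%N ->
  exists K (y : {perm option L}), [/\ Ktype H K y t, y None = None & #|K| = m.+2].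
Proof.
move=> HM m0 U O S tm mt.
have TE : #|transl H| = m.+2 by have := card_unip_inf HM; rewrite U; case: #|transl H| => // n [->].
have [al] : exists al, al \in transl H :\ 0.
  apply/card_gt0P; move: TE; rewrite (cardsD1 0 (transl H)) (proj1 (transl_additive H)).
  by move: #|_ :\ _| => n; clear; lia.
rewrite in_setD1 => /andP[al0 alT].
have [z0 z0O] : exists z0, Some z0 \in orbit 'P H None.
  have : (0 < #|orbit 'P H None :\ None|)%N.
    have := O; rewrite /orb (cardsD1 None) orbit_refl.
    by move: #|_ :\ _| => n; clear; lia.
  by case/card_gt0P=> -[z|]; rewrite in_setD1 // => zO; exists z.
(* The map z -> (z - z0) / al fixes infinity, sends the orbit point [z0] to 0 and turns the
   translation by [al] into the one by 1. *)
pose y := aff al^-1 (- z0 / al).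
have al1 : al^-1 != 0 by rewrite invr_eq0.
have yM : y \in Mob L by apply: aff_Mob.
have yi : y None = None by rewrite aff_inf.
have yz : y (Some z0) = Some 0 by rewrite affE //; congr Some; field.
pose H' := (H :^ y)%G.
have HM' : H' \subset Mob L by rewrite -(conjGid yM) conjSg.
have U' : #|unip H' None| = m.+1 by rewrite -yi unipJ cardJg.
have S' : #|stabp H' None| = ((m + 2) * t)%N by rewrite -yi stabpJ cardJg.
have O' : orb H' None = m.+3 by rewrite -{1}yi orbJ.
have TE' : #|transl H'| = m.+2.
  by have := card_unip_inf HM'; rewrite U'; case: #|transl H'| => // n [->].
have T1 : 1 \in transl H'.
  rewrite inE /= mem_conjg /y affV // conjgE !affV ?invr_eq0 ?invr_eq0 //.
  rewrite inE in alT; rewrite !affM ?mulf_neq0 ?invr_eq0 ?oner_neq0 ?invrK //.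
  by move: alT; congr (_ \in H); congr aff; field.
have O0 : Some 0 \in orbit 'P H' None.
  case/orbitP: z0O => h hH; rewrite /= apermE => hE.
  apply/orbitP; exists (h ^ y)%g; first by rewrite memJ_conjg.
  by rewrite /= apermE -{1}yi conjgE !permM permK hE yz.
have [] := subfield_core HM' T1 O0 _ _ _ (t := t).
- by rewrite O' TE'.
- by rewrite S' TE' addn2.
- by rewrite TE'; move: mt; clear; lia.
move=> sK K1 K2; exists (transl H'), y; split=> //; split=> //.
  by rewrite TE' -(orb_stab H None) O S addn2 mulnC.
by rewrite TE'; split; move: tm mt; clear; lia.
Qed.

Lemma Ktype_conj H K (y z : {perm option L}) t : z \in Mob L ->
  Ktype (H :^ z)%G K y t -> Ktype H K (z * y)%g t.
Proof.
move=> zM [[sK yM K1 K2] N tb]; split=> //; last by rewrite -N cardJg.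
by rewrite conjsgM groupM.
Qed.

Lemma Ktype_any H P m t : H \subset Mob L -> (0 < m)%N ->
  #|unip H P| = m.+1 -> orb H P = m.+3 ->
  #|stabp H P| = ((m + 2) * t)%N -> (t <= m.+1)%N -> (m.+1 <= 2 * t)%N ->
  exists K (y : {perm option L}), Ktype H K y t /\ #|K| = m.+2.
Proof.
move=> HM m0 U O S tm mt; have [z zM zP] := Mob_move_inf P.
have HM' : (H :^ z)%G \subset Mob L by rewrite -(conjGid zM) conjSg.
have [|||K [y [KH _ Km]]] := @Ktype_inf (H :^ z)%G m t HM' m0 _ _ _ tm mt.
- by rewrite -zP unipJ cardJg.
- by rewrite -{1}zP orbJ.
- by rewrite -zP stabpJ cardJg.
by exists K, (z * y)%g; split=> //; apply: Ktype_conj.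
Qed.

End SubfieldType.

(** * Traces outside of subfields *)

Section Counting.

Local Open Scope nat_scope.

Lemma card_le_fibre2 (T S : finType) (D : {set T}) (f : T -> S) :
  (forall x y z, x \in D -> y \in D -> z \in D -> f x = f y -> f y = f z ->
     [|| x == y, y == z | z == x]) -> #|D| <= 2 * #|f @: D|.
Proof.
move=> f3; rewrite -sum1_card (partition_big f (mem (f @: D))) /=; last first.
  by move=> x xD; apply: imset_f.
rewrite mulnC -sum_nat_const; apply: leq_sum => s _; rewrite sum1dep_card.
rewrite leqNgt; apply/negP => /card_gt2P[x [y [z [[]]]]].
rewrite !inE => /andP[xD /eqP xs] /andP[yD /eqP ys] /andP[zD /eqP zs] [xy yz zx].
have := f3 x y z xD yD zD; rewrite xs ys zs (negbTE xy) (negbTE yz) (negbTE zx).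
by move/(_ erefl erefl).
Qed.

(* Compares the number of values of the trace, at least [q (q - 1) / 2], with the number of
   values excluded by the subfields of at most [q = p ^ e] elements. *)
Lemma power_sum_bound p e q : 2 < p -> q = p ^ e -> 4 < q ->
  2 * (1 + \sum_(1 <= j < e.+1) 2 * (p ^ j).-1) < q * q.-1.
Proof.
move=> p2 qE q5; have p0 : 0 < p by apply: ltn_trans p2.
have S n : \sum_(1 <= j < n.+1) 2 * (p ^ j).-1 + 2 * n <= 3 * (p ^ n).-1.
  elim: n => [|n IH]; first by rewrite big_geq.
  rewrite big_nat_recr //=.
  have : 3 * p ^ n <= p * p ^ n by rewrite leq_mul2r p2 orbT.
  have : 0 < p ^ n by rewrite expn_gt0 p0.
  rewrite expnS; move: IH; move: (\sum_(_ <= _ < _) _) (p ^ n) (p * _) => s x y; clear.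
  lia.
have [e1|e1] : e = 1 \/ 1 < e.
  by case: e qE => [|[|e]] qE; [move: q5; rewrite qE | left | right].
  rewrite e1 big_nat1 qE e1 expn1; rewrite qE e1 expn1 in q5.
  have : 4 * p.-1 <= p.-1 * p.-1 by rewrite leq_mul2r; apply/orP; right; lia.
  have -> : p * p.-1 = p.-1 * p.-1 + p.-1 by rewrite -{1}(prednK p0) mulSn addnC.
  move: (p.-1 * p.-1) => x; lia.
have q9 : 8 < q.
  rewrite qE; apply: leq_trans (leq_pexp2l p0 e1); rewrite -[9]/(3 ^ 2).
  by rewrite leq_exp2r.
have := S e; rewrite -qE.
have : 8 * q.-1 <= q * q.-1 by rewrite leq_mul2r ltnW ?orbT.
move: (\sum_(_ <= _ < _) _) (q * q.-1) => s x; lia.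
Qed.

End Counting.

Section Traces.

Local Open Scope ring_scope.
Import GRing.Theory.

Variable L : finFieldType.
Implicit Types (a b c d x y z : L) (g h : {perm option L}) (K : {set L}).

(* The square of the trace over the determinant is an invariant of the
   projective transformation, whereas the trace is not. *)
Definition tau a b c d : L := (a + d) ^+ 2 / (a * d - b * c).

Lemma tau_conj a b c d (y : {perm option L}) a' b' c' d' : y \in Mob L -> a * d - b * c != 0 ->
  a' * d' - b' * c' != 0 -> (mob a b c d ^ y)%g = mob a' b' c' d' ->
  tau a b c d = tau a' b' c' d'.
Proof.
case/MobP=> s [t [u [v [Dy ->]]]] D D'; have Dy' : v * s - - t * - u != 0.
  by rewrite mulrNN mulrC.
rewrite conjgE mobV // !mobM ?det_mul ?mulf_neq0 // => /mob_inj[||k k0 [-> -> -> ->]] //.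
  by rewrite !det_mul !mulf_neq0.
have tau_scale t1 t2 t3 t4 : tau (k * t1) (k * t2) (k * t3) (k * t4) = tau t1 t2 t3 t4.
  rewrite /tau -mulrDr exprMn.
  have -> : k * t1 * (k * t4) - k * t2 * (k * t3) = k ^+ 2 * (t1 * t4 - t2 * t3) by ring.
  by rewrite -mulf_div divff ?expf_neq0 ?mul1r.
rewrite tau_scale /tau !det_mul.
have -> : v * s - - t * - u = s * v - t * u by ring.
rewrite [X in _ = X ^+ 2 / _](_ : _ = (s * v - t * u) * (a + d)); last by ring.
by field; rewrite D Dy.
Qed.

Lemma Ktype_tau (H : {group {perm option L}}) K (y : {perm option L}) t a b c d :
  Ktype H K y t -> a * d - b * c != 0 ->
  mob a b c d \in H -> tau a b c d \in K.
Proof.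
move=> [[sK yM _ HK] _ _] D gH.
have : (mob a b c d ^ y)%g \in PGLset K by rewrite (subsetP HK) // memJ_conjg.
case/PGLsetP=> a' [b' [c' [d' [/and4P[aK bK cK dK] D' E]]]].
rewrite (tau_conj yM D D' E); apply: (sf_div sK); first exact/(sfX sK)/(sfD sK).
by apply: (sfB sK); apply: (sfM sK).
Qed.

Section OneField.

Variable K : {set L}.
Hypothesis sK : subfield K.

Let w := mob 0 1 (-1) 0 : {perm option L}.

Lemma det_w : 0 * 0 - 1 * (-1) != 0 :> L.
Proof. by rewrite mul0r mulrN1 sub0r opprK oner_neq0. Qed.

Lemma w_PSL : w \in PSLset K.
Proof.
apply/PSLsetP; exists 0, 1, (-1), 0; rewrite sf0 ?sf1 ?sfN ?sf1 //.
by rewrite mul0r mulrN1 sub0r opprK.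
Qed.

Lemma scale_PGL a b c d z : z != 0 -> [&& a / z \in K, b / z \in K, c / z \in K & d / z \in K] ->
  a * d - b * c != 0 -> mob a b c d \in PGLset K.
Proof.
move=> z0 K4 D; apply/PGLsetP; exists (a / z), (b / z), (c / z), (d / z); split=> //.
  have -> : a / z * (d / z) - b / z * (c / z) = (a * d - b * c) / z ^+ 2 by field.
  by rewrite mulf_neq0 ?invr_eq0 ?expf_neq0.
transitivity (mob (z * (a / z)) (z * (b / z)) (z * (c / z)) (z * (d / z))); last exact: mob_scale.
by rewrite !mulrA ![z * _]mulrC !mulfK.
Qed.

(** The final condition makes the traces [al * a + be * b + al^-1 * d] with [al], [be] in [K] take
    many values. *)
Lemma trace_normal_form g : g \in Mob L -> g \notin PGLset K ->
  exists m1 m2 a b c d, [/\ m1 \in PSLset K, m2 \in PSLset K, a * d - b * c != 0,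
     (m1 * g * m2)%g = mob a b c d & b != 0 /\ ~~ ((a / b \in K) && (d / b \in K))].
Proof.
case/MobP=> a [b [c [d [D ->]]]] gK.
have one : 1%g \in PSLset K by exact: (group1 (PSLgroup sK)).
have D1 : (1 * 1 - 0 * 1 : L) != 0 by rewrite mulr1 mul0r subr0 oner_neq0.
have D2 : (1 * 1 - 1 * 0 : L) != 0 by rewrite mulr1 mulr0 subr0 oner_neq0.
have [b0|b0] := eqVneq b 0.
  have [a0 d0] : a != 0 /\ d != 0.
    by apply/andP; rewrite -negb_or -mulf_eq0; move: D; rewrite b0 mul0r subr0.
  have [caK|caK] := boolP (c / a \in K).
    exists 1%g, (low 1%R), a, (a + b), c, (c + d); rewrite one mul1g low_PSL ?sf1 //.
    split=> //; first by have -> : a * (c + d) - (a + b) * c = a * d - b * c by [ring].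
      by rewrite /low mobM //; apply: eq_mob; ring.
    rewrite b0 addr0; split=> //; rewrite negb_and; apply/orP; right.
    rewrite mulrDl; apply: contra gK => cdK.
    have daK : d / a \in K by rewrite -[X in X \in K](addKr (c / a)) sfD // sfN.
    by apply: (@scale_PGL _ _ _ _ a); rewrite // b0 mul0r divff // caK daK sf0 ?sf1.
  exists 1%g, w, (- b), a, (- d), c; rewrite one mul1g w_PSL.
  split=> //; first by have -> : - b * c - a * - d = a * d - b * c by [ring].
    by rewrite /w mobM ?det_w //; apply: eq_mob; ring.
  by split=> //; rewrite negb_and caK orbT.
have [/andP[abK dbK]|nK] := boolP ((a / b \in K) && (d / b \in K)); last first.
  by exists 1%g, 1%g, a, b, c, d; rewrite one mul1g mulg1.
(* Only this ratio is then outside of [K]; the factor [w] swaps the rows and brings it to the place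
   of [a / b]. *)
have cbK : c / b \notin K.
  apply: contra gK => cbK; apply: (@scale_PGL _ _ _ _ b) => //.
  by rewrite abK dbK cbK divff // sf1.
have [d0|d0] := eqVneq d 0; last first.
  exists w, 1%g, c, d, (- a), (- b); rewrite one mulg1 w_PSL.
  split=> //; first by have -> : c * - b - d * - a = a * d - b * c by [ring].
    by rewrite /w mobM ?det_w //; apply: eq_mob; ring.
  split=> //; rewrite negb_and; apply/orP; left; apply: contra cbK => cdK.
  by have -> : c / b = (c / d) * (d / b) by [field; rewrite b0 d0]; rewrite sfM.
exists (w * aff 1%R 1%R)%g, 1%g, (a + c), (b + d), (- a), (- b); rewrite one mulg1.
split=> //.
- exact: (groupM (G := PSLgroup sK)) w_PSL (aff_PSL sK (sf1 sK)).
- by have -> : (a + c) * - b - (b + d) * - a = a * d - b * c by [ring].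
- rewrite /aff /w !mobM ?det_mul ?mulf_neq0 ?det_w //.
  by apply: eq_mob; ring.
rewrite d0 addr0; split=> //; rewrite negb_and mulrDl; apply/orP; left.
by apply: contra cbK => acK; rewrite -[X in X \in K](addKr (a / b)) sfD // sfN.
Qed.

Lemma subfield_root (K' : {set L}) x : subfield K' -> x \in K' -> x != 0 ->
  x ^+ #|K'|.-1 = 1.
Proof.
move=> sK' xK x0.
have U (T : {set L}) : subfield T -> group_set [set u : {unit L} | val u \in T].
  move=> sT; apply/group_setP; split=> [|u v]; rewrite !inE; first exact: (sf1 sT).
  by move=> uK vK; rewrite FinRing.val_unitM; apply: (sfM sT).
have xu : x \is a GRing.unit by rewrite unitfE.
pose G := Group (U _ sK').
have GE : #|G| = #|K'|.-1.
  rewrite (cardsD1 0 K') (sf0 sK') /= -(card_imset G val_inj); apply: eq_card => z.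
  apply/imsetP/setD1P => [[u]|[z0 zK]].
    by rewrite inE => uK ->; rewrite -unitfE (valP u).
  have zu : z \is a GRing.unit by rewrite unitfE.
  by exists (FinRing.Unit zu); rewrite ?inE.
have xG : FinRing.Unit xu \in G by rewrite inE.
have := expg_cardG xG; rewrite GE => /(congr1 val).
by rewrite FinRing.val_unitX.
Qed.

Lemma card_power_roots n z : (0 < n)%N -> (#|[set x : L | x ^+ n == z]| <= n)%N.
Proof.
move=> n0; pose p : {poly L} := ('X^n - z%:P)%R.
have p0 : p != 0 by rewrite -size_poly_eq0 size_XnsubC.
rewrite cardE; have := max_poly_roots p0 _ (enum_uniq [set x : L | x ^+ n == z]).
rewrite size_XnsubC // ltnS; apply.
by apply/allP=> x; rewrite mem_enum inE /root !hornerE subr_eq0.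
Qed.

Hypothesis L2 : (2%:R : L) != 0.
Hypothesis K5 : (4 < #|K|)%N.

(** A count: each trace comes from at most two pairs [(al, be)], so there are more traces than
    values excluded by the small subfields. *)
Lemma exists_large_trace a b c d : a * d - b * c != 0 -> b != 0 ->
  ~~ ((a / b \in K) && (d / b \in K)) ->
  exists al be, [/\ al \in K, be \in K, al != 0 &
    forall K', subfield K' -> (#|K'| <= #|K|)%N ->
      (al * a + be * b + al^-1 * d) ^+ 2 / (a * d - b * c) \notin K'].
Proof.
move=> D b0 nK; have AK := subfield_additive sK.
have [p [pr_p odd_p [n Ln]]] := card_char_power L2.
have [e Ke] := card_additive_power pr_p Ln AK.
have p2 : (2 < p)%N by case: p pr_p odd_p {Ln Ke} => [|[|[]]].
pose Dl := a * d - b * c.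
(* Contains all nonzero [z] with [z ^+ 2 / Dl] in a subfield of order [p ^ j], since nonzero
   elements of it have order dividing [p ^ j - 1]. It depends only on the order of the subfield. *)
pose B j := [set z : L | (z ^+ (2 * (p ^ j).-1)) == Dl ^+ (p ^ j).-1].
pose Bad := [set 0] :|: \bigcup_(j <- index_iota 1 e.+1) B j.
have cardBad : (#|Bad| <= 1 + \sum_(1 <= j < e.+1) 2 * (p ^ j).-1)%N.
  rewrite /Bad; apply: leq_trans (leq_card_setU _ _) _; rewrite cards1 leq_add2l.
  rewrite big_seq [X in (_ <= X)%N]big_seq.
  elim/big_rec2: _ => [|j y X]; first by rewrite cards0.
  rewrite mem_index_iota => /andP[j0 _] IH; apply: leq_trans (leq_card_setU _ _) _.
  apply: leq_add => //; apply: card_power_roots.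
  have : (p ^ 1 <= p ^ j)%N by rewrite leq_exp2l // ltnW.
  rewrite expn1; move: (p ^ j)%N p2; clear; lia.
pose f (x : L * L) := x.1 * a + x.2 * b + x.1^-1 * d.
pose DD := setX (K :\ 0) K.
have cardD : #|DD| = (#|K|.-1 * #|K|)%N.
  by rewrite cardsX (cardsD1 0 K) (sf0 sK).
have DDP (x : L * L) : x \in DD -> x.1 != 0 /\ x.1 \in K.
  by case: x => u v /setXP[/= /setD1P[? ?] _].
have fib (x y : L * L) : x \in DD -> y \in DD -> f x = f y -> x != y ->
    x.1 != y.1 /\ (a - d / (x.1 * y.1)) / b \in K.
  move: x y => [al be] [al' be'] /setXP[/= /setD1P[a0 aK] bK] /setXP[/= /setD1P[a0' aK'] bK'].
  rewrite /f /= => E nE; have aa : al != al'.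
    apply: contra nE => /eqP aa; move: E; rewrite aa => /addIr/addrI/(mulIf b0) ->.
    by [].
  split=> //; have d0 : al - al' != 0 by rewrite subr_eq0.
  suff -> : (a - d / (al * al')) / b = (be' - be) / (al - al').
    by apply: (sf_div sK); apply: (sfB sK).
  apply/eqP; rewrite eqr_div //; apply/eqP.
  by apply: (eq_by1 (m := 1) E); field; rewrite a0 a0'.
have fibre2 : (#|DD| <= 2 * #|f @: DD|)%N.
  apply: card_le_fibre2 => x y z xD yD zD fxy fyz; apply: contraT.
  rewrite !negb_or => /and3P[xy yz zx].
  have [_ k1] := fib _ _ xD yD fxy xy.
  have [yz1 _] := fib _ _ yD zD fyz yz.
  have [_ k3] := fib _ _ zD xD (esym (etrans fxy fyz)) zx.
  have [[[x0 xK] [y0 yK]] [z0 zK]] := (DDP _ xD, DDP _ yD, DDP _ zD).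
  (* Two of these elements of [K] differ by a nonzero [K]-multiple of [d / b]. So three pairs with
     equal trace would put [d / b], and then [a / b], into [K]. *)
  have dK : d / b \in K.
    have dyz : y.1 - z.1 != 0 by rewrite subr_eq0.
    have -> : d / b = ((a - d / (x.1 * y.1)) / b - (a - d / (z.1 * x.1)) / b)
        * (x.1 * y.1 * z.1 / (y.1 - z.1)).
      by field; rewrite b0 x0 y0 z0 dyz.
    apply: (sfM sK); first exact: (sfB sK).
    by apply: (sf_div sK); [do 2!apply: (sfM sK) => // | apply: (sfB sK)].
  have aK : a / b \in K.
    have -> : a / b = (a - d / (x.1 * y.1)) / b + d / b / (x.1 * y.1).
      by field; rewrite b0 x0 y0.
    by apply: (sfD sK) => //; apply: (sf_div sK) => //; apply: (sfM sK).
  by rewrite aK dK in nK.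
have [z zf zB] : exists2 z, z \in f @: DD & z \notin Bad.
  apply/subsetPn; apply/negP => /subset_leq_card le.
  have := power_sum_bound p2 Ke K5; rewrite (mulnC #|K|) -cardD ltnNge => /negP; apply.
  apply: leq_trans fibre2 _; rewrite leq_mul2l /=.
  exact: leq_trans le cardBad.
case/imsetP: zf => -[al be] /setXP[/= /setD1P[a0 aK] bK] zE.
exists al, be; split=> // K' sK' K'K; apply: contra zB => tK.
rewrite /Bad in_setU in_set1 -implyNb; apply/implyP => z0.
have Dl0 : Dl != 0 by [].
have [j K'j] := card_additive_power pr_p Ln (subfield_additive sK').
have [j0 je] : (0 < j)%N /\ (j < e.+1)%N.
  split; last by rewrite ltnS -(@leq_exp2l p) ?(ltnW p2) // -K'j -Ke.
  rewrite lt0n; apply/eqP=> j0; move: K'j; rewrite j0 expn0.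
  rewrite (cardsD1 0 K') (sf0 sK') (cardsD1 1 (K' :\ 0)) in_setD1 oner_neq0 (sf1 sK').
  by [].
have -> r : (z \in \bigcup_(i <- r) B i) = has (fun i => z \in B i) r.
  elim: r => [|i r IH]; first by rewrite big_nil in_set0.
  by rewrite big_cons in_setU IH.
apply/hasP; exists j; first by rewrite mem_index_iota j0 je.
rewrite inE exprM.
have := subfield_root sK' tK _; rewrite K'j -/Dl -[al * a + _ + _]zE.
rewrite mulf_neq0 ?expf_neq0 ?invr_eq0 // => /(_ isT).
rewrite expr_div_n => /eqP; rewrite -(inj_eq (mulIf (expf_neq0 (p ^ j).-1 Dl0))) divfK ?expf_neq0 //.
by rewrite mul1r.
Qed.

(** The two-sided factors of the normal form move to one side by conjugation: [m2 * m * m1 * g] is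
    conjugate to [m * (m1 * g * m2)], and [tau] is invariant. *)
Lemma large_trace g : g \in Mob L -> g \notin PGLset K ->
  exists m a b c d, [/\ m \in PSLset K, a * d - b * c != 0, (m * g)%g = mob a b c d &
    forall K', subfield K' -> (#|K'| <= #|K|)%N -> tau a b c d \notin K'].
Proof.
move=> gM gK; have [m1 [m2 [a [b [c [d [m1K m2K D E [b0 nK]]]]]]]] := trace_normal_form gM gK.
have [al [be [alK beK al0 notK]]] := exists_large_trace D b0 nK.
pose m := mob al 0 be al^-1; have Dm : al * al^-1 - 0 * be = 1.
  by rewrite divff // mul0r subr0.
have mK : m \in PSLset K.
  by apply/PSLsetP; exists al, 0, be, al^-1; rewrite alK beK (sf0 sK) (sfV sK).
have m3M : (m2 * m * m1)%g \in PSLset K.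
  by do 2!apply: (groupM (G := PSLgroup sK)) => //.
have : ((m2 * m * m1) * g)%g \in Mob L by rewrite groupM // (PSL_Mob m3M).
case/MobP=> a' [b' [c' [d' [D' E']]]]; exists (m2 * m * m1)%g, a', b', c', d'.
split=> // K' sK' K'K; have := notK K' sK' K'K; apply: contra.
have D1 : al * al^-1 - 0 * be != 0 by rewrite Dm oner_neq0.
have E1 : (mob a' b' c' d' ^ m2)%g = mob (al * a + 0 * c) (al * b + 0 * d)
    (be * a + al^-1 * c) (be * b + al^-1 * d).
  by rewrite -E' -mobM // -E conjgE -/m !mulgA mulVg mul1g.
rewrite (tau_conj (PSL_Mob m2K) D' _ E1); last by rewrite det_mul mulf_neq0.
rewrite /tau det_mul Dm mul1r mul0r addr0.
by have -> : al * a + (be * b + al^-1 * d) = al * a + be * b + al^-1 * d by [rewrite addrA].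
Qed.

End OneField.

End Traces.

(** Reachability by [nreach] is a bare proposition, so maxima over reachable lists are taken
    classically. *)
Lemma ex_maximum (T : Type) (P : T -> Prop) (f : T -> nat) (B : nat) :
  (exists x, P x) -> (forall x, P x -> f x <= B)%N ->
  exists x, P x /\ forall y, P y -> (f y <= f x)%N.
Proof.
case=> x0 Px0 fB; apply: NNPP => no.
have step n : exists x, P x /\ (n <= f x)%N.
  elim: n => [|n [x [Px nx]]]; first by exists x0.
  apply: NNPP => no'; apply: no; exists x; split=> // y Py.
  rewrite leqNgt; apply/negP => xy; apply: no'; exists y; split=> //.
  exact: leq_ltn_trans nx xy.
have [x [/fB xB]] := step B.+1.
by rewrite ltnNge xB.
Qed.

(** * Pairs generating a group of maximal order *)

Section Pairs.

Local Open Scope nat_scope.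

Variable L : finFieldType.
Implicit Types (P Q R : option L) (g h x y z : {perm option L}).
Implicit Types (s r : seq {perm option L}).

Lemma gens_fix s P : (forall x, x \in s -> x P = P) -> forall h, h \in gens s -> h P = P.
Proof.
move=> sP h; have : gens s \subset 'C[P | 'P].
  by apply/gens_subP => x /sP xP; apply/astab1P.
by move/subsetP=> sub /sub/astab1P.
Qed.

Lemma gens_stable s (A : {set option L}) : (forall x, x \in s -> x @: A = A) ->
  forall h, h \in gens s -> h @: A = A.
Proof.
move=> sA h; have : gens s \subset 'N(A | 'P).
  apply/gens_subP => x /sA xA; rewrite -sub1set; apply/actsP => _ /set1P -> P.
  rewrite /= apermE -{1}xA mem_imset //; exact: perm_inj.
move/subsetP=> sub /sub hN; apply/eqP.
rewrite eqEcard (card_imset _ (@perm_inj _ h)) leqnn andbT.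
by apply/subsetP=> _ /imsetP[P PA ->]; rewrite -[h P]/('P%act P h) (astabs_act _ hN).
Qed.

Lemma irred_gensP s : reflect (forall P, exists2 x, x \in s & x P != P) (irred (gens s)).
Proof.
apply: (iffP (irredP _)) => irr P; have [h hs hP] := irr P; last first.
  by exists h; rewrite ?mem_gens.
have /allPn[x xs xP] : ~~ all (fun x => x P == P) s.
  apply: contra hP => /allP sP; apply/eqP; apply: gens_fix hs => x /sP/eqP.
  by [].
by exists x.
Qed.

Lemma good_gensP s :
  reflect (forall P Q, exists2 x, x \in s & x @: [set P; Q] != [set P; Q]) (good (gens s)).
Proof.
apply: (iffP (goodP _)) => irr P Q; have [h hs hP] := irr P Q; last first.
  by exists h; rewrite ?mem_gens.
have /allPn[x xs xP] : ~~ all (fun x => x @: [set P; Q] == [set P; Q]) s.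
  apply: contra hP => /allP sP; apply/eqP; apply: gens_stable hs => x /sP/eqP.
  by [].
by exists x.
Qed.

Lemma nreach_swap x y s : nreach (x :: y :: s) (y :: x :: s).
Proof. by apply: nreach_perm; rewrite (perm_catCA [:: x] [:: y] s). Qed.

(* Any two nontrivial elements sharing a fixed point without a common fixed
   point for all form a triangle, which is broken by multiplying two of them. *)
Lemma irred_pair s : {subset s <= Mob L} -> {in s, forall g, 0 < #|fixs g|} ->
  irred (gens s) -> exists x y r, nreach s [:: x, y & r] /\ irred (gens [:: x; y]).
Proof.
move=> sM sF irr; apply: NNPP => no.
have common t x y r : nreach s t -> perm_eq t [:: x, y & r] -> exists P, x P = P /\ y P = P.
  move=> st tE; apply: NNPP => nP; apply: no; exists x, y, r; split.
    exact: nreach_trans st (nreach_perm tE).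
  apply/irred_gensP => P; have [xP|xP] := eqVneq (x P) P; last by exists x; rewrite ?inE ?eqxx.
  exists y; rewrite ?inE ?eqxx ?orbT //; apply/eqP => yP; apply: nP; exists P.
  by split.
have [g1 g1s g11] : exists2 g, g \in s & g None != None by exact: (irred_gensP _ irr).
have [P /fixsP g1P] : exists P, P \in fixs g1 by apply/card_gt0P; exact: sF.
have [g2 g2s g2P] := irred_gensP _ irr P.
have share g h : g \in s -> h \in s -> g != h -> exists Q, g Q = Q /\ h Q = Q.
  move=> gs hs gh; apply: (@common s g h (rem h (rem g s)) (nreach_refl s)).
  rewrite (perm_trans (perm_to_rem gs)) // perm_cons perm_to_rem //.
  have := perm_mem (perm_to_rem gs) h; rewrite hs inE eq_sym (negbTE gh) /=.
  by move=> <-.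
have g12 : g1 != g2 by apply: contra_neq g2P => <-.
have [Q [g1Q g2Q]] := share _ _ g1s g2s g12.
have [g3 g3s g3Q] := irred_gensP _ irr Q.
have g13 : g1 != g3 by apply: contra_neq g3Q => <-.
have g23 : g2 != g3 by apply: contra_neq g3Q => <-.
have PQ : P != Q by apply: contra_neq g2P => ->.
have fix1 R : g1 R = R -> R = P \/ R = Q.
  move=> g1R; case: (eqVneq R P) => [|RP]; first by left.
  case: (eqVneq R Q) => [|RQ]; first by right.
  case/negP: g11; apply/eqP; rewrite (@fixs3 _ g1 P Q R) ?perm1 ?sM //.
  by rewrite /= !inE negb_or PQ eq_sym RP eq_sym RQ.
have g3P : g3 P = P.
  by have [R [/fix1[->//|->]]] := share _ _ g1s g3s g13; move/eqP; rewrite (negbTE g3Q).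
have [R [g2R g3R]] := share _ _ g2s g3s g23.
have RP : R != P by apply: contra_neq g2P => <-.
have RQ : R != Q by apply: contra_neq g3Q => <-.
have g21 : g2 != 1%g by apply: contra_neq g2P => ->; rewrite perm1.
have g31 : g3 != 1%g by apply: contra_neq g3Q => ->; rewrite perm1.
have fix3 T : g3 T = T -> T = P \/ T = R.
  move=> g3T; case: (eqVneq T P) => [|TP]; first by left.
  case: (eqVneq T R) => [|TR]; first by right.
  case/negP: g31; apply/eqP; apply: (@fixs3 _ g3 P R T); rewrite ?sM //.
  by rewrite /= !inE negb_or eq_sym RP eq_sym TP eq_sym TR.
pose r := rem g3 (rem g2 (rem g1 s)).
have sE : perm_eq s [:: g1, g2, g3 & r].
  have g2s' : g2 \in rem g1 s.
    by have := perm_mem (perm_to_rem g1s) g2; rewrite g2s inE eq_sym (negbTE g12) /= => <-.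
  have g3s' : g3 \in rem g2 (rem g1 s).
    have := perm_mem (perm_to_rem g2s') g3; rewrite inE eq_sym (negbTE g23) /= => <-.
    by have := perm_mem (perm_to_rem g1s) g3; rewrite g3s inE eq_sym (negbTE g13) /= => <-.
  apply: perm_trans (perm_to_rem g1s) _; rewrite perm_cons.
  apply: perm_trans (perm_to_rem g2s') _; rewrite perm_cons.
  exact: perm_to_rem.
(* The triangle has vertices [P] (fixed by [g1], [g3]), [Q] (by [g1], [g2]) and [R] (by [g2], [g3]).
   As [g3] fixes only [P] and [R], one of these would be fixed by [g1 * g2], and neither is. *)
have [||T []] := @common [:: (g1 * g2)%g, g2, g3 & r] (g1 * g2)%g g3 (g2 :: r).
- apply: nreach_trans (nreach_perm sE) _; apply: nreach_mul1.
  by rewrite inE eqxx.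
- by rewrite perm_cons (perm_catCA [:: g2] [:: g3] r).
rewrite permM => E /fix3[TE|TE]; rewrite TE in E.
  by move: E; rewrite g1P => /eqP; rewrite (negbTE g2P).
have : g1 R = R by apply: (@perm_inj _ g2); rewrite E g2R.
by case/fix1 => E1; [rewrite E1 eqxx in RP | rewrite E1 eqxx in RQ].
Qed.

Definition max_pair s x y := forall x' y' r', nreach s [:: x', y' & r'] ->
  irred (gens [:: x'; y']) -> #|gens [:: x'; y']| <= #|gens [:: x; y]|.

Lemma cardsp1 P Q g : g \in Mob L -> g != 1%g -> P != Q -> g P = P -> g Q = Q ->
  fixs g = [set P; Q].
Proof.
move=> gM g1 PQ gP gQ; apply/esym/eqP; rewrite eqEcard cards2 PQ fixs_le2 // andbT.
by apply/subsetP=> R /set2P[] ->; apply/fixsP.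
Qed.

Lemma preserve2 P Q g :
  g @: [set P; Q] = [set P; Q] -> (g P = P /\ g Q = Q) \/ (g P = Q /\ g Q = P).
Proof.
move=> gE; have gP : g P \in [set P; Q] by rewrite -gE imset_f // set21.
have gQ : g Q \in [set P; Q] by rewrite -gE imset_f // set22.
case: (eqVneq P Q) gP gQ => [<-|PQ]; first by rewrite setUid !inE => /eqP-> _; left.
case/set2P=> gP /set2P[] gQ; [|by left|by right|].
  by move: PQ; rewrite -{1}gP => /eqP[]; apply: (@perm_inj _ g); rewrite gP gQ.
by move: PQ => /eqP[]; apply: (@perm_inj _ g); rewrite gP gQ.
Qed.

Lemma preserve2P P Q g : (g P = P /\ g Q = Q) \/ (g P = Q /\ g Q = P) ->
  g @: [set P; Q] = [set P; Q].
Proof.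
by case=> [[gP gQ]|[gP gQ]]; rewrite imsetU1 imset_set1 gP gQ // setUC.
Qed.

(* If the pair generated a group preserving [{P, Q}], that group would be dihedral and
   another entry, multiplied into the pair, would enlarge it. *)
Lemma max_pair_good s x y r : {subset gens s <= Mob L} -> {in gens s, forall g, 0 < #|fixs g|} ->
  good (gens s) -> nreach s [:: x, y & r] -> irred (gens [:: x; y]) -> max_pair s x y ->
  good (gens [:: x; y]).
Proof.
move=> sM sF gs reach irr maxD; apply: contraT => /good_gensP bad.
have [P [Q DPQ]] : exists P Q, forall g, g \in [:: x; y] -> g @: [set P; Q] = [set P; Q].
  apply: NNPP => no; apply: bad => P Q.
  have [/allP all2|/allPn[g gxy nE]] := boolP (all
      (fun g : {perm option L} => g @: [set P; Q] == [set P; Q]) [:: x; y]); last first.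
    by exists g.
  by case: no; exists P, Q => g /all2/eqP.
have sxy : gens [:: x, y & r] = gens s by rewrite (nreach_gens reach).
have memxy g : g \in [:: x, y & r] -> g \in gens s by rewrite -sxy; apply: mem_gens.
have PQ : P != Q.
  apply/eqP => PQ; have [g /DPQ] := irred_gensP _ irr P.
  by rewrite -PQ setUid imset_set1 => /set1_inj -> ; rewrite eqxx.
(* Dihedral generators: if both entries swap the points, their product fixes them. *)
have [c [t [reach' cP cQ [tP tQ] DE]]] : exists c t, [/\ nreach s [:: c, t & r], c P = P, c Q = Q,
    t P = Q /\ t Q = P & gens [:: c; t] = gens [:: x; y]].
  have Dx := preserve2 (DPQ x (mem_head _ _)).
  have Dy : (y P = P /\ y Q = Q) \/ (y P = Q /\ y Q = P).
    by apply: preserve2; apply: DPQ; rewrite !inE eqxx orbT.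
  have r1 : nreach [:: x; y] [:: (x * y)%g; y] by apply: nreach_mul1; rewrite inE.
  case: Dx Dy => [[xP xQ]|[xP xQ]] [[yP yQ]|[yP yQ]].
  - have [g] := irred_gensP _ irr P; rewrite !inE => /orP[] /eqP ->; first by rewrite xP eqxx.
    by rewrite yP eqxx.
  - by exists x, y.
  - exists y, x; split=> //; first exact: nreach_trans reach (nreach_swap _ _ _).
    by apply: eq_gens => g; rewrite !inE orbC.
  - exists (x * y)%g, y; split; rewrite ?permM ?xP ?xQ //.
      by apply: nreach_trans reach (nreach_mul1 _ _); rewrite inE eqxx.
    by rewrite -(nreach_gens r1).
have cM : c \in Mob L by apply: sM; rewrite (nreach_gens reach') mem_gens // inE eqxx.
have ts : t \in gens s by rewrite (nreach_gens reach') mem_gens // !inE eqxx orbT.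
have tM := sM _ ts; have [R /fixsP tR] : exists R, R \in fixs t by apply/card_gt0P; apply: sF.
have RP : R != P by apply: contra_neq PQ => RP; rewrite -tP -RP tR.
have RQ : R != Q by apply: contra_neq PQ => RQ; rewrite -tQ -RQ tR.
(* The square fixes [P], [Q] and a third point. Applied to [t] and [t * c], this shows that [t]
   inverts [c]. *)
have swap2 h : h \in Mob L -> h P = Q -> h Q = P -> 0 < #|fixs h| -> (h * h)%g = 1%g.
  move=> hM hP hQ /card_gt0P[T /fixsP hT]; apply: (@fixs3 _ _ P Q T); rewrite ?groupM //.
  - rewrite /= !inE negb_or PQ /= andbT; apply/andP; split.
      by apply: contra_neq PQ => E; rewrite -hP E hT.
    by apply: contra_neq PQ => E; rewrite -hQ E hT.
  - by rewrite permM hP hQ.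
  - by rewrite permM hQ hP.
  - by rewrite permM !hT.
have tt : (t * t)%g = 1%g by apply: swap2 => //; apply: sF.
have cs : c \in gens s by rewrite (nreach_gens reach') mem_gens // inE eqxx.
have c1 : c != 1%g.
  apply/eqP => c1; have := irr; rewrite -DE => /irred_gensP/(_ R)[g].
  by rewrite !inE c1 => /orP[] /eqP ->; rewrite ?perm1 ?tR eqxx.
have fc : fixs c = [set P; Q] by apply: cardsp1.
have ct : (t * c * (t * c) = 1)%g.
  by apply: swap2; rewrite ?groupM ?permM ?tP ?tQ ?cP ?cQ // ?sF ?groupM.
have Dle : #|gens [:: x; y]| <= 2 * #[c]%g.
  have t2 : #[t]%g <= 2 by apply: dvdn_leq; rewrite // order_dvdn expgS expg1 tt.
  have tN : <[t]> \subset 'N(<[c]>).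
    rewrite cycle_subG; apply/normP; rewrite -cycleJ.
    have -> : (c ^ t)%g = c^-1%g; last by rewrite cycleV.
    have tV : t^-1%g = t by apply/eqP; rewrite eq_invg_mul tt.
    apply/eqP; rewrite eq_sym eq_invg_mul conjgE tV.
    have -> : (c * (t * (c * t)) = t^-1 * (t * c * (t * c)) * t)%g by rewrite !mulgA mulVg mul1g.
    by rewrite ct mulg1 mulVg.
  have sub : gens [:: c; t] \subset <[c]> <*> <[t]>.
    apply/gens_subP => g; rewrite !inE => /orP[] /eqP ->.
      by rewrite (subsetP (joing_subl _ _)) ?cycle_id.
    by rewrite (subsetP (joing_subr _ _)) ?cycle_id.
  rewrite -DE; apply: leq_trans (subset_leq_card sub) _.
  rewrite (norm_joinEr tN) mulnC; apply: leq_trans (leq_mul (leqnn #|<[c]>|) t2).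
  by rewrite (orderE t) mul_cardG leq_pmulr // cardG_gt0.
(* If [c] and [z] have no common fixed point, maximality bounds the index of [<[c]>] in [<c, z>] by
   2, so [z] normalises [<[c]>] and preserves [fixs c]. Otherwise the common fixed point is [P] or
   [Q]. *)
have claim z r' : nreach s [:: c, z & r'] ->
    z @: [set P; Q] = [set P; Q] \/ (z P = P \/ z Q = Q).
  move=> reachz; have [/(maxD _ _ _ reachz) le|red] := boolP (irred (gens [:: c; z])).
    left; have sub : <[c]> \subset gens [:: c; z] by rewrite cycle_subG mem_gens // inE eqxx.
    have zE : z \in gens [:: c; z] by rewrite mem_gens // !inE eqxx orbT.
    have zN : z \in 'N(<[c]>).
      have := Lagrange sub; case E : #|gens [:: c; z] : <[c]>| => [|[|[|n]]] NE.
      - by have := cardG_gt0 (gens [:: c; z]); rewrite -NE muln0.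
      - have cE : <[c]> = gens [:: c; z] by apply/eqP; rewrite eqEcard sub -NE muln1 leqnn.
        by move: zE; rewrite -cE; apply: (subsetP (normG _)).
      - by have /andP[_ /subsetP] := index2_normal sub E; apply.
      - exfalso; have := leq_trans le Dle; rewrite -NE -/#[c]%g mulnC leq_pmul2r ?order_gt0 //.
    have cz : (c ^ z)%g \in <[c]> by rewrite memJ_norm ?cycle_id.
    rewrite -{1}fc -fixsJ; apply: (cardsp1 _ _ PQ).
    - by rewrite groupJ // sM // (nreach_gens reachz) mem_gens // !inE eqxx orbT.
    - by rewrite conjg_eq1.
    - by case/cycleP: cz => n ->; elim: n => [|n IH]; rewrite ?perm1 // expgS permM cP.
    - by case/cycleP: cz => n ->; elim: n => [|n IH]; rewrite ?perm1 // expgS permM cQ.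
  have [T] : exists T, c T = T /\ z T = T.
    apply: NNPP => no; case/negP: red; apply/irred_gensP => T.
    have [cT|cT] := eqVneq (c T) T; last by exists c; rewrite ?inE ?eqxx.
    exists z; rewrite ?inE ?eqxx ?orbT //; apply/eqP => zT; apply: no; exists T.
    by split.
  case=> cT zT; right; have : T \in fixs c by apply/fixsP.
  by rewrite fc => /set2P[] TE; [left | right]; rewrite -TE.
have tPQ : t @: [set P; Q] = [set P; Q] by apply: preserve2P; right.
have stable z : z \in r -> z @: [set P; Q] = [set P; Q].
  move=> zr; have pz : perm_eq [:: c, t & r] [:: c, z, t & rem z r].
    rewrite perm_cons; apply: perm_trans (_ : perm_eq _ [:: t, z & rem z r]) _.
      by rewrite perm_cons perm_to_rem.
    by rewrite (perm_catCA [:: t] [:: z] (rem z r)).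
  have r1 := nreach_trans reach' (nreach_perm pz).
  (* As [t] swaps the two points, [z] and [t * z] cannot both fall under the second alternative of
     [claim]. *)
  have r2 : nreach s [:: c, (t * z)%g & t :: rem z r].
    apply: nreach_trans r1 _; apply: nreach_trans (nreach_swap _ _ _) _.
    apply: nreach_trans (nreach_swap _ _ _); apply: nreach_mull.
    by rewrite mem_gens // !inE eqxx orbT.
  case: (claim _ _ r1) => // zPQ; case: (claim _ _ r2) => [tz|].
    rewrite -{1}tPQ -imset_comp -[RHS]tz; apply: eq_imset => T /=.
    by rewrite permM.
  have inj := @perm_inj _ z; rewrite !permM tP tQ.
  case: zPQ => E1 [] E2; case/eqP: PQ; try by rewrite -E1 -E2.
    by apply: inj; rewrite E1 E2.
  by apply: inj; rewrite E1 E2.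
have [g] := goodP _ gs P Q; rewrite (nreach_gens reach') => gg /negP[]; apply/eqP.
apply: gens_stable gg => z; rewrite !inE => /or3P[/eqP->|/eqP->//|/stable//].
by apply: preserve2P; left.
Qed.

End Pairs.

(** * From a maximal pair to a group of subfield type *)

Section LargeTriple.

Local Open Scope nat_scope.

Variable L : finFieldType.
Implicit Types (P Q R : option L) (g h x y z : {perm option L}).
Implicit Types (s r : seq {perm option L}).
Hypothesis L2 : (2%:R != 0 :> L)%R.

Lemma good_cards (H : {group {perm option L}}) : H \subset Mob L ->
  {in H, forall h, 0 < #|fixs h|} -> good H ->
  [\/ #|H| = 12 /\ forall P, #|stabp H P| <= 3, #|H| = 24 | 60 <= #|H|].
Proof.
move=> HM HF gH; case: (good_numbers L2 HM HF gH).
- by move=> aH; constructor 1.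
- by case=> HN _; constructor 2.
- by case=> HN _; constructor 3; rewrite HN.
case=> P [m [t [m2 om _ [O S tm mt]]]]; constructor 3.
(* The least case is [m = 3], [t = 2], with the order of PSL(2,5). *)
rewrite -(orb_stab H P) O S; have : 6 * (5 * 2) <= m.+3 * ((m + 2) * t).
  by rewrite !leq_mul //; move: m2 mt; clear; lia.
by [].
Qed.

Section NoUnipotent.

Variables (H : {group {perm option L}}) (P : option L).
Hypothesis HM : H \subset Mob L.
Hypothesis U0 : unip H P = set0.

Lemma stab_aff : exists2 y, y \in Mob L & y P = None /\
  forall k, k \in stabp H P -> exists2 a, (a != 0)%R & exists c, (k ^ y)%g = aff a c.
Proof.
have [y yM yP] := Mob_move_inf P; exists y => //; split=> // k /stabpP[kH kP].
apply: affP; first by rewrite groupJ // (subsetP HM).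
by rewrite -yP conjgE !permM permK kP.
Qed.

(** Affine maps with equal multipliers differ by a translation. Without unipotents the multiplier
    therefore embeds the stabiliser into the multiplicative group of [L]. *)
Lemma same_multiplier y g h a c d : y P = None -> g \in stabp H P -> h \in stabp H P ->
  (a != 0)%R -> (g ^ y)%g = aff a c -> (h ^ y)%g = aff a d -> g = h.
Proof.
move=> yP /stabpP[gH _] /stabpP[hH _] a0 gE hE.
have kE : ((g * h^-1) ^ y)%g = aff 1%R ((c - d) / a)%R.
  by rewrite conjMg conjVg gE hE translD // GRing.divff.
apply/eqP; rewrite eq_mulgV1; apply: contraT => k1.
have e0 : ((c - d) / a)%R != 0%R.
  apply: contra k1 => /eqP e0; rewrite -(conjg_eq1 _ y) kE e0 aff1.
  by [].
have : (g * h^-1)%g \in unip H P.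
  rewrite inE groupM ?groupV //=; apply/eqP/(imset_inj (@perm_inj _ y)).
  by rewrite -fixsJ kE imset_set1 yP fixs_aff ?GRing.oner_neq0 // eqxx (negbTE e0).
by rewrite U0 inE.
Qed.

Lemma stab_commute g h : g \in stabp H P -> h \in stabp H P -> (g * h = h * g)%g.
Proof.
move=> gS hS; have [y yM [yP ya]] := stab_aff.
have [a a0 [c gE]] := ya g gS; have [b b0 [d hE]] := ya h hS.
apply: (same_multiplier (y := y) (a := (a * b)%R) (c := (c * b + d)%R) (d := (d * a + c)%R)) => //.
- by rewrite groupM.
- by rewrite groupM.
- by rewrite GRing.mulf_neq0.
- by rewrite conjMg gE hE affM.
by rewrite conjMg gE hE affM // GRing.mulrC.
Qed.

Lemma stab_involution g h : g \in stabp H P -> h \in stabp H P -> g != 1%g -> h != 1%g ->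
  (g * g)%g = 1%g -> (h * h)%g = 1%g -> g = h.
Proof.
move=> gS hS g1 h1 gg hh; have [y yM [yP ya]] := stab_aff.
have main k : k \in stabp H P -> k != 1%g -> (k * k)%g = 1%g ->
    exists c, (k ^ y)%g = aff (-1)%R c.
  move=> kS k1 kk; have [a a0 [c kE]] := ya k kS; exists c; rewrite kE; congr (aff _ c).
  have a1 : a != 1%R.
    apply: contra k1 => /eqP a1; apply/eqP.
    apply: (same_multiplier (y := y) (a := 1%R) (c := c) (d := 0%R)); rewrite ?GRing.oner_neq0 //.
      by rewrite kE a1.
    by rewrite aff1 conj1g.
  have : ((k * k) ^ y)%g = aff 1%R 0%R by rewrite kk conj1g aff1.
  rewrite conjMg kE affM // => /aff_inj[||aa _]; rewrite ?GRing.mulf_neq0 ?GRing.oner_neq0 //.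
  move/eqP: aa; rewrite -GRing.expr2 GRing.sqrf_eq1 (negbTE a1) /= => /eqP ->.
  by [].
have [c gE] := main g gS g1 gg; have [d hE] := main h hS h1 hh.
apply: (same_multiplier yP gS hS _ gE hE).
by rewrite GRing.oppr_eq0 GRing.oner_neq0.
Qed.

Lemma stab_second_point g : g \in stabp H P -> g != 1%g -> exists P',
  [/\ P != P', fixs g = [set P; P'] & forall h, h \in stabp H P -> h P' = P'].
Proof.
move=> gS g1; have [gH gP] := stabpP _ _ _ gS.
have gM := subsetP HM _ gH.
have [P' P'F P'P] : exists2 P', P' \in fixs g & P' != P.
  apply/exists_inP; apply: contraT; rewrite negb_exists_in => /forall_inP noP.
  have : g \in unip H P.
    rewrite inE gH; apply/eqP/setP=> Q; rewrite in_set1; apply/idP/eqP => [/noP|->].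
      by rewrite negbK => /eqP.
    exact/fixsP.
  by rewrite U0 inE.
have fg : fixs g = [set P; P'].
  by apply: cardsp1 => //; [rewrite eq_sym | apply/fixsP].
exists P'; split=> //; first by rewrite eq_sym.
move=> h hS; have [hH hP] := stabpP _ _ _ hS.
have : h P' \in fixs g.
  apply/fixsP; rewrite -permM -(stab_commute gS hS) permM; congr (h _).
  exact/fixsP.
rewrite fg => /set2P[E|//]; case/eqP: P'P; apply: (@perm_inj _ h).
by rewrite E hP.
Qed.

End NoUnipotent.

Section MaxPair.

Variables (s r : seq {perm option L}) (x y : {perm option L}).
Hypothesis sM : gens s \subset Mob L.
Hypothesis sF : {in gens s, forall g, 0 < #|fixs g|}.
Hypothesis maxD : max_pair s x y.
Hypothesis goodD : good (gens [:: x; y]).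

(* The sporadic orders 24 and 60 of [<x, y, g>] are ruled out by multiplying [g] by an
   element of [<x, y>] so that it becomes an elliptic element [c] of order at least 4: one
   of the pairs [(c, x)] and [(c, y)] then beats the maximal pair. *)
Lemma max_pair_large g r' : nreach s [:: x, y, g & r'] -> g \notin gens [:: x; y] ->
  exists K (z : {perm option L}) t, Ktype (gens [:: x; y; g]) K z t /\ 4 < #|K|.
Proof.
move=> reach gD; set D := gens [:: x; y] in gD; set M := gens [:: x; y; g].
have gs : gens [:: x, y, g & r'] = gens s by rewrite (nreach_gens reach).
have Ms : M \subset gens s.
  rewrite -gs; apply: gensS => z; rewrite !inE => /or3P[] -> ; rewrite ?orbT //.
have DM : D \subset M by apply: gensS => z; rewrite !inE => /orP[] ->; rewrite ?orbT.
have gM : g \in M by rewrite mem_gens // !inE eqxx !orbT.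
have restr (A : {group {perm option L}}) : A \subset M ->
    A \subset Mob L /\ {in A, forall h, 0 < #|fixs h|}.
  move=> AM; have As := subset_trans AM Ms; split; first exact: subset_trans As sM.
  by move=> h /(subsetP As); apply: sF.
have [MM MF] := restr M (subxx _); have [DMob DF] := restr D DM.
have ltDM : #|D| < #|M|.
  by apply: proper_card; rewrite properE DM; apply: contra gD => /subsetP; apply.
have dvdDM := cardSg DM.
have goodM := goodS DM goodD.
have D12 : #|M| <= 60 -> #|D| = 12 /\ (forall P, #|stabp D P| <= 3) \/ #|D| = 24.
  move=> M60; case: (good_cards DMob DF goodD); [by left | by right |].
  by move=> D60; have := leq_ltn_trans D60 ltDM; rewrite ltnNge M60.
suff ctrick n c P : goodtype_b M n -> unip M P = set0 -> #|stabp M P| = n ->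
  (forall R, n %| #|stabp M R| -> #|stabp M R| = n) -> #|D| = 12 ->
  c \in stabp M P -> 3 < #[c]%g -> (exists2 d, d \in D & g = (d * c)%g) -> False.
  case: (good_numbers L2 MM MF goodM).
  - case=> M12 _; case: (D12 _) => [|[D12' _]|D24]; first by rewrite M12.
      by rewrite D12' M12 ltnn in ltDM.
    by rewrite D24 M12 in ltDM.
  - case=> M24 b4; have [P [U0 S4 dvS]] := b4.
    have [D12' DS] : #|D| = 12 /\ forall P, #|stabp D P| <= 3.
      case: (D12 _) => [|//|D24]; first by rewrite M24.
      by rewrite D24 M24 ltnn in ltDM.
    (* The stabiliser has order 4 but at most one involution, whose multiplier is -1. *)
    have [c cS cc] : exists2 c, c \in stabp M P & (c * c)%g != 1%g.
      apply/exists_inP; apply: contraT; rewrite negb_exists_in => /forall_inP noc.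
      have : 1 < #|stabp M P :\ 1%g|.
        have := cardsD1 1%g (stabp M P); rewrite S4 group1.
        by move: #|_ :\ _| => j; clear; lia.
      case/card_gt1P=> u [v [/setD1P[u1 uS] /setD1P[v1 vS] /eqP[]]].
      apply: (stab_involution MM U0 uS vS u1 v1); apply/eqP; have := noc _ uS; have := noc _ vS.
        by rewrite !negbK.
      by rewrite !negbK.
    have ord4 : 3 < #[c]%g.
      have : #[c]%g %| 4 by rewrite -S4 order_dvdG.
      have : #[c]%g != 1 by rewrite order_eq1; apply: contra cc => /eqP ->; rewrite mulg1.
      have : #[c]%g != 2.
        by apply: contra cc => /eqP c2; rewrite -(expg_order c) c2 expgS expg1.
      by move: #[c]%g => [|[|[|[|]]]].
    have cD : c \notin D.
      apply/negP => cD; have := DS P; rewrite leqNgt => /negP; apply.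
      apply: leq_trans ord4 _; rewrite orderE; apply: subset_leq_card.
      by rewrite cycle_subG; move: cS; rewrite !stabpE cD => /andP[].
    exfalso; apply: (ctrick 4 c P) => //.
    exists (g * c^-1)%g; last by rewrite mulgKV.
    have iMD : #|M : D| = 2 by rewrite -divgS // M24 D12'.
    have cM : c \in M :\: D by rewrite inE cD; case/stabpP: cS.
    have : g \in D :* c by rewrite (rcoset_index2 DM iMD cM) inE gD.
    by case/rcosetP=> d dD ->; rewrite mulgK.
  - case=> M60 b5; have [P [U0 S5 dvS]] := b5.
    have D12' : #|D| = 12.
      case: (D12 _) => [|[->//]|D24]; first by rewrite M60.
      by move: dvdDM; rewrite D24 M60.
    (* The coprime orders 12 and 5 have product 60, so every element of [M] factors as [d * c]. *)
    have TI : D :&: stabp M P = 1%g.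
      by apply: coprime_TIg; rewrite D12' S5.
    have ME : (D * stabp M P)%g = M.
      apply/eqP; rewrite eqEcard (TI_cardMg TI) D12' S5 M60 leqnn andbT mul_subG //.
      by apply/subsetP=> z /stabpP[].
    have : g \in (D * stabp M P)%g by rewrite ME.
    case/mulsgP=> d c dD cS gE; exfalso; apply: (ctrick 5 c P) => //; last by exists d.
    have c1 : c != 1%g by apply: contra gD => /eqP c1; rewrite gE c1 mulg1.
    have : #[c]%g %| 5 by rewrite -S5 order_dvdG.
    have : #[c]%g != 1 by rewrite order_eq1.
    by move: #[c]%g => [|[|[|[|]]]].
  case=> P [m [t [m2 om U [O S tm mt]]]].
  have [K [z [Kz Km]]] := Ktype_any MM (ltnW (ltnW m2)) U O S tm mt.
  by exists K, z, t; split=> //; rewrite Km; move: m2; clear; lia.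
move=> _ U0 Sn dvS D12' cS ord4 [d dD gE].
have [cM cP] := stabpP _ _ _ cS.
have cc1 : (c * c)%g != 1%g.
  apply/eqP => cc; have : #[c]%g <= 2 by rewrite dvdn_leq // order_dvdn expgS expg1 cc.
  by move: ord4; move: #[c]%g; clear; lia.
have c1 : c != 1%g by apply: contra cc1 => /eqP ->; rewrite mulg1.
have [P' [PP' fc allP']] := stab_second_point MM U0 cS c1.
have SP' : stabp M P = stabp M P' :> {set _}.
  have sub : stabp M P \subset stabp M P'.
    by apply/subsetP=> h hS; apply/stabpP; split; [case/stabpP: hS | apply: allP'].
  by apply/eqP; rewrite eqEcard sub Sn dvS ?leqnn // -Sn cardSg.
(* A generator of [D] moving the pair of fixed points of [c]. Then [<c, h>] preserves no pair and
   contains [c] in a point stabiliser, which the type of order 12 forbids: it is larger than [D]. *)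
have [h hxy hPP'] := good_gensP _ goodD P P'.
have hM : h \in M by apply: (subsetP DM); apply: mem_gens.
have reachc : exists r'', nreach s [:: c, h & r''].
  have r1 : nreach s [:: c, x, y & r'].
    have r2 : perm_eq [:: x, y, g & r'] [:: g, x, y & r'].
      by rewrite (perm_catCA [:: x; y] [:: g] r').
    apply: nreach_trans reach _; apply: nreach_trans (nreach_perm r2) _.
    have -> : c = (d^-1 * g)%g by rewrite gE mulKg.
    apply: nreach_mull; rewrite groupV; apply: subsetP dD.
    by apply: gensS => z; rewrite !inE => /orP[] ->; rewrite ?orbT.
  move: hxy; rewrite !inE => /orP[] /eqP ->; first by exists (y :: r').
  exists (x :: r'); apply: nreach_trans r1 (nreach_perm _).
  by rewrite perm_cons (perm_catCA [:: x] [:: y] r').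
have [r'' reach2] := reachc.
have EM : gens [:: c; h] \subset M.
  by apply/gens_subP => z; rewrite !inE => /orP[] /eqP ->.
have [EMob EF] := restr _ EM.
have goodE : good (gens [:: c; h]).
  apply/good_gensP => Q R; apply: NNPP => no.
  have pres z : z \in [:: c; h] -> z @: [set Q; R] = [set Q; R].
    by move=> zch; apply/eqP; apply: contraT => zE; case: no; exists z.
  (* An invariant pair is fixed pointwise by the square of [c], so it consists of fixed points of
     [c]. *)
  have fcc : fixs (c * c)%g = [set P; P'].
    apply: cardsp1; rewrite ?permM ?cP ?allP' //; exact: groupM (subsetP MM _ cM) (subsetP MM _ cM).
  have QF : Q \in [set P; P'] /\ R \in [set P; P'].
    have := preserve2 (pres c (mem_head _ _)).
    by rewrite -fcc; case=> -[cQ cR]; split; apply/fixsP; rewrite permM ?cQ ?cR ?cQ.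
  have hQR : h @: [set Q; R] = [set Q; R] by apply: pres; rewrite !inE eqxx orbT.
  have hP0 : h P != P.
    apply: contra hPP' => /eqP hP; apply/eqP/preserve2P; left; split=> //.
    by apply: allP'; apply/stabpP.
  have hP'0 : h P' != P'.
    apply: contra hPP' => /eqP hP'; apply/eqP/preserve2P; left; split=> //.
    have : h \in stabp M P by rewrite SP'; apply/stabpP.
    by case/stabpP.
  case: QF => /set2P[] QE /set2P[] RE; move: hQR; rewrite QE RE ?setUid.
  - by rewrite imset_set1 => /set1_inj /eqP; rewrite (negbTE hP0).
  - by move/eqP; rewrite (negbTE hPP').
  - by rewrite setUC => /eqP; rewrite (negbTE hPP').
  - by rewrite imset_set1 => /set1_inj /eqP; rewrite (negbTE hP'0).
have := maxD reach2 (good_irred goodE); rewrite -/D D12' => E12.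
case: (good_cards EMob EF goodE) => [[_ /(_ P)]|E24|E60].
- rewrite leqNgt => /negP; apply; apply: leq_trans ord4 _; rewrite orderE.
  apply: subset_leq_card; rewrite cycle_subG; apply/stabpP; split=> //.
  by rewrite mem_gens // inE eqxx.
- by rewrite E24 in E12.
- by have := leq_trans E60 E12.
Qed.

End MaxPair.

End LargeTriple.

(** * Reaching a generating triple *)

Section GeneratingTriple.

Local Open Scope ring_scope.
Import GRing.Theory.

Variable L : finFieldType.
Implicit Types (P Q R : option L) (g h z : {perm option L}).
Implicit Types (s r : seq {perm option L}) (K : {set L}).
Hypothesis L2 : (2%:R != 0 :> L)%R.

Lemma PGL_sqr K g : subfield K -> g \in PGLset K -> (g * g)%g \in PSLset K.
Proof.
move=> sK /PGLsetP[a [b [c [d [/and4P[aK bK cK dK] D ->]]]]].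
rewrite mobM //; apply: (PSL_square sK (r := a * d - b * c)); rewrite ?det_mul ?mulf_neq0 //.
  by apply/and4P; split; apply: (sfD sK); apply: (sfM sK).
by apply: (sfB sK); apply: (sfM sK).
Qed.

Lemma aff_sqr (b : L) : aff 1 b = (aff 1%R (b / 2%:R)%R * aff 1%R (b / 2%:R)%R)%g.
Proof. by rewrite affM ?oner_neq0 // !mulr1; congr aff; field. Qed.

Lemma low_sqr (b : L) : low b = (low (b / 2%:R)%R * low (b / 2%:R)%R)%g.
Proof.
have D : 1 * 1 - b / 2%:R * 0 != 0 by rewrite mulr0 mulr1 subr0 oner_neq0.
by rewrite /low mobM //; apply: eq_mob; field.
Qed.

Lemma sf2 K : subfield K -> 2%:R \in K.
Proof. by move=> sK; rewrite -[2%:R]/(1 + 1) (sfD sK) ?(sf1 sK). Qed.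

(** PSL(2,K) is generated by unipotents, which are squares as 2 is invertible, and squares in
    PGL(2,K') lie in PSL(2,K'). *)
Lemma PSL_conj_sub (K K' : {set L}) (A : {group {perm option L}}) y :
  subfield K -> subfield K' ->
  (forall g, g \in PSLset K -> (g ^ y)%g \in PGLset K') ->
  (PSLset K' \subset A :^ y)%g -> PSLset K \subset A.
Proof.
move=> sK sK' KK' K'A; have sq g : g \in PSLset K -> (g * g)%g \in A.
  move=> /KK' /(PGL_sqr sK') ggK; rewrite -(memJ_conjg A y) conjMg.
  exact: (subsetP K'A).
apply: (PSL_generated sK) => b bK.
  by rewrite aff_sqr; apply/sq/(aff_PSL sK)/(sf_div sK bK)/sf2.
by rewrite low_sqr; apply/sq/(low_PSL sK)/(sf_div sK bK)/sf2.
Qed.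

(** A translation swapping two points would have a square fixing both, yet this square is again
    nontrivial. So only infinity could be preserved, and [g] moves it. *)
Lemma good_unip (H : {group {perm option L}}) (b : L) g : b != 0 -> aff 1 b \in H ->
  g \in H -> g None != None -> good H.
Proof.
move=> b0 bH gH gi; apply/goodP=> P Q.
have fx c : c != 0 -> forall R, aff 1 c R = R -> R = None.
  move=> c0 R /fixsP; rewrite fixs_aff ?oner_neq0 // eqxx (negbTE c0) inE => /eqP.
  by [].
apply: NNPP => no.
have pres h : h \in H -> h @: [set P; Q] = [set P; Q].
  by move=> hH; apply/eqP; apply: contraT => hE; case: no; exists h.
have [PN QN] : P = None /\ Q = None.
  case/preserve2: (pres _ bH) => [[/fx -> // /fx -> //]|[bP bQ]].
  have b2 : b + b != 0 by rewrite -mulr2n -mulr_natl mulf_neq0.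
  have PN : P = None.
    apply: (fx _ b2); have -> : aff 1 (b + b) = (aff 1%R b * aff 1%R b)%g.
      by rewrite affM ?oner_neq0 // !mulr1.
    by rewrite permM bP bQ.
  by split=> //; rewrite -bP PN aff_inf ?oner_neq0.
by move: (pres _ gH); rewrite PN QN setUid imset_set1 => /set1_inj/eqP; rewrite (negbTE gi).
Qed.

(** For a given field the order varies by a factor of at most 2, while a larger field has at least
    three times as many elements. *)
Lemma Ktype_card_le (H1 H2 : {group {perm option L}}) K1 K2 (y1 y2 : {perm option L}) t1 t2 :
  Ktype H1 K1 y1 t1 -> Ktype H2 K2 y2 t2 -> (#|H1| <= #|H2|)%N -> (#|K1| <= #|K2|)%N.
Proof.
move=> [[sK1 _ _ _] N1 [_ b1]] [[sK2 _ _ _] N2 [b2 _]].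
have [p [pr_p odd_p [n Ln]]] := card_char_power L2.
have [e1 E1] := card_additive_power pr_p Ln (subfield_additive sK1).
have [e2 E2] := card_additive_power pr_p Ln (subfield_additive sK2).
have p2 : (2 < p)%N by case: p pr_p odd_p {Ln E1 E2} => [|[|[]]].
have K20 : (0 < #|K2|)%N by apply/card_gt0P; exists 1; apply: sf1.
rewrite N1 N2 => le; rewrite leqNgt; apply/negP => lt.
have le3 : (3 * #|K2| <= #|K1|)%N.
  rewrite E1 E2 in lt *; rewrite ltn_exp2l ?(ltnW p2) // in lt.
  apply: leq_trans (leq_pexp2l (ltnW (ltnW p2)) lt).
  by rewrite expnS leq_mul2r p2 orbT.
move: le b1 b2 le3 K20; move: #|K1| #|K2| => q1 q2; clear => le b1 b2 le3 q20.
have h1 : (q1 * q1.-1 * q1.+1 <= 2 * (q1 * t1 * q1.+1))%N.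
  by rewrite mulnA leq_mul2r mulnCA leq_mul2l; apply/orP; right; apply/orP; right; lia.
have h2 : (q2 * t2 * q2.+1 <= q2 * q2.-1 * q2.+1)%N by rewrite leq_mul2r leq_mul2l b2 !orbT.
have h3 : (3 * q2 * q2 * q2.+1 <= q1 * q1.-1 * q1.+1)%N by rewrite !leq_mul //; lia.
have h4 : (2 * (q2 * q2.-1 * q2.+1) < 3 * q2 * q2 * q2.+1)%N.
  rewrite mulnA ltn_mul2r /= !mulnA -[(3 * q2 * q2)%N]mulnA.
  case: q2 q20 {le b2 le3 h1 h2 h3} => // q2 _ /=.
  have : (0 < q2.+1 * q2.+1)%N by [].
  rewrite -mulnA mulnS; move: (q2.+1 * q2)%N => x; clear; lia.
by have := leq_ltn_trans (leq_trans h1 (leq_trans (leq_mul (leqnn 2) le) (leq_mul (leqnn 2) h2)))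
   (leq_trans h4 h3); rewrite ltnn.
Qed.

Variable F : {set L}.
Hypothesis sF : subfield F.
Hypothesis fixF : {in PGLset F, forall g, (0 < #|fixs g|)%N}.

Variable G : {group {perm option L}}.
Hypothesis SG : PSLset F \subset G.
Hypothesis GP : G \subset PGLset F.

Let S := PSLgroup sF.

(** As PSL(2,F) has index at most 2, this says for a subgroup of [G] that it maps onto [G] modulo
    PSL(2,F). *)
Definition surj_mod_PSL (M : {set {perm option L}}) :=
  (G \subset PSLset F) || ~~ (M \subset PSLset F).

Lemma surj_mod_PSLS (M N : {set {perm option L}}) :
  M \subset N -> surj_mod_PSL M -> surj_mod_PSL N.
Proof.
move=> MN /orP[GS|MS]; apply/orP; [by left | right]; apply: contra MS.
exact: subset_trans MN.
Qed.

Lemma surj_mod_PSL_eq (M : {group {perm option L}}) : PSLset F \subset M -> M \subset G ->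
  surj_mod_PSL M -> M = G.
Proof.
move=> SM MG surj; apply/val_inj/eqP; rewrite eqEsubset MG /=.
case/orP: surj => [GS|/subsetPn[h hM hS]]; first exact: subset_trans GS SM.
apply/subsetP=> w wG; have [/(subsetP SM)//|wS] := boolP (w \in PSLset F).
rewrite -(groupMr _ hM); apply: (subsetP SM); apply: PGL_PSL_mul => //.
  exact: (subsetP GP).
exact/(subsetP GP)/(subsetP MG).
Qed.

Lemma goodG : good G.
Proof.
apply: (@good_unip _ 1 (low 1)); first exact: oner_neq0.
- by apply: (subsetP SG); apply: (aff_PSL sF); apply: sf1.
- by apply: (subsetP SG); apply: (low_PSL sF); apply: sf1.
by rewrite mob_fix_inf ?oner_neq0 // mulr1 mulr0 subr0 oner_neq0.
Qed.

Lemma PGL_sub_Mob : G \subset Mob L.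
Proof. exact: subset_trans GP (PGLset_sub F). Qed.

(* Take [M = <x, y, z>] of subfield type and maximal order. An entry [g] outside of PGL(2,K)
   could be multiplied by an element of [M] to have an invariant [tau] in no field of order
   at most [#|K|], and then [<x, y, m g>] would be larger. So the whole list lies in
   PGL(2,K), and [M] contains the unipotents of [G]. *)
Lemma generating_triple s : gens s = G -> (2 < size s)%N ->
  exists x y z r, nreach s [:: x, y, z & r] /\ gens [:: x; y; z] = G.
Proof.
move=> sG s3.
have sM : {subset gens s <= Mob L} by rewrite sG; apply/subsetP/PGL_sub_Mob.
have sMs : {subset s <= Mob L} by move=> x /mem_gens /sM.
have sFix : {in gens s, forall g, (0 < #|fixs g|)%N}.
  by rewrite sG => g /(subsetP GP); apply: fixF.
have goods : good (gens s) by rewrite sG goodG.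
have [|x0 [y0 [r0 [reach0 irr0]]]] := irred_pair sMs _ (good_irred goods).
  by move=> g /mem_gens /sFix.
pose pairP (u : {perm option L} * {perm option L} * seq {perm option L}) :=
  nreach s [:: u.1.1, u.1.2 & u.2] /\ irred (gens [:: u.1.1; u.1.2]).
have [||[[x y] r] [[/= reach irr] maxD']] := @ex_maximum _ pairP
    (fun u => #|gens [:: u.1.1; u.1.2]|) #|G|.
- by exists (x0, y0, r0).
- move=> [[x y] r] [/= reach _]; rewrite -sG (nreach_gens reach); apply/subset_leq_card/gensS.
  by move=> z; rewrite !inE => /orP[] ->; rewrite ?orbT.
have maxD : max_pair s x y by move=> x' y' r' reach' irr'; apply: (maxD' (x', y', r')).
have goodD := max_pair_good sM sFix goods reach irr maxD.
have rs : gens [:: x, y & r] = G by rewrite -sG (nreach_gens reach).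
set D := gens [:: x; y] in goodD.
have subD g : D \subset gens [:: x; y; g].
  by apply: gensS => z; rewrite !inE => /orP[] ->; rewrite ?orbT.
have subG g r' : nreach s [:: x, y, g & r'] -> gens [:: x; y; g] \subset G.
  move=> reach'; rewrite -sG (nreach_gens reach'); apply: gensS => z.
  by rewrite !inE => /or3P[] ->; rewrite ?orbT.
have rsize : (0 < size r)%N.
  by have := nreach_size reach; move: s3; case: (r) => //= s3 E; rewrite E in s3.
have to_third g : g \in r -> nreach s [:: x, y, g & rem g r].
  move=> gr; apply: nreach_trans reach (nreach_perm _).
  by rewrite !perm_cons perm_to_rem.
have [DG|DG] := eqVneq D G.
  case: r reach rs rsize to_third => // z r reach _ _ to_third.
  exists x, y, z, r; split=> //; apply/val_inj/eqP; rewrite eqEsubset (subG z r) //.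
  by rewrite -DG subD.
(* If [D] lies in PSL(2,F) and [G] does not, an entry outside of PSL(2,F) serves both purposes. *)
have [g [r' [reach1 gD surjM]]] : exists g r', [/\ nreach s [:: x, y, g & r'], g \notin D &
    surj_mod_PSL (gens [:: x; y; g])].
  have [surjD|] := boolP (surj_mod_PSL D).
    have /allPn[g gr gD] : ~~ all (fun g => g \in D) r.
      apply: contra DG => /allP rD; apply/eqP/val_inj/eqP; rewrite eqEsubset -rs.
      rewrite gensS /=; last by move=> z; rewrite !inE => /orP[] ->; rewrite ?orbT.
      apply/gens_subP => z; rewrite !inE => /or3P[/eqP->|/eqP->|/rD//]; apply: mem_gens;
        by rewrite !inE eqxx ?orbT.
    exists g, (rem g r); split=> //; first exact: to_third.
    exact: surj_mod_PSLS (subD g) surjD.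
  rewrite negb_or negbK => /andP[GS DS].
  have DS' z : z \in D -> z \in S by apply: subsetP DS z.
  have /allPn[g gr gS] : ~~ all (fun g => g \in S) r.
    apply: contra GS => /allP rD; rewrite -rs; apply/(@gens_subP _ _ S).
    move=> z; rewrite 2!in_cons => /or3P[/eqP->|/eqP->|/rD//]; apply: DS'; apply: mem_gens;
      by rewrite !in_cons eqxx ?orbT.
  exists g, (rem g r); split; [exact: to_third | by apply: contra gS => /DS' |].
  apply/orP; right; apply: contra gS => /subsetP; apply; apply: mem_gens.
  by rewrite !inE eqxx !orbT.
(* The pair stays fixed; only the third entry and the rest of the list vary in this maximum. *)
pose tripP (u : {perm option L} * seq {perm option L}) :=
  [/\ nreach s [:: x, y, u.1 & u.2], u.1 \notin D & surj_mod_PSL (gens [:: x; y; u.1])].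
have [||[g2 r2] [[/= reach2 g2D surjM2] maxM]] := @ex_maximum _ tripP
    (fun u => #|gens [:: x; y; u.1]|) #|G|.
- by exists (g, r').
- by move=> [g' r''] [/= reach' _ _]; apply/subset_leq_card/(subG _ _ reach').
move: g2 r2 reach2 g2D surjM2 maxM {g r' reach1 gD surjM} => g r' reach1 gD surjM maxM.
set M := gens [:: x; y; g] in surjM *.
have MG : M \subset G := subG _ _ reach1.
have sMob : gens s \subset Mob L by apply/subsetP.
have [K [y1 [t [KM K5]]]] := max_pair_large L2 sMob sFix maxD goodD reach1 gD.
have [[sK yM KMsub MK] _ _] := KM.
have gM : g \in M by rewrite mem_gens // !inE eqxx !orbT.
have MKg h : h \in M -> (h ^ y1)%g \in PGLset K.
  by move=> hM; apply: (subsetP MK); rewrite memJ_conjg.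
(* Hence the multiplier [m0] below lies in PSL(2,F), and multiplying by it keeps an entry outside of
   PSL(2,F). *)
have KS : PSLset K \subset (S :^ y1)%g.
  have := @PSL_conj_sub K F (S :^ y1)%G y1^-1%g sK sF; rewrite /= conjsgK; apply=> // h hK.
  have : (h ^ y1^-1)%g \in M by rewrite -(memJ_conjg _ y1) conjgKV (subsetP KMsub).
  by move/(subsetP MG); apply: (subsetP GP).
(* The condition on [z] makes the new triple admissible in the maximum; its larger group then
   contradicts the choice of [M]. *)
have main z r'' : nreach s [:: z, x, y, g & r''] -> z \in G ->
    (surj_mod_PSL D || (z \notin S)) -> (z ^ y1)%g \in PGLset K.
  move=> reachz zG surjz; apply: contraT => zK.
  have zMob : (z ^ y1)%g \in Mob L by rewrite groupJ // (subsetP PGL_sub_Mob).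
  have [m [a [b [c [d [mK Dabcd mz notK]]]]]] := large_trace sK L2 K5 zMob zK.
  pose m0 := (m ^ y1^-1)%g.
  have m0M : m0 \in M by rewrite -(memJ_conjg _ y1) conjgKV (subsetP KMsub).
  have m0S : m0 \in S by rewrite -(memJ_conjg _ y1) conjgKV (subsetP KS).
  have wE : ((m0 * z) ^ y1)%g = mob a b c d by rewrite conjMg conjgKV mz.
  have wM : (m0 * z)%g \notin M.
    by apply: contra zK => wM; apply: MKg; rewrite groupMl in wM.
  have wD : (m0 * z)%g \notin D by apply: contra wM; apply/subsetP/subD.
  have reachw : nreach s [:: x, y, (m0 * z)%g & g :: r''].
    apply: nreach_trans reachz _; apply: nreach_trans (_ : nreach _ [:: (m0 * z)%g, x, y, g & r'']) _.
      apply: nreach_mull; apply: subsetP m0M; apply: gensS => h.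
      by rewrite !inE => /or3P[] ->; rewrite ?orbT.
    by apply: nreach_perm; rewrite (perm_catCA [:: (m0 * z)%g] [:: x; y] (g :: r'')).
  have [K' [y' [t' [KE K'5]]]] := max_pair_large L2 sMob sFix maxD goodD reachw wD.
  have surjE : surj_mod_PSL (gens [:: x; y; (m0 * z)%g]).
    case/orP: surjz => [|zS]; first by apply: surj_mod_PSLS; apply: subD.
    apply/orP; right; apply/subsetPn; exists (m0 * z)%g.
      by rewrite mem_gens // !inE eqxx !orbT.
    by rewrite -[PSLset F]/(S : {set _}) groupMl.
  have leEM := maxM ((m0 * z)%g, g :: r'') (And3 reachw wD surjE).
  have K'K := Ktype_card_le KE KM leEM.
  have [[sK' _ _ _] _ _] := KE.
  have wMob : (m0 * z)%g \in Mob L.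
    by apply: (subsetP PGL_sub_Mob); rewrite groupM // (subsetP MG).
  have [a' [b' [c' [d' [D' wE']]]]] := MobP _ wMob.
  have tauK' : tau a' b' c' d' \in K'.
    by apply: (Ktype_tau KE) => //; rewrite -wE' mem_gens // !inE eqxx !orbT.
  have := notK K' sK' K'K; rewrite -(tau_conj yM D' Dabcd) ?tauK' //.
  by rewrite -wE'.
have all_r z : z \in r' -> (z ^ y1)%g \in PGLset K.
  move=> zr; have reachz : nreach s [:: z, x, y, g & rem z r'].
    apply: nreach_trans reach1 (nreach_perm _).
    apply: perm_trans (_ : perm_eq _ [:: x, y, g, z & rem z r']) _.
      by rewrite !perm_cons perm_to_rem.
    by rewrite (perm_catCA [:: x; y; g] [:: z] (rem z r')).
  have zG : z \in G by rewrite -sG (nreach_gens reachz) mem_gens // inE eqxx.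
  have [surjz|] := boolP (surj_mod_PSL D || (z \notin S)); first exact: (main z (rem z r')).
  rewrite negb_or negbK => /andP[nsurj zS].
  (* Here [D] and [z] lie in PSL(2,F), so [g] does not. Then [main] applies to [g * z], from which
     [g] cancels. *)
  have gS : g \notin S.
    apply/negP => gS; move: nsurj; rewrite negb_or negbK => /andP[/negP nGS DS].
    case/orP: surjM => // /negP; apply; apply/(@gens_subP _ _ S) => h.
    have DS' u : u \in D -> u \in S by apply: subsetP DS u.
    rewrite 3!in_cons orbF => /or3P[] /eqP -> //; apply: DS';
      by rewrite mem_gens // !in_cons eqxx ?orbT.
  have gzK : ((g * z) ^ y1)%g \in PGLset K.
    apply: (main _ (rem z r')); last by rewrite (groupMr _ (zS : z \in S)) gS orbT.
      apply: nreach_trans reachz _; apply: nreach_mull.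
      by rewrite mem_gens // !inE eqxx !orbT.
    by rewrite groupM // (subsetP MG).
  have := groupM (G := PGLgroup sK) (groupVr (G := PGLgroup sK) (MKg _ gM)) gzK.
  by rewrite -conjVg -conjMg mulKg.
exists x, y, g, r'; split=> //; apply: surj_mod_PSL_eq => //.
apply: (PSL_conj_sub (y := y1) sF sK) => // h hF.
have : h \in G by apply: (subsetP SG).
have GK : G \subset (PGLset K :^ y1^-1)%g.
  rewrite -sG (nreach_gens reach1); apply/(@gens_subP _ _ (PGLgroup sK :^ y1^-1)%G) => z zr.
  rewrite /= mem_conjgV; move: zr; rewrite 3!in_cons.
  case/or4P=> [/eqP->|/eqP->|/eqP->|/all_r//]; apply: MKg.
  - by rewrite mem_gens // in_cons eqxx.
  - by rewrite mem_gens // !in_cons eqxx orbT.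
  - by [].
by move/(subsetP GK); rewrite mem_conjgV.
Qed.

End GeneratingTriple.

(** * Redundant entries *)

Section NielsenMore.

Variable gT : finGroupType.
Implicit Types (s t r : seq gT) (x y z a b c : gT).

Lemma nreach_cons x s t : nreach s t -> nreach (x :: s) (x :: t).
Proof.
have swap u v r : nreach [:: u, v & r] [:: v, u & r].
  by apply: nreach_perm; rewrite (perm_catCA [:: u] [:: v] r).
elim=> {s t} [s|s t r _ IH1 _ IH2|s t st|y z s zs|y s].
- exact: nreach_refl.
- exact: nreach_trans IH1 IH2.
- by apply: nreach_perm; rewrite perm_cons.
- apply: nreach_trans (swap _ _ _) _; apply: nreach_trans (swap _ _ _).
  by apply: nreach_mul1; rewrite inE zs orbT.
- by apply: nreach_trans (swap _ _ _) _; apply: nreach_trans (swap _ _ _); apply: nreach_inv.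
Qed.

Lemma nreach_conj x z s : z \in gens s -> nreach (x :: s) (x ^ z :: s).
Proof.
move=> zs; rewrite conjgE; apply: nreach_trans (nreach_mulr _ zs) _.
by apply: nreach_mull; rewrite groupV.
Qed.

(** A fourth entry acts as a common conjugator of the other three. *)
Lemma nreach_conj3 a b c z r :
  nreach [:: a, b, c, z & r] [:: a ^ z, b ^ z, c ^ z, z & r].
Proof.
have zg s : z \in s -> z \in gens s by apply: mem_gens.
apply: nreach_trans (nreach_conj _ (zg _ _)) _; first by rewrite !inE eqxx !orbT.
apply: nreach_cons; apply: nreach_trans (nreach_conj _ (zg _ _)) _.
  by rewrite !inE eqxx !orbT.
apply: nreach_cons; apply: nreach_conj; apply: zg.
by rewrite !inE eqxx.
Qed.

Lemma nreach_fourth (G : {group gT}) a b c z w r : gens [:: a; b; c] = G ->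
  gens [:: a, b, c & r] = G -> z \in G -> w \in G ->
  nreach [:: a, b, c, z & r] [:: a, b, c, w & r].
Proof.
move=> _ rG zG wG; have pe u : perm_eq [:: a, b, c, u & r] [:: u, a, b, c & r].
  by rewrite (perm_catCA [:: a; b; c] [:: u] r).
apply: nreach_trans (nreach_perm (pe z)) _.
apply: nreach_trans (nreach_replace rG zG wG) (nreach_perm _).
by rewrite perm_sym.
Qed.

Lemma gens_cat3 (G : {group gT}) a b c r : gens [:: a; b; c] = G -> {subset r <= G} ->
  gens [:: a, b, c & r] = G.
Proof.
move=> abc rG; apply/val_inj/eqP; rewrite eqEsubset; apply/andP; split.
  apply/gens_subP => x; rewrite !inE => /or4P[/eqP->|/eqP->|/eqP->|/rG//];
    by rewrite -abc mem_gens // !inE eqxx ?orbT.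
by rewrite -abc; apply: gensS => x; rewrite !inE => /or3P[] ->; rewrite ?orbT.
Qed.

Lemma nreach_trivial_tail (G : {group gT}) a b c r : gens [:: a; b; c] = G ->
  {subset r <= G} -> nreach [:: a, b, c & r] [:: a, b, c & nseq (size r) 1].
Proof.
move=> abc; elim: r => [|x r IH] rG; first exact: nreach_refl.
have rG' : {subset r <= G} by move=> z zr; apply: rG; rewrite inE zr orbT.
have xG : x \in G by apply: rG; rewrite inE eqxx.
apply: nreach_trans (nreach_fourth abc (gens_cat3 abc rG') xG (group1 G)) _.
have pe t : perm_eq [:: a, b, c, 1 & t] [:: 1, a, b, c & t].
  by rewrite (perm_catCA [:: a; b; c] [:: 1] t).
apply: nreach_trans (nreach_perm (pe _)) _.
apply: nreach_trans (nreach_cons _ (IH rG')) (nreach_perm _).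
by rewrite perm_sym; apply: pe.
Qed.

End NielsenMore.

(** * Generation by a translation, a homothety and an entry moving infinity *)

Section Flags.

Local Open Scope ring_scope.
Import GRing.Theory.

Variable L : finFieldType.
Implicit Types (P Q R : option L) (g h : {perm option L}).
Implicit Types (s r : seq {perm option L}) (K : {set L}).
Hypothesis L2 : (2%:R != 0 :> L)%R.

Variable F : {set L}.
Hypothesis sF : subfield F.
Hypothesis fixF : {in PGLset F, forall g, (0 < #|fixs g|)%N}.

Variable G : {group {perm option L}}.
Hypothesis SG : PSLset F \subset G.
Hypothesis GP : G \subset PGLset F.

Variable th : L.
Hypothesis thF : th \in F.
Hypothesis th0 : th != 0.
Hypothesis gen_th : forall x, x \in F -> x != 0 -> exists m : nat, x = th ^+ m.

Let S := PSLgroup sF.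

Lemma diff_squares (x : L) : x = ((x + 1) / 2%:R) ^+ 2 - ((x - 1) / 2%:R) ^+ 2.
Proof.
have L4 : (4%:R : L) != 0 by rewrite -[4%N]/(2 * 2)%N natrM mulf_neq0.
by field.
Qed.

(** The nonzero squares are the even powers of [th], and every element is a difference of two
    squares. *)
Lemma even_power_span (T : {set L}) : additive_set T ->
  (forall m, th ^+ m.*2 \in T) -> F \subset T.
Proof.
move=> AT Tth; have sq u : u \in F -> u ^+ 2 \in T.
  move=> uF; have [->|u0] := eqVneq u 0; first by rewrite expr0n; case: AT.
  by have [m ->] := gen_th uF u0; rewrite -exprM muln2.
apply/subsetP=> x xF; rewrite [x]diff_squares; case: (AT) => _; apply; apply: sq.
  by apply: (sf_div sF); [apply: (sfD sF); rewrite ?(sf1 sF) | apply: sf2].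
by apply: (sf_div sF); [apply: (sfB sF); rewrite ?(sf1 sF) | apply: sf2].
Qed.

(** If the generator were a square, squaring would be onto and hence injective on [F], contrary to 1
    and -1. *)
Lemma th_nonsquare (r : L) : r \in F -> th != r ^+ 2.
Proof.
move=> rF; apply/eqP => thr; have r0 : r != 0.
  by apply: contraNneq th0 => r0; rewrite thr r0 expr0n.
have sq : F \subset [set x ^+ 2 | x in F].
  apply/subsetP=> x xF; have [->|x0] := eqVneq x 0.
    by apply/imsetP; exists 0; rewrite ?(sf0 sF) ?expr0n.
  have [m ->] := gen_th xF x0; apply/imsetP; exists (r ^+ m); first exact: sfX.
  by rewrite thr -!exprM mulnC.
have /imset_injP inj : #|[set x ^+ 2 | x in F]| == #|F|.
  by rewrite eqn_leq leq_imset_card subset_leq_card.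
have := inj 1 (-1) (sf1 sF) (sfN sF (sf1 sF)); rewrite sqrrN => /(_ erefl)/eqP.
by rewrite -addr_eq0 -mulr2n (negbTE L2).
Qed.

Lemma aff_PGL a c : a \in F -> c \in F -> a != 0 -> aff a c \in PGLset F.
Proof.
by move=> aF cF a0; apply/PGLsetP; exists a, 0, c, 1; rewrite aF cF (sf0 sF) (sf1 sF) aff_det.
Qed.

(* The homothety of ratio [ep] generates the torus of [G] fixing zero and infinity. *)
Lemma torus_generator : exists ep, [/\ ep \in F, ep != 0, aff ep 0 \in G,
  (G \subset PSLset F) || (aff ep 0 \notin PSLset F) &
  forall m, exists n, th ^+ m.*2 = ep ^+ n].
Proof.
have [GS|/subsetPn[g gG gS]] := boolP (G \subset PSLset F).
  exists (th ^+ 2); split; rewrite ?(sfX sF) ?expf_neq0 //.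
    apply: (subsetP SG); apply: (PSL_square sF (r := th)) => //.
    - by rewrite (sfX sF) ?(sf0 sF) ?(sf1 sF).
    - by rewrite aff_det expf_neq0.
    - by rewrite mul0r subr0 mulr1.
  by move=> m; exists m; rewrite -exprM mul2n.
exists th; split=> //; last by move=> m; exists m.*2.
- have thP : aff th 0 \in PGLset F by rewrite aff_PGL ?(sf0 sF).
  have [/(subsetP SG)//|thS] := boolP (aff th 0 \in PSLset F).
  rewrite -(groupMr _ gG); apply: (subsetP SG); apply: PGL_PSL_mul => //.
  exact: (subsetP GP).
apply/PSLsetP => -[a [b [c [d [/and4P[aF bF cF dF] D E]]]]].
have D1 : th * 1 - 0 * 0 != 0 by rewrite mulr1 mul0r subr0.
have D' : a * d - b * c != 0 by rewrite D oner_neq0.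
have [k k0 [aE bE cE dE]] := mob_inj D1 D' E.
have := th_nonsquare (sfV sF dF); rewrite dE mulr1 => /eqP; apply.
move: D; rewrite aE bE cE dE !mulr0 mulr1 subr0 => D.
by rewrite exprVn; apply: (mulIf (expf_neq0 2 k0)); rewrite mulVf ?expf_neq0 // -D; ring.
Qed.

Variable ep : L.
Hypothesis epF : ep \in F.
Hypothesis ep0 : ep != 0.
Hypothesis epG : aff ep 0 \in G.
Hypothesis epS : (G \subset PSLset F) || (aff ep 0 \notin PSLset F).
Hypothesis ep_th : forall m, exists n, th ^+ m.*2 = ep ^+ n.

Lemma PGL_b g : g \in PGLset F -> g None != None -> exists a b c d,
  [/\ [&& a \in F, b \in F, c \in F & d \in F], a * d - b * c != 0, b != 0 & g = mob a b c d].
Proof.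
case/PGLsetP=> a [b [c [d [F4 D ->]]]]; rewrite mob_fix_inf // => b0.
by exists a, b, c, d.
Qed.

(** The homothety multiplies the translation by powers of [ep], which span [F] additively; with all
    translations present, [PSL_bruhat] applies. *)
Lemma flag_generates g (b : L) : g \in G -> g None != None -> b \in F -> b != 0 ->
  gens [:: g; aff 1 b; aff ep 0] = G.
Proof.
move=> gG gi bF b0; set M := gens _.
have [gM bM eM] : [/\ g \in M, aff 1 b \in M & aff ep 0 \in M].
  by split; rewrite mem_gens // !in_cons eqxx ?orbT.
have bepM n : aff 1 (b * ep ^+ n) \in M.
  elim: n => [|n IH]; first by rewrite expr0 mulr1.
  have := groupJ IH eM; rewrite conjgE affV // !affM ?mulf_neq0 ?oner_neq0 ?invr_eq0 //.
  by rewrite mul1r mulVf // exprSr; congr (aff _ _ \in M); field.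
have uM : {in F, forall x, aff 1 x \in M}.
  have AT : additive_set [set x | b * x \in transl M].
    have [T0 TB] := transl_additive M.
    split; first by rewrite inE mulr0.
    by move=> u v; rewrite [_ \in _]inE => uT; rewrite [_ \in _]inE => vT; rewrite inE mulrBr; apply: TB.
  have FT : F \subset [set x | b * x \in transl M].
    apply: even_power_span AT _ => m; have [n ->] := ep_th m.
    by rewrite inE inE; apply: bepM.
  move=> x xF; have := subsetP FT (x / b) (sf_div sF xF bF).
  by rewrite inE inE mulrC divfK.
have [a' [b' [c' [d' [F4 D b0' gE]]]]] := PGL_b (subsetP GP _ gG) gi.
have SM : PSLset F \subset M by apply: (PSL_bruhat sF uM F4 D b0'); rewrite -gE.
have uG : aff 1 b \in G by apply: (subsetP SG); apply: (aff_PSL sF).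
apply: (surj_mod_PSL_eq (F := F) sF) => //.
  by apply/gens_subP => z; rewrite 3!in_cons orbF => /or3P[] /eqP ->.
case/orP: epS => [GS|eS]; apply/orP; [by left | right].
by apply/subsetPn; exists (aff ep 0).
Qed.

Lemma aff1_rat v : aff 1 v \in PGLset F -> v \in F.
Proof.
move=> vF; have := @PGL_rat _ _ sF _ (Some 0) vF; rewrite affE ?oner_neq0 // mul0r add0r.
by rewrite !inE; apply; apply: sf0.
Qed.

(** The invariant puts [th ^+ 2], hence [F], into [K]. Conversely the translations of [E] scale [K]
    into [F], so the fields agree, and the conjugating affine map is then shown to be defined over
    [F]. *)
Lemma Ktype_full (E : {group {perm option L}}) K (y : {perm option L}) t a b c d :
  E \subset G -> Ktype E K y t -> y None = None -> a * d - b * c != 0 ->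
  mob a b c d \in E -> (tau a b c d = th \/ tau a b c d = th ^+ 2) -> PSLset F \subset E.
Proof.
move=> EG KE yi D wE tauE; have tauK := Ktype_tau KE D wE.
have [[sK yM KE1 KE2] _ _] := KE.
have th2K : th ^+ 2 \in K by case: tauE tauK => -> // thK; apply: (sfX sK).
have FK : F \subset K.
  apply: even_power_span (subfield_additive sK) _ => m.
  by rewrite -mul2n exprM; apply: (sfX sK).
have [al al0 [ga yE]] := affP yM yi.
have EP z : z \in E -> z \in PGLset F by move=> /(subsetP EG)/(subsetP GP).
have KF k : k \in K -> k / al \in F.
  move=> kK; apply: aff1_rat; apply: EP.
  have -> : aff 1 (k / al) = (aff 1%R k ^ y^-1)%g.
    rewrite yE conjgE invgK affV // !affM ?mulf_neq0 ?invr_eq0 ?oner_neq0 //.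
    by congr aff; field; rewrite ?al0 ?oner_neq0.
  by rewrite -(memJ_conjg E y) conjgKV (subsetP KE1) // (aff_PSL sK).
have FKE : F = K.
  apply/eqP; rewrite eqEcard FK -(card_imset K (mulIf (_ : al^-1 != 0))) ?invr_eq0 //=.
  by apply/subset_leq_card/subsetP=> _ /imsetP[k kK ->]; apply: KF.
have alF : al \in F by rewrite -[al]invrK (sfV sF) // -[al^-1]mul1r KF ?(sf1 sK).
have gaF : ga \in F.
  have D1 : 1 * 1 - 1 * 0 != 0 :> L by rewrite mulr1 mulr0 subr0 oner_neq0.
  (* [low 1] sends -1 to infinity, so [w] sends [(- 1 - ga) / al] there; this preimage of infinity
     is rational. *)
  pose w := (low 1%R ^ y^-1)%g.
  have wF : w \in PGLset F.
    by apply: EP; rewrite -(memJ_conjg E y) conjgKV (subsetP KE1) // (low_PSL sK) ?(sf1 sK).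
  have wP : w (Some ((- 1 - ga) / al)) = None.
    rewrite /w conjgE invgK !permM yE affE // divfK // subrK mob_SomeE //.
    by rewrite /pt mulr1 addNr eqxx -yE -{1}yi permK.
  have wVF : w^-1%g \in PGLset F := groupVr (G := PGLgroup sF) wF.
  have H : (- 1 - ga) / al \in F.
    by have := PGL_rat sF (P := None) wVF; rewrite -{2}wP permK !inE; apply.
  have -> : ga = - (1 + (- 1 - ga) / al * al) by field.
  by rewrite (sfN sF) // (sfD sF) ?(sf1 sF) // (sfM sF).
have yF : y \in PGLset F by rewrite yE aff_PGL.
have /normP yN : y \in 'N(PSLset F) by apply: (subsetP (PGL_norm_PSL sF)).
by rewrite -(conjSg _ _ y) yN; move: KE1; rewrite -FKE.
Qed.

Lemma unip_subgroup (E : {group {perm option L}}) (be : L) g a b c d : E \subset G ->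
  be != 0 -> aff 1 be \in E -> g \in E -> g None != None ->
  a * d - b * c != 0 -> mob a b c d \in E ->
  (tau a b c d = th \/ tau a b c d = th ^+ 2) -> PSLset F \subset E \/ #|E| = 60%N.
Proof.
move=> EG be0 beE gE gi D wE tauE.
have EM : E \subset Mob L by apply: subset_trans EG (subset_trans GP (PGLset_sub F)).
have EF : {in E, forall h, (0 < #|fixs h|)%N}.
  by move=> h /(subsetP EG)/(subsetP GP); apply: fixF.
have irr := good_irred (good_unip L2 be0 beE gE gi).
have U0 : unip E None != set0.
  by apply/set0Pn; exists (aff 1 be); rewrite inE beE fixs_aff ?oner_neq0 // eqxx (negbTE be0) eqxx.
have [m [t [f [n [Q [[m0 om tm t0 f0] [U St O] _ ar]]]]]] := unip_numbers L2 EM EF U0 irr.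
case: ar => [[f1 ar]|[m1 t2 _ f3]]; last first.
  by right; rewrite -(orb_stab E None) O St m1 t2 f3.
left; have [||K [y [KE yi _]]] := @Ktype_inf _ E m t EM m0 U _ St tm _.
- by rewrite O f1 muln1 add1n addn2.
- by move: ar; clear; lia.
exact: Ktype_full KE yi D wE tauE.
Qed.

(** The trace of [g * aff 1 be] is [a + d + b * be], hence arbitrary, with unchanged determinant
    [th ^+ n]. The parity of [n] decides whether [th] or [th ^+ 2] times it is a square; the sign of
    the root is chosen so that [be != 0]. *)
Lemma good_trace g : g \in PGLset F -> g None != None -> exists be a b c d,
  [/\ be \in F, be != 0, a * d - b * c != 0, (g * aff 1%R be)%g = mob a b c d &
     tau a b c d = th \/ tau a b c d = th ^+ 2].
Proof.
move=> gP gi; have [a [b [c [d [/and4P[aF bF cF dF] D b0 gE]]]]] := PGL_b gP gi.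
have DF : a * d - b * c \in F by apply: (sfB sF); apply: (sfM sF).
have [n nE] := gen_th DF D.
have [sg [sF' [sg0 sgE]]] : exists sg, sg \in F /\ sg != 0 /\
    (sg ^+ 2 = th * (a * d - b * c) \/ sg ^+ 2 = th ^+ 2 * (a * d - b * c)).
  have := odd_double_half n; case: (odd n) => /= nE'.
    exists (th ^+ (n./2).+1); rewrite (sfX sF) // expf_neq0 //; split=> //; split=> //; left.
    by rewrite nE -exprM -exprS; congr (_ ^+ _); move: nE'; move: n./2 => j; clear; lia.
  exists (th ^+ (n./2).+1); rewrite (sfX sF) // expf_neq0 //; split=> //; split=> //; right.
  by rewrite nE -exprM -exprD; congr (_ ^+ _); move: nE'; move: n./2 => j; clear; lia.
have main (s : L) : s \in F -> s ^+ 2 = sg ^+ 2 -> s - (a + d) != 0 -> exists be a' b' c' d',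
  [/\ be \in F, be != 0, a' * d' - b' * c' != 0, (g * aff 1%R be)%g = mob a' b' c' d' &
     tau a' b' c' d' = th \/ tau a' b' c' d' = th ^+ 2].
  move=> sF1 sE s0; pose be := (s - (a + d)) / b.
  have D1 : 1 * 1 - 0 * be != 0 by rewrite mul0r mulr1 subr0 oner_neq0.
  exists be, (a * 1 + b * be), (a * 0 + b * 1), (c * 1 + d * be), (c * 0 + d * 1).
  split.
  - by apply: (sf_div sF) => //; apply: (sfB sF) => //; apply: (sfD sF).
  - by rewrite mulf_neq0 ?invr_eq0.
  - by rewrite det_mul mulf_neq0.
  - by rewrite gE /aff mobM.
  rewrite /tau det_mul.
  have -> : a * 1 + b * be + (c * 0 + d * 1) = s by rewrite /be; field.
  have -> : 1 * 1 - 0 * be = 1 :> L by rewrite mul0r mulr1 subr0.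
  by rewrite mulr1 sE; case: sgE => ->; [left | right]; rewrite mulfK.
have [E|s0] := eqVneq (sg - (a + d)) 0; last exact: (main sg).
apply: (main (- sg)); rewrite ?(sfN sF) ?sqrrN //.
move/eqP: E; rewrite subr_eq0 => /eqP <-; rewrite -opprD oppr_eq0 -mulr2n -mulr_natl.
by rewrite mulf_neq0.
Qed.

End Flags.

Section Permutations.

Variable T : eqType.
Implicit Types (a b c d : T) (r : seq T).

Lemma perm_swap13 a b c r : perm_eq [:: a, b, c & r] [:: c, b, a & r].
Proof. by apply/seq.permP => p /=; lia. Qed.

Lemma perm_swap34 a b c d r : perm_eq [:: a, b, c, d & r] [:: a, b, d, c & r].
Proof. by apply/seq.permP => p /=; lia. Qed.

Lemma perm_swap14 a b c d r : perm_eq [:: a, b, c, d & r] [:: d, b, c, a & r].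
Proof. by apply/seq.permP => p /=; lia. Qed.

Lemma perm_swap24 a b c d r : perm_eq [:: a, b, c, d & r] [:: a, d, c, b & r].
Proof. by apply/seq.permP => p /=; lia. Qed.

End Permutations.

(** * Joining all generating lists to one *)

Section Connected.

Local Open Scope ring_scope.
Import GRing.Theory.

Variable L : finFieldType.
Implicit Types (P Q R : option L) (g h : {perm option L}).
Implicit Types (s r : seq {perm option L}) (K : {set L}).
Hypothesis L2 : (2%:R != 0 :> L)%R.

Variable F : {set L}.
Hypothesis sF : subfield F.
Hypothesis fixF : {in PGLset F, forall g, (0 < #|fixs g|)%N}.

Variable G : {group {perm option L}}.
Hypothesis SG : PSLset F \subset G.
Hypothesis GP : G \subset PGLset F.

Lemma moves_rational g : g \in PGLset F -> g != 1%g -> exists2 P, P \in rat_pts F & g P != P.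
Proof.
move=> gP g1; apply: NNPP => no.
have fx P : P \in rat_pts F -> g P = P.
  by move=> PF; apply/eqP; apply: contraT => gPP; case: no; exists P.
case/eqP: g1; apply: (@fixs3 _ g None (Some 0) (Some 1)).
- exact: PGL_Mob gP.
- by rewrite /= !inE /= andbT (inj_eq Some_inj) eq_sym oner_neq0.
- by apply: fx; rewrite inE.
- by apply: fx; rewrite inE (sf0 sF).
- by apply: fx; rewrite inE (sf1 sF).
Qed.

Lemma first_element s : gens s = G -> exists2 e, e \in s &
  e != 1%g /\ ((G \subset PSLset F) || (e \notin PSLset F)).
Proof.
move=> sG; have [GS|/negP GS] := boolP (G \subset PSLset F).
  have /allPn[e es e1] : ~~ all (fun e => e == 1%g) s.
    apply/negP => /allP s1; have /gens_subP sub : {subset s <= [1 {perm option L}]%G}.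
      by move=> e /s1; rewrite in_set1.
    have := subsetP SG _ (aff_PSL sF (sf1 sF)); rewrite -sG => /(subsetP sub).
    rewrite in_set1 -aff1 => /eqP/aff_inj[||_ /eqP]; rewrite ?oner_neq0 //.
    by rewrite (negbTE (oner_neq0 L)).
  by exists e.
have /allPn[e es eS] : ~~ all (fun e => e \in PSLset F) s.
  apply/negP => /allP sS; apply: GS; rewrite -sG; apply/(@gens_subP _ _ (PSLgroup sF)) => z /sS.
  by [].
exists e => //; split=> //; apply: contra eS => /eqP ->.
exact: (group1 (PSLgroup sF)).
Qed.

Lemma triple_to_front s r e x y z : nreach s [:: x, y, z & r] -> e \in [:: x; y; z] ->
  exists b c, nreach s [:: e, b, c & r] /\ gens [:: e; b; c] = gens [:: x; y; z].
Proof.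
move=> reach exyz; have pe := perm_to_rem exyz.
case: (rem e [:: x; y; z]) pe => [|b [|c [|d t]]] pe; try by have := perm_size pe.
exists b, c; split; last by apply/esym/eq_gens/perm_mem.
apply: nreach_trans reach (nreach_perm _).
by rewrite -[[:: x, y, z & r]]/([:: x; y; z] ++ r) -[[:: e, b, c & r]]/([:: e; b; c] ++ r) perm_cat2r.
Qed.

Lemma gens_subG s r : gens s = G -> nreach s r -> {subset r <= G}.
Proof. by move=> sG /nreach_gens E z /mem_gens; rewrite -E sG. Qed.

Lemma unipotent_triple s : gens s = G -> (3 < size s)%N ->
  exists a be w v r, [/\ nreach s [:: a, aff 1 be, w, v & r], gens [:: a; aff 1 be; w] = G,
    be \in F, be != 0 & a None != None].
Proof.
move=> sG s4; have [th thF [th0 gen_th]] := sf_generator sF.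
have [x [y [z [r [reach1 xyzG]]]]] := generating_triple L2 sF fixF SG GP sG (ltnW s4).
have [e1 e1xyz [e1n1 e1S]] := first_element xyzG.
have [b1 [c1 [reach2 gens2]]] := triple_to_front reach1 e1xyz.
case: r reach1 reach2 => [|v1 r] reach1 reach2.
  by move: s4; rewrite (nreach_size reach2).
have sub2 := gens_subG sG reach2.
have e1G : e1 \in G by apply: sub2; rewrite in_cons eqxx.
have rG : {subset r <= G} by move=> u ur; apply: sub2; rewrite !in_cons ur !orbT.
have v1G : v1 \in G by apply: sub2; rewrite !in_cons eqxx !orbT.
have [P PF e1P] := moves_rational (subsetP GP _ e1G) e1n1.
have [g gS gP] := PSL_move_inf sF PF.
have gG : g \in G by apply: (subsetP SG).
rewrite xyzG in gens2.
(* The redundant fourth entry becomes [g], which carries a point moved by [e1] to infinity. *)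
have reach3 : nreach s [:: (e1 ^ g)%g, (b1 ^ g)%g, (c1 ^ g)%g, g & r].
  apply: nreach_trans reach2 _; apply: nreach_trans (nreach_conj3 _ _ _ _ _).
  exact: (nreach_fourth gens2 (gens_cat3 gens2 rG)).
set e := (e1 ^ g)%g in reach3; set b := (b1 ^ g)%g in reach3; set c := (c1 ^ g)%g in reach3.
have gens3 : gens [:: e; b; c] = G.
  apply/val_inj/eqP; rewrite eqEsubset; apply/andP; split.
    by apply/gens_subP => u; rewrite 3!in_cons orbF => ubc; apply: (gens_subG sG reach3);
      rewrite 4!in_cons; case/or3P: ubc => ->; rewrite ?orbT.
  rewrite -(conjSg _ _ g^-1%g) (conjGid (groupVr gG)).
  suff : gens [:: e1; b1; c1] \subset (gens [:: e; b; c] :^ g^-1)%g by rewrite gens2.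
  apply/(@gens_subP _ _ (gens [:: e; b; c] :^ g^-1)%G) => u; rewrite 3!in_cons orbF => uE.
  rewrite /= mem_conjgV mem_gens // 3!in_cons.
  by case/or3P: uE => /eqP ->; rewrite eqxx ?orbT.
have eG : e \in G by rewrite groupJ.
have ei : e None != None.
  rewrite -gP /e conjgE !permM permK (inj_eq perm_inj); exact: e1P.
have eS : (G \subset PSLset F) || (e \notin PSLset F).
  case/orP: e1S => [->//|e1S]; apply/orP; right; apply: contra e1S.
  by rewrite -[PSLset F]/(PSLgroup sF : {set _}) groupJr.
have [be [ta [tb [tc [td [beF be0 D wE tauE]]]]]] :=
  good_trace L2 sF thF th0 gen_th (subsetP GP _ eG) ei.
set x1 := aff 1 be.
have x1G : x1 \in G by apply: (subsetP SG); apply: (aff_PSL sF).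
have reach4 : nreach s [:: e, b, c, x1 & r].
  apply: nreach_trans reach3 _.
  exact: (nreach_fourth gens3 (gens_cat3 gens3 rG)).
have inG u : u \in [:: e; b; c] -> u \in G by move=> ue; rewrite -gens3; apply: mem_gens.
(* [A] contains [e * x1], whose invariant is the one of [good_trace], and [e] supplies surjectivity
   modulo PSL(2,F). *)
have full (A : {group {perm option L}}) : A \subset G -> e \in A -> x1 \in A ->
    A = G \/ #|A| = 60%N.
  move=> AG eA xA; have wA : mob ta tb tc td \in A by rewrite -wE groupM.
  case: (unip_subgroup L2 sF fixF GP gen_th AG be0 xA eA ei D wA tauE); last by right.
  move=> SA; left; apply: (surj_mod_PSL_eq sF GP SA AG).
  case/orP: eS => [GS|eS]; apply/orP; [by left | right].
  by apply/subsetPn; exists e.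
have sub3 u : u \in [:: b; c] -> gens [:: e; x1; u] \subset G.
  move=> ubc; apply/gens_subP => h; rewrite 3!in_cons orbF => /or3P[] /eqP -> //.
  by apply: inG; rewrite in_cons ubc orbT.
have [w wbc gensw] : exists2 w, w \in [:: b; c] & gens [:: e; x1; w] = G.
  have EG : gens [:: e; x1] \subset G.
    by apply/gens_subP => h; rewrite 2!in_cons orbF => /orP[] /eqP ->.
  have eE : e \in gens [:: e; x1] by rewrite mem_gens // in_cons eqxx.
  have xE : x1 \in gens [:: e; x1] by rewrite mem_gens // !in_cons eqxx orbT.
  have subE u : gens [:: e; x1] \subset gens [:: e; x1; u].
    by apply: gensS => h; rewrite 3!in_cons 2!in_cons => /or3P[] // ->; rewrite ?orbT.
  have [E1|EnG] := eqVneq (gens [:: e; x1]) G.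
    exists b; first by rewrite in_cons eqxx.
    by apply/val_inj/eqP; rewrite eqEsubset (sub3 b (mem_head _ _)) -E1 subE.
  have E1 : #|gens [:: e; x1]| = 60%N.
    by case: (full _ EG eE xE) => // E1; rewrite E1 eqxx in EnG.
  have /allPn[w wbc wE'] : ~~ all (fun u => u \in gens [:: e; x1]) [:: b; c].
    apply: contra EnG => /allP bcE; apply/eqP/val_inj/eqP; rewrite eqEsubset EG -gens3.
    by apply/gens_subP => u; rewrite in_cons => /orP[/eqP->|/bcE].
  exists w => //.
  (* Order 60 a second time would mean that [w] already lies in [<e, x1>]. *)
  have [//|E2] := full (gens [:: e; x1; w]) (sub3 w wbc) (subsetP (subE w) _ eE) (subsetP (subE w) _ xE).
  case/negP: wE'; have /eqP -> : gens [:: e; x1] == gens [:: e; x1; w].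
    by rewrite -val_eqE eqEcard subE E1 E2.
  by rewrite mem_gens // !in_cons eqxx !orbT.
move: wbc; rewrite 2!in_cons orbF => /orP[] /eqP wE'.
  exists e, be, w, c, r; split=> //; rewrite wE'; apply: nreach_trans reach4 (nreach_perm _).
  by rewrite perm_cons (perm_catCA [:: b; c] [:: x1] r).
exists e, be, w, b, r; split=> //; rewrite wE'; apply: nreach_trans reach4 (nreach_perm _).
by rewrite perm_cons perm_swap13.
Qed.

Theorem PSL_PGL_nielsen_connected k : (3 < k)%N -> nielsen_connected G k.
Proof.
move=> k4; have [th thF [th0 gen_th]] := sf_generator sF.
have [ep [epF ep0 epG epS ep_th]] := torus_generator L2 sF SG GP thF th0 gen_th.
have flag g b := flag_generates L2 sF SG GP gen_th ep0 epG epS ep_th (g := g) (b := b).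
have l1 : low 1 None != None :> option L.
  by rewrite mob_fix_inf ?oner_neq0 // mulr1 mulr0 subr0 oner_neq0.
have l1G : low 1 \in G by apply: (subsetP SG); apply: (low_PSL sF (sf1 sF)).
have u1G : aff 1 1 \in G by apply: (subsetP SG); apply: (aff_PSL sF (sf1 sF)).
have gens0 := flag _ _ l1G l1 (sf1 sF) (oner_neq0 L).
have nG (n : nat) : {subset nseq n (1%g : {perm option L}) <= G}.
  by move=> z /nseqP[-> _]; apply: group1.
exists [:: low 1, aff 1 1, aff ep 0 & nseq (k - 3) 1%g]; split.
- by rewrite /= size_nseq; move: k4; clear; lia.
- by rewrite (gens_cat3 gens0 (nG _)).
move=> s sk sG'; have sG : gens s = G by apply: val_inj.
have [|a [be [w [v [r [reach1 gens1 beF be0 ai]]]]]] := unipotent_triple sG; first by rewrite sk.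
have sub1 := gens_subG sG reach1.
have aG : a \in G by apply: sub1; rewrite in_cons eqxx.
have wG : w \in G by apply: sub1; rewrite !in_cons eqxx !orbT.
have vG : v \in G by apply: sub1; rewrite !in_cons eqxx !orbT.
have rG : {subset r <= G} by move=> u ur; apply: sub1; rewrite !in_cons ur !orbT.
have beG : aff 1 be \in G by apply: (subsetP SG); apply: (aff_PSL sF beF).
have gens2 := flag _ _ aG ai beF be0.
have gens3 := flag _ _ l1G l1 beF be0.
have gens4 := flag _ _ l1G l1 (sf1 sF) (oner_neq0 L).
have sz : size r = (k - 4)%N by have := nreach_size reach1; rewrite sk /= => ->; rewrite !subSS subn0.
have fourth (x y z u t : {perm option L}) := @nreach_fourth _ G x y z u t r.
(* At each stage three entries generate [G], and the fourth is exchanged for a standard one: [v] for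
   the homothety, [w] for [low 1], [a] for [aff 1 1]. The translation by [be] finally joins the
   trivial tail. *)
apply: nreach_trans reach1 _.
apply: nreach_trans (fourth _ _ _ _ (aff ep 0) gens1 (gens_cat3 gens1 rG) vG epG) _.
apply: nreach_trans (nreach_perm (perm_swap34 _ _ _ _ _)) _.
apply: nreach_trans (fourth _ _ _ _ (low 1) gens2 (gens_cat3 gens2 rG) wG l1G) _.
apply: nreach_trans (nreach_perm (perm_swap14 _ _ _ _ _)) _.
apply: nreach_trans (fourth _ _ _ _ (aff 1 1) gens3 (gens_cat3 gens3 rG) aG u1G) _.
apply: nreach_trans (nreach_perm (perm_swap24 _ _ _ _ _)) _.
have rbG : {subset aff 1 be :: r <= G} by move=> z; rewrite in_cons => /orP[/eqP->|/rG].
have := nreach_trivial_tail gens4 rbG.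
have -> : size (aff 1 be :: r) = (k - 3)%N by rewrite /= sz; move: k4; clear; lia.
by [].
Qed.

End Connected.

(** * From matrices to permutations *)

Section Extension.

Local Open Scope ring_scope.
Import GRing.Theory.

(** A splitting field of the product of all monic quadratic polynomials over [F]. *)
Lemma quadratic_extension (F : finFieldType) : exists (L : finFieldType)
  (iota : {rmorphism F -> L}), forall a b : F, exists z : L, z ^+ 2 + iota a * z + iota b = 0.
Proof.
pose q (u : F * F) : {poly F} := 'X^2 + (u.1 *: 'X + u.2%:P).
have sq u : size (q u) = 3.
  rewrite /q size_polyDl ?size_polyXn //; apply: leq_ltn_trans (size_polyD _ _) _.
  rewrite gtn_max (leq_ltn_trans (size_scale_leq _ _)) ?size_polyX //.
  by rewrite (leq_ltn_trans (size_polyC_leq1 _)).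
have p0 : \prod_u q u != 0.
  by apply/prodf_neq0 => u _; rewrite -size_poly_eq0 sq.
have [L [rs splitp _]] := FinSplittingFieldFor p0.
pose Lf : finFieldType := FinFieldExtType L.
exists Lf, (in_alg L : {rmorphism F -> Lf}) => a b.
have : map_poly (in_alg L) (q (a, b)) %| \prod_(z <- rs) ('X - z%:P).
  rewrite -(eqp_dvdr _ splitp) (bigD1 (a, b)) //= rmorphM.
  exact: dvdp_mulr.
case/dvdp_prod_XsubC => m.
have s3 : size (map_poly (in_alg L) (q (a, b))) = 3 by rewrite size_map_poly sq.
case: (mask m rs) => [|z t] E.
  by have := eqp_size E; rewrite big_nil size_poly1 s3.
exists z; have : root (map_poly (in_alg L) (q (a, b))) z.
  by rewrite (eqp_root E) big_cons rootM root_XsubC eqxx.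
rewrite /root /q rmorphD rmorphD /= map_polyXn map_polyZ map_polyX map_polyC /= !hornerE.
by move/eqP=> zE; exact: zE.
Qed.

Lemma odd_char2 (F : finFieldType) p e : prime p -> (0 < e)%N -> #|F| = (p ^ e)%N ->
  odd (p ^ e) -> (2%:R : F) != 0.
Proof.
move=> pr_p e_gt0 cardF; apply: contraTneq => two0.
have char2 : 2 \in [pchar F] by rewrite inE two0 /=.
have := pcharf_eq char2 p; rewrite (card_finPcharP cardF pr_p) => /esym/eqP ->.
by rewrite oddX eqn0Ngt e_gt0.
Qed.

End Extension.

Section Interface.

Local Open Scope ring_scope.
Import GRing.Theory.

Variables (F L : finFieldType) (iota : {rmorphism F -> L}).
Hypothesis F2 : (2%:R : F) != 0.
Hypothesis split2 : forall a b : F, exists z : L, z ^+ 2 + iota a * z + iota b = 0.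

Let K : {set L} := [set iota x | x : F].

Lemma image_subfield : subfield K.
Proof.
split=> [|_ _ /imsetP[x _ ->] /imsetP[y _ ->]|_ _ /imsetP[x _ ->] /imsetP[y _ ->]].
- by apply/imsetP; exists 1; rewrite ?rmorph1.
- by apply/imsetP; exists (x - y); rewrite ?rmorphB.
- by apply/imsetP; exists (x * y); rewrite ?rmorphM.
Qed.

Lemma iota_K x : iota x \in K.
Proof. by apply/imsetP; exists x. Qed.

Lemma image_char2 : (2%:R : L) != 0.
Proof. by rewrite -(rmorph_nat iota) fmorph_eq0. Qed.

(** Finite fixed points are the roots of b z^2 + (d - a) z - c, which has a root in [L] when [b] is
    nonzero. *)
Lemma image_fix : {in PGLset K, forall g, (0 < #|fixs g|)%N}.
Proof.
move=> g /PGLsetP[a [b [c [d [/and4P[aK bK cK dK] D ->]]]]]; apply/card_gt0P.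
have [b0|b0] := eqVneq b 0; first by exists None; rewrite inE mob_fix_inf // b0.
have sK := image_subfield.
have /imsetP[u _ uE] : (d - a) / b \in K by apply: (sf_div sK) => //; apply: (sfB sK).
have /imsetP[v _ vE] : - c / b \in K by apply: (sf_div sK) => //; apply: (sfN sK).
have [z] := split2 u v; rewrite -uE -vE => zE.
exists (Some z); rewrite inE mob_fix_Some //; apply/eqP.
by apply: (eq_by1 (m := - b) zE); field.
Qed.

Definition gl_mob (u : {'GL_2[F]}) : {perm option L} :=
  mob (iota (GLval u 0 0)) (iota (GLval u 0 1)) (iota (GLval u 1 0)) (iota (GLval u 1 1)).

Lemma det_mx22 (A : 'M[F]_2) : \det A = A 0 0 * A 1 1 - A 0 1 * A 1 0.
Proof.
rewrite (expand_det_row _ 0) big_ord_recl big_ord1 /cofactor !det_mx11 !mxE /=.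
rewrite expr0 mul1r expr1 mulN1r mulrN.
by congr (A _ _ * A _ _ - A _ _ * A _ _); apply: val_inj.
Qed.

Lemma gl_det (u : {'GL_2[F]}) :
  iota (GLval u 0 0) * iota (GLval u 1 1) - iota (GLval u 0 1) * iota (GLval u 1 0) =
  iota (\det (GLval u)).
Proof. by rewrite det_mx22 rmorphB !rmorphM. Qed.

Lemma gl_det_neq0 (u : {'GL_2[F]}) :
  iota (GLval u 0 0) * iota (GLval u 1 1) - iota (GLval u 0 1) * iota (GLval u 1 0) != 0.
Proof. by rewrite gl_det fmorph_eq0 GL_det. Qed.

Lemma GL_mul22 (u v : {'GL_2[F]}) i j :
  GLval (u * v) i j = GLval u i 0 * GLval v 0 j + GLval u i 1 * GLval v 1 j.
Proof.
rewrite GL_MxE mxE big_ord_recl big_ord1.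
by have -> : lift ord0 ord0 = 1 :> 'I_2 by apply: val_inj.
Qed.

Lemma gl_mobM : {in [set: {'GL_2[F]}] &, {morph gl_mob : u v / (u * v)%g}}.
Proof.
move=> u v _ _; rewrite /gl_mob mobM ?gl_det_neq0 //.
by rewrite !GL_mul22 !rmorphD !rmorphM.
Qed.

Canonical gl_mob_morphism := Morphism gl_mobM.

Lemma gl_exists (a b c d : F) : a * d - b * c != 0 -> exists u : {'GL_2[F]},
  [/\ GLval u 0 0 = a, GLval u 0 1 = b, GLval u 1 0 = c & GLval u 1 1 = d].
Proof.
move=> D; pose A : 'M[F]_2 := \matrix_(i, j) if i == 0 then (if j == 0 then a else b)
  else (if j == 0 then c else d).
have AU : A \is a GRing.unit by rewrite -[_ \is a _]/(A \in unitmx) unitmxE det_mx22 !mxE /= unitfE.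
by exists (FinRing.Unit AU); rewrite /= !mxE.
Qed.

Lemma gl_mob_GL : gl_mob @* 'GL_2[F] = PGLset K.
Proof.
apply/setP=> g; apply/morphimP/PGLsetP => [[u _ _ ->]|[a [b [c [d [F4 D ->]]]]]].
  by do 4!eexists; split; last by []; rewrite ?iota_K ?gl_det_neq0.
case/and4P: F4 D => /imsetP[a' _ ->] /imsetP[b' _ ->] /imsetP[c' _ ->] /imsetP[d' _ ->].
rewrite -!rmorphM -rmorphB fmorph_eq0 => /gl_exists[u [<- <- <- <-]].
by exists u; rewrite ?inE.
Qed.

Lemma gl_mob_SL : gl_mob @* SL2 F = PSLset K.
Proof.
apply/setP=> g; apply/morphimP/PSLsetP => [[u _ uSL ->]|[a [b [c [d [F4 D ->]]]]]].
  do 4!eexists; split; last by []; first by rewrite !iota_K.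
  by rewrite gl_det; move: uSL; rewrite inE => /eqP ->; rewrite rmorph1.
case/and4P: F4 D => /imsetP[a' _ ->] /imsetP[b' _ ->] /imsetP[c' _ ->] /imsetP[d' _ ->].
rewrite -!rmorphM -rmorphB => /eqP; rewrite fmorph_eq1 => /eqP D.
have [u [ua ub uc ud]] : exists u : {'GL_2[F]},
    [/\ GLval u 0 0 = a', GLval u 0 1 = b', GLval u 1 0 = c' & GLval u 1 1 = d'].
  by apply: gl_exists; rewrite D oner_neq0.
by exists u; rewrite /= ?inE ?det_mx22 /gl_mob ?ua ?ub ?uc ?ud ?D.
Qed.

Lemma ord2P (i : 'I_2) : i = 0 \/ i = 1.
Proof. by case: i => [[|[|//]] lti]; [left | right]; apply: val_inj. Qed.

Lemma gl_mob_eq1 (u : {'GL_2[F]}) : gl_mob u = 1%g ->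
  [/\ GLval u 0 1 = 0, GLval u 1 0 = 0 & GLval u 0 0 = GLval u 1 1].
Proof.
rewrite -mob1 => E; have D1 : 1 * 1 - 0 * 0 != 0 :> L by rewrite mulr1 mulr0 subr0 oner_neq0.
have [k k0 [aE bE cE dE]] := mob_inj D1 (gl_det_neq0 u) (esym E).
rewrite mulr1 in aE; rewrite mulr0 in bE; rewrite mulr0 in cE; rewrite mulr1 in dE.
split; apply/eqP; first by rewrite -(fmorph_eq0 iota) bE.
  by rewrite -(fmorph_eq0 iota) cE.
by rewrite -(inj_eq (fmorph_inj iota)) aE dE.
Qed.

(** Both sides are the scalar matrices of [A]: commuting with the two elementary matrices [e] and
    [f] of [SL2 F] already forces a matrix to be scalar. *)
Lemma ker_center (A : {group {'GL_2[F]}}) : SL2 F \subset A ->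
  'ker_A gl_mob = 'Z(A).
Proof.
move=> SA; apply/setP=> u; rewrite in_setI; apply/andP/centerP => [[uA]|[uA cu]].
  rewrite (sameP (kerP _ (in_setT u)) eqP) => /eqP/gl_mob_eq1[u01 u10 u00].
  split=> // v _; apply: val_inj; rewrite /= -[val u]/(GLval u) -[val v]/(GLval v).
  have -> : GLval u = (GLval u 0 0)%:M.
    by apply/matrixP=> i j; rewrite mxE; case: (ord2P i) => ->; case: (ord2P j) => ->;
      rewrite /= ?mulr1n ?mulr0n.
  by rewrite -[LHS]/(_ *m GLval v) -[RHS]/(GLval v *m _) scalar_mxC.
split=> //; apply/kerP; first exact: in_setT.
have D1 : 1 * 1 - 1 * 0 = 1 :> F by rewrite mulr1 mulr0 subr0.
have D2 : 1 * 1 - 0 * 1 = 1 :> F by rewrite mulr1 mul0r subr0.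
have [e [ea eb ec ed]] : exists e : {'GL_2[F]},
    [/\ GLval e 0 0 = 1, GLval e 0 1 = 1, GLval e 1 0 = 0 & GLval e 1 1 = 1].
  by apply: gl_exists; rewrite D1 oner_neq0.
have [f [fa fb fc fd]] : exists e : {'GL_2[F]},
    [/\ GLval e 0 0 = 1, GLval e 0 1 = 0, GLval e 1 0 = 1 & GLval e 1 1 = 1].
  by apply: gl_exists; rewrite D2 oner_neq0.
have eA : e \in A by apply: (subsetP SA); rewrite inE det_mx22 ea eb ec ed D1.
have fA : f \in A by apply: (subsetP SA); rewrite inE det_mx22 fa fb fc fd D2.
have comm v i j : v \in A -> GLval (u * v) i j = GLval (v * u) i j.
  by move=> vA; rewrite (cu v vA).
have := comm e 0 0 eA; have := comm e 0 1 eA; have := comm f 0 0 fA.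
rewrite !GL_mul22 ea eb ec ed fa fb fc !(mul0r, mulr0, mul1r, mulr1, addr0, add0r).
move=> u01 u11 u10.
have {}u01 : GLval u 0 1 = 0 by apply: (addrI (GLval u 0 0)); rewrite u01 addr0.
have {}u10 : GLval u 1 0 = 0.
  by apply: (addrI (GLval u 0 0)); rewrite -u10 addr0.
have {}u11 : GLval u 1 1 = GLval u 0 0.
  by apply: (addrI (GLval u 0 1)); rewrite -u11 addrC.
have u00 : iota (GLval u 0 0) != 0.
  by have := gl_det_neq0 u; rewrite u01 u11 rmorph0 mul0r subr0 mulf_eq0 negb_or => /andP[].
rewrite /= /gl_mob u01 u10 u11 rmorph0 -mob1.
transitivity (mob (iota (GLval u 0 0) * 1) (iota (GLval u 0 0) * 0)
  (iota (GLval u 0 0) * 0) (iota (GLval u 0 0) * 1)); last exact: mob_scale.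
by rewrite mulr0 mulr1.
Qed.

Lemma PSL2_isog : PSLset K \isog PSL2 F.
Proof.
have := first_isog_loc gl_mob_morphism (subsetT (SL2_group F)).
by rewrite (ker_center (subxx _)) -gl_mob_SL isog_sym.
Qed.

Lemma PGL2_isog : PGLset K \isog PGL2 F.
Proof.
have := first_isog_loc gl_mob_morphism (subsetT ('GL_2[F])%G).
by rewrite (ker_center (subsetT _)) -gl_mob_GL isog_sym.
Qed.

End Interface.

(* In [group_scope] the power of natural numbers would be read as a conjugate. *)
Local Close Scope group_scope.

Theorem theorem1 (q : nat) (F : finFieldType) (k : nat)
  (q_prime_power : exists p e : nat, [/\ prime p, 0 < e & q = p ^ e])
  (q_odd : odd q) (cardF : #|F| = q) (k_ge4 : 4 <= k) :
  extended_PRA_connected (PSL2 F) k /\ extended_PRA_connected (PGL2 F) k.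
Proof.
have F2 : (2%:R != 0 :> F)%R.
  by have [p [e [pr_p e_gt0 qE]]] := q_prime_power; apply: (odd_char2 pr_p e_gt0); rewrite -qE.
have [L [iota split2]] := quadratic_extension F.
have L2 := image_char2 iota F2; have sK := image_subfield iota.
have fixK := image_fix split2.
have SP := PSL_PGL [set iota x | x : F].
split; apply: extended_PRA_connected_nielsen; rewrite ?(ltn_trans _ k_ge4) //.
  apply: (nielsen_connected_isog (H := PSLgroup sK)); first exact: PSL2_isog.
  exact: (PSL_PGL_nielsen_connected L2 sK fixK (G := PSLgroup sK) (subxx _) SP).
apply: (nielsen_connected_isog (H := PGLgroup sK)); first exact: PGL2_isog.
exact: (PSL_PGL_nielsen_connected L2 sK fixK (G := PGLgroup sK) SP (subxx _)).
Qed.
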